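(* Suppose that Assumption A and Assumption S (stated in the context) hold. Consider the sphere-smoothed variant of DSA-PGM (described in the context), which projects onto $\Theta_\delta^{\mathrm{sp}}$, with stepsize $0<\alpha\le1/L_{\mathcal L}^{\mathrm{sm}}$, where $$L_{\mathcal L}^{\mathrm{sm}} := L_{\ell,\theta}^{\mathrm{sm}} + L_{\ell,\theta}^{\mathrm{Lip}} L_{\beta,\theta}^{\mathrm{Lip}}\sqrt{I_{\max}} + L_{\beta,\theta}^{\mathrm{sm}}\sqrt{M_\ell I_{\max}} + L_{\beta,\theta}^{\mathrm{Lip}}\left(L_{G,\beta}^{\mathrm{Lip}} L_{\beta,\theta}^{\mathrm{Lip}} + L_{G,\theta}^{\mathrm{Lip}}\right).$$ Let $$C_1 := 3\left((L_{\ell,\theta}^{\mathrm{Lip}})^2 I_{\max} + (L_{\beta,\theta}^{\mathrm{Lip}} L_{G,\beta}^{\mathrm{Lip}})^2\right)\sigma_{\max}^2,$$ $$C_2' := 3M_\ell I_{\max}\left(\frac{3\sigma_{\max}^2}{b_{\min}}+3(L_{\beta,\theta}^{\mathrm H})^2+\frac{(L_{\beta,\theta}^{\mathrm H})^2}{6}+18(L_{\beta,\theta}^{\mathrm{Lip}})^2\right).$$ For any $\epsilon>0$, choose $b_{\mathrm{sp}}=nb$ and $\delta=n^{1/6}b^{-1/6}$, initialize at $\theta_0\in\Theta_\delta^{\mathrm{sp}}$, and choose $T$ and $b$ as the smallest positive integers satisfying $$T\ge\frac{6(\mathcal L(\theta_0)-\mathcal L_* )}{\alpha\epsilon^2},\qquad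 b\ge\max\left(b_{\min},\ n,\ \frac{3C_1}{\epsilon^2},\ \frac{n(3C_2')^{1.5}}{\epsilon^3}\right).$$ Then $$\frac1T\sum_{t=0}^{T-1}\mathbb E\left[\|\mathcal G_\alpha(\theta_t)\|^2\right]\le\epsilon^2,$$ and the total sample complexity of the variant (the total number of samples used over $T$ iterations, $T(b+2b_{\mathrm{sp}}b_{\min})$) is $O(n^2\epsilon^{-5})$.
   Context: Setting. $n,m,d$ are positive integers; $\|\cdot\|$ is the Euclidean norm for vectors and the induced (operator) norm for matrices and for derivative tensors. $\Theta\subseteq\mathbb R^n$ is the model parameter set, $\beta:\mathbb R^n\to\mathbb R^m$ the distribution parameter mapping with $m\times n$ Jacobian $\frac{\partial\beta}{\partial\theta}$, $B\subseteq\mathbb R^m$ the distribution parameter space, and $\ell:\mathbb R^d\times\mathbb R^n\to\mathbb R$, $(z,\theta)\mapsto\ell(z;\theta)$, the loss. $\{\mathcal D_{\beta_0}\}_{\beta_0\in B}$ is a family of probability distributions on a data space $\mathcal Z\subseteq\mathbb R^d$, dominated by a common $\sigma$-finite measure $\mu$, with densities $p(\cdot;\beta_0)$. $\mathrm{Pred}$ is an estimator mapping a finite dataset to an element of $B$. For $\delta>0$, with $e_i$ the standard basis vectors of $\mathbb R^n$ and $\mathbb S^{n-1}$ the unit sphere of $\mathbb R^n$, $$\Theta_\delta:=\{\theta\in\Theta:\theta\pm\delta e_i\in\Theta,\ i=1,\dots,n\},\qquad \Theta_\delta^{\mathrm{sp}}:=\{\theta\in\Theta:\theta\pm\delta u\in\Theta\text{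 for every }u\in\mathbb S^{n-1}\}.$$ Define the score $s(z;\beta_0):=\nabla_\beta\ln p(z;\beta_0)$, $G(\theta;\beta_0):=\mathbb E_{z\sim\mathcal D_{\beta_0}}[\ell(z;\theta)s(z;\beta_0)]\in\mathbb R^m$, the Fisher information $I(\beta_0):=\mathbb E_{z\sim\mathcal D_{\beta_0}}[s(z;\beta_0)s(z;\beta_0)^\top]$, and the performative loss $\mathcal L(\theta):=\mathbb E_{z\sim\mathcal D_{\beta(\theta)}}[\ell(z;\theta)]$. Its gradient is $\nabla\mathcal L(\theta)=\nabla_1\mathcal L(\theta)+\nabla_2\mathcal L(\theta)$ with $\nabla_1\mathcal L(\theta)=\mathbb E_{z\sim\mathcal D_{\beta(\theta)}}[\nabla_\theta\ell(z;\theta)]$ and $\nabla_2\mathcal L(\theta)=\frac{\partial\beta}{\partial\theta}(\theta)^\top G(\theta;\beta(\theta))$. Assumption A. (1) $\Theta$ and $\Theta_\delta$ (for the perturbation radius $\delta$ used) are nonempty, closed, convex and compact. (2) $B$ is convex and compact, and $\beta(\Theta)\subseteq B$. (3) $\beta$ is $C^3$. (4) The densities $\{p(\cdot;\beta_0)\}_{\beta_0\in B}$ have common support, $p(z;\cdot)$ is $C^2$ on $B$, and differentiation under the integral sign with respect to $\beta_0$ is valid (for the integrals $\int p\,d\mu$, $\int\ell\,p\,d\mu$, $\int\ell\,s\,p\,d\mu$). (5) There are finite constants $K_1,K_2\ge0$ and integers $q_1,q_2\ge0$ with $\|s(z;\beta_0)\|\le K_1(1+\|z\|^{q_1})$ and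 $\|\frac{\partial}{\partial\beta}s(z;\beta_0)\|\le K_2(1+\|z\|^{q_2})$ for all $z$ and $\beta_0\in B$. (6) $\ell$ is $C^2$, and there are finite constants $K_3,K_4,K_5\ge0$ and integers $q_3,q_4,q_5\ge0$ with $|\ell(z;\theta)|\le K_3(1+\|z\|^{q_3})$, $\|\nabla_\theta\ell(z;\theta)\|\le K_4(1+\|z\|^{q_4})$, $\|\nabla_\theta^2\ell(z;\theta)\|\le K_5(1+\|z\|^{q_5})$ for all $z$ and $\theta\in\Theta$. (7) With $q_{\max}:=\max\{2q_1+q_3,\ q_2+q_3,\ 2q_3,\ 2q_4,\ q_1+q_4,\ q_5\}$, there are constants $M_k<\infty$ with $\sup_{\beta_0\in B}\mathbb E_{z\sim\mathcal D_{\beta_0}}[\|z\|^k]\le M_k$ for $0\le k\le q_{\max}$. (8) There are $\sigma_{\max}\ge0$ and $b_{\min}\in\mathbb N$ such that for every $\theta\in\Theta$ and $b\ge b_{\min}$, the estimator $\hat\beta=\mathrm{Pred}(\{z_i\}_{i=1}^b)\in B$ built from i.i.d. samples $z_i\sim\mathcal D_{\beta(\theta)}$ satisfies $\mathbb E[\|\hat\beta-\beta(\theta)\|^2]\le\sigma_{\max}^2/b$. Constants. $\mathcal L_*:=\inf_{\theta\in\Theta}\mathcal L(\theta)>-\infty$, and $L_{\ell,\theta}^{\mathrm{Lip}},L_{\ell,\theta}^{\mathrm{sm}},L_{\beta,\theta}^{\mathrm{Lip}},L_{\beta,\theta}^{\mathrm{sm}},L_{\beta,\theta}^{\mathrm H},L_{G,\beta}^{\mathrm{Lip}},L_{G,\theta}^{\mathrm{Lip}},M_\ell,I_{\max}\ge0$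 are finite constants such that for all $\theta,\theta'\in\Theta$ and $\beta_0,\beta_0'\in B$: $\sup_{\beta_1\in B}\mathbb E_{z\sim\mathcal D_{\beta_1}}[\|\nabla_\theta\ell(z;\theta)\|^2]^{1/2}\le L_{\ell,\theta}^{\mathrm{Lip}}$; $\mathbb E_{z\sim\mathcal D_{\beta(\theta)}}[\|\nabla_\theta\ell(z;\theta)-\nabla_\theta\ell(z;\theta')\|]\le L_{\ell,\theta}^{\mathrm{sm}}\|\theta-\theta'\|$; $\|\beta(\theta)-\beta(\theta')\|\le L_{\beta,\theta}^{\mathrm{Lip}}\|\theta-\theta'\|$; $\|\frac{\partial\beta}{\partial\theta}(\theta)-\frac{\partial\beta}{\partial\theta}(\theta')\|\le L_{\beta,\theta}^{\mathrm{sm}}\|\theta-\theta'\|$; $\|\frac{\partial^2\beta}{\partial\theta^2}(\theta)-\frac{\partial^2\beta}{\partial\theta^2}(\theta')\|\le L_{\beta,\theta}^{\mathrm H}\|\theta-\theta'\|$; $\|G(\theta;\beta_0)-G(\theta';\beta_0')\|\le L_{G,\beta}^{\mathrm{Lip}}\|\beta_0-\beta_0'\|+L_{G,\theta}^{\mathrm{Lip}}\|\theta-\theta'\|$; $\mathrm{Var}_{z\sim\mathcal D_{\beta_0}}[\ell(z;\theta)]\le M_\ell$; $\mathrm{Tr}(I(\beta_0))\le I_{\max}$. Assumption S. The set $\Theta_\delta^{\mathrm{sp}}$ is nonempty. The estimator is conditionally unbiased given the model parameter: $\mathbb E[\hat\beta-\beta(\theta)\mid\theta]=0$. For every $\theta,\theta'\in\Theta$,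 $b\ge b_{\min}$ and $1\le j\le m$ (with $(\cdot)_j$ the $j$-th component and $\hat\beta=\mathrm{Pred}$ of $b$ i.i.d. samples from $\mathcal D_{\beta(\theta)}$), $$\mathbb E[|\hat\beta_j-\beta(\theta)_j|^2\mid\theta]\le\frac{\sigma_{\max,j}^2}{b},\qquad \|\nabla_\theta^2\beta_j(\theta)-\nabla_\theta^2\beta_j(\theta')\|\le L_{\beta,\theta,j}^{\mathrm H}\|\theta-\theta'\|,$$ where $\sigma_{\max}^2=\sum_{j=1}^m\sigma_{\max,j}^2$ and $L_{\beta,\theta}^{\mathrm H}=\sqrt{\sum_{j=1}^m(L_{\beta,\theta,j}^{\mathrm H})^2}$. Sphere-smoothed variant of DSA-PGM. Inputs: $\theta_0\in\Theta_\delta^{\mathrm{sp}}$, $b,b_{\mathrm{sp}}\in\mathbb N$, $\delta>0$, $\alpha>0$. At each iteration $t=0,1,2,\dots$, given $\theta_t$ (all randomness fresh conditionally on the past): draw i.i.d. $\{z_{t,j}\}_{j=1}^b\sim\mathcal D_{\beta(\theta_t)}$ and set $\hat\beta_t=\mathrm{Pred}(\{z_{t,j}\}_{j=1}^b)$; draw independent directions $u_t^1,\dots,u_t^{b_{\mathrm{sp}}}\sim\mathrm{Unif}(\mathbb S^{n-1})$; for each $i$ draw i.i.d. $z_{t,i,j}^\pm\sim\mathcal D_{\beta(\theta_t\pm\delta u_t^i)}$, $j=1,\dots,b_{\min}$ (conditional on the directions, datasets for different directions and signs are mutually independent), set $\hat\beta_{t,i}^\pm=\mathrm{Pred}(\{z_{t,i,j}^\pm\}_{j=1}^{b_{\min}})$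 and $$\widehat{\tfrac{\partial\beta}{\partial\theta}}(\theta_t)=\frac{n}{b_{\mathrm{sp}}}\sum_{i=1}^{b_{\mathrm{sp}}}\frac{\hat\beta_{t,i}^+-\hat\beta_{t,i}^-}{2\delta}(u_t^i)^\top;$$ set $\widehat{\nabla\mathcal L}(\theta_t)=\mathbb E_{z\sim\mathcal D_{\hat\beta_t}}[\nabla_\theta\ell(z;\theta_t)]+\widehat{\frac{\partial\beta}{\partial\theta}}(\theta_t)^\top G(\theta_t;\hat\beta_t)$ (expectations over $\mathcal D_{\hat\beta_t}$ computed exactly) and $\theta_{t+1}=\mathrm{Proj}(\theta_t-\alpha\widehat{\nabla\mathcal L}(\theta_t))$, with $\mathrm{Proj}$ the Euclidean projection onto $\Theta_\delta^{\mathrm{sp}}$. Gradient mapping (with this projection): $\mathcal G_\alpha(\theta):=\frac1\alpha\left(\theta-\mathrm{Proj}(\theta-\alpha\nabla\mathcal L(\theta))\right)$. In the $O(\cdot)$ bound, $\epsilon$ is bounded above (e.g. $0<\epsilon\le1$) and the quantities $\alpha$, $\mathcal L(\theta_0)-\mathcal L_*$, $b_{\min}$, $C_1$, $C_2'$ are treated as constants independent of $n$ and $\epsilon$. *)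

(* Defs.v *)
(* Vectors of R^k are column vectors 'cV[R]_k.  Their library norm `|x| is the
   sup norm, hence the separate Euclidean norm [enorm] below; topology and
   derivatives do not depend on the choice. *)
From HB Require Import structures.
From mathcomp Require Import all_boot all_order all_algebra.
From mathcomp Require Import all_classical all_reals all_analysis.

Set Implicit Arguments.
Unset Strict Implicit.
Unset Printing Implicit Defensive.

Import Order.TTheory GRing.Theory Num.Theory.
Import numFieldNormedType.Exports.

Local Open Scope classical_set_scope.
Local Open Scope ring_scope.

(* the Borel sigma-algebra *)
HB.instance Definition _ (R : realType) (k l : nat) :=
  @isMeasurable.Build (sigma_display (@open 'M[R]_(k, l))) 'M[R]_(k, l)
    <<s @open 'M[R]_(k, l) >> (@sigma_algebra0 _ setT _) (@sigma_algebraC _ _)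
    (@sigma_algebra_bigcup _ setT _).

Section Euclidean.
Context {R : realType}.

Definition enorm {k : nat} (x : 'cV[R]_k) : R :=
  Num.sqrt (\sum_(i < k) x i 0 ^+ 2).

Definition opnorm {k l : nat} (A : 'M[R]_(k, l)) : R :=
  sup [set enorm (A *m x) | x in [set x | enorm x <= 1]].

Definition bilnorm {k l : nat} (T : 'cV[R]_k -> 'cV[R]_k -> 'cV[R]_l) : R :=
  sup [set enorm (T xy.1 xy.2) |
       xy in [set xy | enorm xy.1 <= 1 /\ enorm xy.2 <= 1]].

Definition ebasis {k : nat} (i : 'I_k) : 'cV[R]_k := delta_mx i 0.

Definition sphere {k : nat} : set 'cV[R]_k := [set x | enorm x = 1].

Definition euclid_proj {k : nat} (C : set 'cV[R]_k) (x : 'cV[R]_k) : 'cV[R]_k :=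
  get [set y | C y /\ forall y', C y' -> enorm (x - y) <= enorm (x - y')].

Definition grad {k : nat} (f : 'cV[R]_k -> R) (x : 'cV[R]_k) : 'cV[R]_k :=
  \col_i 'D_(ebasis i) f x.

Definition jac {k l : nat} (f : 'cV[R]_k -> 'cV[R]_l) (x : 'cV[R]_k) :
  'M[R]_(l, k) := \matrix_(i, j) ('D_(ebasis j) f x) i 0.

Definition hess {k : nat} (f : 'cV[R]_k -> R) (x : 'cV[R]_k) : 'M[R]_k :=
  jac (grad f) x.

(* symmetric and bilinear in (u, v) when f is C^2 *)
Definition deriv2 {k l : nat} (f : 'cV[R]_k -> 'cV[R]_l) (x u v : 'cV[R]_k) :
  'cV[R]_l := 'D_u (fun y => 'D_v f y) x.

(* C^r on an open set U: the derivative is C^(r-1) as a map from U to the space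
   of linear maps; in finite dimension this is tested vector by vector. *)
Fixpoint Ck {V W : normedModType R} (r : nat) (U : set V) (f : V -> W) : Prop :=
  match r with
  | 0 => forall x, U x -> {for x, continuous f}
  | r'.+1 => (forall x, U x -> differentiable f x) /\
             (forall v, Ck r' U (fun x => 'D_v f x))
  end.

End Euclidean.

Section Probability.
Context {R : realType}.

Definition expect {dT} {T : measurableType dT} (P : probability T R)
  {k l : nat} (X : T -> 'M[R]_(k, l)) : 'M[R]_(k, l) :=
  \matrix_(i, j) \int[P]_w X w i j.

Section iid.
Context {dT} {T : measurableType dT}.

Definition tcons (b : nat) (x : T * b.-tuple T) : b.+1.-tuple T :=
  [the b.+1.-tuple T of x.1 :: x.2].

Fact measurable_tcons (b : nat) : measurable_fun setT (@tcons b).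
Proof. by move=> mT A mA; exact: (measurable_cons measurable_fst measurable_snd). Qed.

HB.instance Definition _ (b : nat) :=
  isMeasurableFun.Build _ _ _ _ (@tcons b) (@measurable_tcons b).

(* the b-fold product measure: the law of b i.i.d. draws from P *)
Fixpoint iid (P : probability T R) (b : nat) : probability (b.-tuple T) R :=
  match b with
  | 0 => \d_[tuple]
  | b'.+1 => distribution (P \x iid P b')%E (@tcons b')
  end.

End iid.

(* The uniform law on the unit sphere: the orthogonally invariant one. *)
Definition unif_sphere {k : nat} (nu : probability 'cV[R]_k R) :=
  nu sphere = 1%E /\
  forall (Q : 'M[R]_k) (A : set 'cV[R]_k), Q^T *m Q = 1%:M -> measurable A ->
    nu [set x | A (Q *m x)] = nu A.

Section conditional.
Context {dO} {Omega : measurableType dO} (P : probability Omega R).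

Definition sub_sigma_field (F : set (set Omega)) :=
  sigma_algebra setT F /\ F `<=` measurable.

Definition wrt (F : set (set Omega)) {dE} {E : measurableType dE}
  (X : Omega -> E) := forall A : set E, measurable A -> F (X @^-1` A).

(* Given F, the X i are mutually independent and X i has (random) law kappa i. *)
Definition cond_indep_draws (F : set (set Omega)) (I : finType)
    {dE} {E : measurableType dE}
    (X : I -> Omega -> E) (kappa : I -> Omega -> probability E R) :=
  forall (A : set Omega) (S : I -> set E),
    F A -> (forall i, measurable (S i)) ->
    P (A `&` \bigcap_i (X i @^-1` S i)) =
    (\int[P]_(w in A) (\prod_i fine (kappa i w (S i)))%:E)%E.

End conditional.
End Probability.

Record model (R : realType) (n m d : nat) := Model {
  Theta : set 'cV[R]_n ;
  beta : 'cV[R]_n -> 'cV[R]_m ;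
  Bset : set 'cV[R]_m ;
  loss : 'cV[R]_d -> 'cV[R]_n -> R ;
  Zset : set 'cV[R]_d ;
  mu : {sigma_finite_measure set 'cV[R]_d -> \bar R} ;
  dens : 'cV[R]_d -> 'cV[R]_m -> R ;
  Dist : 'cV[R]_m -> probability 'cV[R]_d R ;
  Pred : forall b : nat, b.-tuple 'cV[R]_d -> 'cV[R]_m }.

Section Model.
Context {R : realType} {n m d : nat} (M : model R n m d).

Local Notation beta := (beta M).
Local Notation loss := (loss M).
Local Notation dens := (dens M).

(* Dist and dens are only meaningful for parameters in Bset; densities are
   extended by 0 outside the data space Zset. *)
Record model_setting : Prop := {
  Zset_measurable : measurable (Zset M) ;
  dens_out : forall z b0, ~ Zset M z -> dens z b0 = 0 ;
  dens_ge0 : forall z b0, Bset M b0 -> 0 <= dens z b0 ;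
  dens_measurable : forall b0, Bset M b0 -> measurable_fun setT (dens ^~ b0) ;
  DistE : forall b0 A, Bset M b0 -> measurable A ->
    Dist M b0 A = (\int[mu M]_(z in A) (dens z b0)%:E)%E ;
  Pred_Bset : forall b (s : b.-tuple 'cV[R]_d), Bset M (Pred M s) ;
  Pred_measurable : forall b, measurable_fun setT (@Pred _ _ _ _ M b) }.

Definition Theta_delta (delta : R) : set 'cV[R]_n :=
  [set t | Theta M t /\ forall i, Theta M (t + delta *: ebasis i) /\
                                  Theta M (t - delta *: ebasis i)].

Definition Theta_sp (delta : R) : set 'cV[R]_n :=
  [set t | Theta M t /\ forall u, sphere u ->
     Theta M (t + delta *: u) /\ Theta M (t - delta *: u)].

Definition supp (b0 : 'cV[R]_m) : set 'cV[R]_d := [set z | 0 < dens z b0].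

(* The score is set to 0 outside the support, a null set, where ln (dens z b0)
   is not defined. *)
Definition score (z : 'cV[R]_d) (b0 : 'cV[R]_m) : 'cV[R]_m :=
  if 0 < dens z b0 then grad (fun b => ln (dens z b)) b0 else 0.

Definition Gvec (t : 'cV[R]_n) (b0 : 'cV[R]_m) : 'cV[R]_m :=
  expect (Dist M b0) (fun z => loss z t *: score z b0).

Definition fisher (b0 : 'cV[R]_m) : 'M[R]_m :=
  expect (Dist M b0) (fun z => score z b0 *m (score z b0)^T).

Definition perf_loss (t : 'cV[R]_n) : R := \int[Dist M (beta t)]_z loss z t.

Definition perf_loss_inf : R := inf [set perf_loss t | t in Theta M].

(* On Theta_sp, whose points are interior to Theta, grad perf_loss only involves
   values of perf_loss on Theta. *)
Definition gradmap (C : set 'cV[R]_n) (alpha : R) (t : 'cV[R]_n) : 'cV[R]_n :=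
  alpha^-1 *: (t - euclid_proj C (t - alpha *: grad perf_loss t)).

(* Differentiation of b0 |-> \int f(z; b0) dmu(z) under the integral sign, at
   every b0 in Bset.  Bset being closed and convex, the derivative at b0 is
   taken along the feasible directions b1 - b0 with b1 in Bset.  The integrals
   run over the (common) support, outside which f vanishes on Bset. *)
Definition diff_under_int (f : 'cV[R]_d -> 'cV[R]_m -> R) :=
  forall b0 b1, Bset M b0 -> Bset M b1 ->
    [/\ (mu M).-integrable (supp b0) (fun z => (f z b1)%:E),
        (mu M).-integrable (supp b0) (fun z => ('D_(b1 - b0) (f z) b0)%:E) &
        t^-1 * ((\int[mu M]_(z in supp b0) f z (b0 + t *: (b1 - b0))) -
                (\int[mu M]_(z in supp b0) f z b0)) @[t --> (0 : R)^'+]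
          --> \int[mu M]_(z in supp b0) 'D_(b1 - b0) (f z) b0].

Record assumption_densities : Prop := {
  supp_common : forall b0 b1, Bset M b0 -> Bset M b1 -> supp b0 = supp b1 ;
  (* C^2 on Bset: C^2 on some open neighbourhood of Bset *)
  dens_C2 : exists U : set 'cV[R]_m, [/\ open U, Bset M `<=` U,
    (forall b0, U b0 -> measurable_fun setT (dens ^~ b0)) &
    (forall z, Ck 2 U (dens z))] ;
  diff_int_dens : diff_under_int dens ;
  diff_int_loss : forall t, Theta M t ->
    diff_under_int (fun z b0 => loss z t * dens z b0) ;
  diff_int_score : forall t (i : 'I_m), Theta M t ->
    diff_under_int (fun z b0 => loss z t * score z b0 i 0 * dens z b0) }.

Definition poly_bound (S : set 'cV[R]_d) (K : R) (q : nat) (f : 'cV[R]_d -> R) :=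
  forall z, S z -> f z <= K * (1 + enorm z ^+ q).

(* The score and its derivative are bounded where ln (dens z b0) is defined.  The
   exponents q1, ..., q5 of the growth bounds determine the moments required. *)
Definition assumption_growth : Prop :=
  Ck 2 setT (fun zt : 'cV[R]_d * 'cV[R]_n => loss zt.1 zt.2) /\
  exists (K1 K2 K3 K4 K5 : R) (q1 q2 q3 q4 q5 : nat) (Mk : nat -> R),
  [/\ [/\ 0 <= K1, 0 <= K2, 0 <= K3, 0 <= K4 & 0 <= K5],
      (forall b0, Bset M b0 ->
        poly_bound (supp b0) K1 q1 (fun z => enorm (score z b0)) /\
        poly_bound (supp b0) K2 q2
          (fun z => opnorm (jac (score z) b0))),
      (forall t, Theta M t ->
        [/\ poly_bound (Zset M) K3 q3 (fun z => `|loss z t|),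
            poly_bound (Zset M) K4 q4 (fun z => enorm (grad (loss z) t)) &
            poly_bound (Zset M) K5 q5 (fun z => opnorm (hess (loss z) t))]) &
      let qmax := maxn (2 * q1 + q3) (maxn (q2 + q3) (maxn (2 * q3)
                    (maxn (2 * q4) (maxn (q1 + q4) q5)))) in
      forall k b0, (k <= qmax)%N -> Bset M b0 ->
        (\int[Dist M b0]_z (enorm z ^+ k)%:E <= (Mk k)%:E)%E].

Record assumption_A (delta sigma_max : R) (b_min : nat) : Prop := {
  A_Theta : [/\ Theta M !=set0, closed (Theta M), convex_set (Theta M)
              & compact (Theta M)] ;
  A_Theta_delta :
    [/\ Theta_delta delta !=set0, closed (Theta_delta delta),
        convex_set (Theta_delta delta) & compact (Theta_delta delta)] ;
  A_Bset : [/\ convex_set (Bset M), compact (Bset M)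
             & forall t, Theta M t -> Bset M (beta t)] ;
  A_beta : Ck 3 setT beta ;
  A_dens : assumption_densities ;
  A_growth : assumption_growth ;
  A_Pred : [/\ 0 <= sigma_max, (0 < b_min)%N &
    forall t b, Theta M t -> (b_min <= b)%N ->
      (\int[iid (Dist M (beta t)) b]_s (enorm (Pred M s - beta t) ^+ 2)%:E
        <= (sigma_max ^+ 2 / b%:R)%:E)%E] }.

End Model.

Record constants (R : realType) := Constants {
  L_l_Lip : R ; L_l_sm : R ;
  L_b_Lip : R ; L_b_sm : R ; L_b_H : R ;
  L_G_b : R ; L_G_t : R ;
  M_l : R ; I_max : R }.

Section Constants.
Context {R : realType} {n m d : nat} (M : model R n m d) (c : constants R).

Local Notation beta := (beta M).
Local Notation loss := (loss M).

Record valid_constants : Prop := {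
  cst_inf : has_lbound [set perf_loss M t | t in Theta M] ;
  cst_ge0 : [/\ [/\ 0 <= L_l_Lip c, 0 <= L_l_sm c & 0 <= L_b_Lip c],
                [/\ 0 <= L_b_sm c, 0 <= L_b_H c & 0 <= L_G_b c] &
                [/\ 0 <= L_G_t c, 0 <= M_l c & 0 <= I_max c]] ;
  cst_l_Lip : forall t b1, Theta M t -> Bset M b1 ->
    ((\int[Dist M b1]_z (enorm (grad (loss z) t) ^+ 2)%:E) `^ 2^-1
      <= (L_l_Lip c)%:E)%E ;
  cst_l_sm : forall t t', Theta M t -> Theta M t' ->
    (\int[Dist M (beta t)]_z (enorm (grad (loss z) t - grad (loss z) t'))%:E
      <= (L_l_sm c * enorm (t - t'))%:E)%E ;
  cst_b_Lip : forall t t', Theta M t -> Theta M t' ->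
    enorm (beta t - beta t') <= L_b_Lip c * enorm (t - t') ;
  cst_b_sm : forall t t', Theta M t -> Theta M t' ->
    opnorm (jac beta t - jac beta t') <= L_b_sm c * enorm (t - t') ;
  cst_b_H : forall t t', Theta M t -> Theta M t' ->
    bilnorm (fun u v => deriv2 beta t u v - deriv2 beta t' u v)
      <= L_b_H c * enorm (t - t') ;
  cst_G : forall t t' b0 b0', Theta M t -> Theta M t' ->
    Bset M b0 -> Bset M b0' ->
    enorm (Gvec M t b0 - Gvec M t' b0')
      <= L_G_b c * enorm (b0 - b0') + L_G_t c * enorm (t - t') ;
  cst_M_l : forall t b0, Theta M t -> Bset M b0 ->
    (variance (Dist M b0) (fun z => loss z t) <= (M_l c)%:E)%E ;
  cst_I_max : forall b0, Bset M b0 -> \tr (fisher M b0) <= I_max c }.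

(* sigma_j and L_b_H_j are the componentwise constants sigma_max,j and
   L^H_(beta,theta,j) *)
Record assumption_S (delta sigma_max : R) (b_min : nat)
    (sigma_j L_b_H_j : 'I_m -> R) : Prop := {
  S_sp : Theta_sp M delta !=set0 ;
  S_unbiased : forall t b, Theta M t -> (b_min <= b)%N ->
    expect (iid (Dist M (beta t)) b) (fun s => Pred M s - beta t) = 0 ;
  S_Pred : forall t b j, Theta M t -> (b_min <= b)%N ->
    (\int[iid (Dist M (beta t)) b]_s
       (`|Pred M s j 0 - beta t j 0| ^+ 2)%:E <= (sigma_j j ^+ 2 / b%:R)%:E)%E ;
  S_hess : forall t t' j, Theta M t -> Theta M t' ->
    opnorm (hess (fun x => beta x j 0) t - hess (fun x => beta x j 0) t')
      <= L_b_H_j j * enorm (t - t') ;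
  S_sigma : sigma_max ^+ 2 = \sum_j sigma_j j ^+ 2 ;
  S_L_b_H : L_b_H c = Num.sqrt (\sum_j L_b_H_j j ^+ 2) }.

Definition L_L_sm : R :=
  L_l_sm c + L_l_Lip c * L_b_Lip c * Num.sqrt (I_max c)
  + L_b_sm c * Num.sqrt (M_l c * I_max c)
  + L_b_Lip c * (L_G_b c * L_b_Lip c + L_G_t c).

Definition C1 (sigma_max : R) : R :=
  3 * (L_l_Lip c ^+ 2 * I_max c + (L_b_Lip c * L_G_b c) ^+ 2) * sigma_max ^+ 2.

Definition C2' (sigma_max : R) (b_min : nat) : R :=
  3 * M_l c * I_max c *
  (3 * sigma_max ^+ 2 / b_min%:R + 3 * L_b_H c ^+ 2 + L_b_H c ^+ 2 / 6
   + 18 * L_b_Lip c ^+ 2).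

End Constants.

Section Algorithm.
Context {R : realType} {n m d : nat} (M : model R n m d).
Context (alpha delta : R) (b b_sp b_min : nat).

Definition grad_est (t : 'cV[R]_n) (bhat : 'cV[R]_m) (J : 'M[R]_(m, n)) :
  'cV[R]_n :=
  expect (Dist M bhat) (fun z => grad (loss M z) t) + J^T *m Gvec M t bhat.

Definition jac_est (bhat_pm : 'I_b_sp * bool -> 'cV[R]_m)
  (u : 'I_b_sp -> 'cV[R]_n) : 'M[R]_(m, n) :=
  (n%:R / b_sp%:R) *:
  \sum_i ((2 * delta)^-1 *: (bhat_pm (i, true) - bhat_pm (i, false))) *m (u i)^T.

Definition perturb (t u : 'cV[R]_n) (s : bool) : 'cV[R]_n :=
  if s then t + delta *: u else t - delta *: u.

Context {dO} {Omega : measurableType dO}.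

(* In data_pm, the datasets z^+ and z^- are indexed by the direction and the sign
   (true for +). *)
Record run := Run {
  theta : nat -> Omega -> 'cV[R]_n ;
  data : nat -> Omega -> b.-tuple 'cV[R]_d ;
  dir : nat -> 'I_b_sp -> Omega -> 'cV[R]_n ;
  data_pm : nat -> 'I_b_sp * bool -> Omega -> b_min.-tuple 'cV[R]_d }.

(* Fpast t, Fdata t, Fdir t: information available at the start of iteration t,
   after drawing the dataset z_t, and after drawing the directions u_t. *)
Record is_run (P : probability Omega R) (nu : probability 'cV[R]_n R)
    (theta0 : 'cV[R]_n) (X : run) (Fpast Fdata Fdir : nat -> set (set Omega)) :
    Prop := {
  run_sigma : forall t, [/\ sub_sigma_field (Fpast t),
    sub_sigma_field (Fdata t) & sub_sigma_field (Fdir t)] ;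
  run_filtration : forall t, [/\ Fpast t `<=` Fdata t, Fdata t `<=` Fdir t
    & Fdir t `<=` Fpast t.+1] ;
  run_adapted : forall t, [/\ wrt (Fpast t) (theta X t),
    wrt (Fdata t) (data X t), (forall i, wrt (Fdir t) (dir X t i))
    & (forall k, wrt (Fpast t.+1) (data_pm X t k))] ;
  run_data : forall t, cond_indep_draws P (Fpast t)
    (fun _ : unit => data X t)
    (fun _ w => iid (Dist M (beta M (theta X t w))) b) ;
  run_dir_sphere : forall t i w, sphere (dir X t i w) ;
  run_dir : forall t, cond_indep_draws P (Fdata t) (dir X t) (fun _ _ => nu) ;
  run_data_pm : forall t, cond_indep_draws P (Fdir t) (data_pm X t)
    (fun k w => iid (Dist M (beta M
       (perturb (theta X t w) (dir X t k.1 w) k.2))) b_min) ;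
  run_init : forall w, theta X 0 w = theta0 ;
  run_step : forall t w,
    let bhat := Pred M (data X t w) in
    let J := jac_est (fun k => Pred M (data_pm X t k w))
                     (fun i => dir X t i w) in
    theta X t.+1 w =
      euclid_proj (Theta_sp M delta)
        (theta X t w - alpha *: grad_est (theta X t w) bhat J) }.

End Algorithm.

Definition smallest_pos (Q : nat -> Prop) (k : nat) :=
  [/\ (0 < k)%N, Q k & forall k', (0 < k')%N -> Q k' -> (k <= k')%N].

(* Main.v *)
(** The projected step is an exact gradient step perturbed by the error [e] of the
gradient estimate.  Strong convexity of the proximal surrogate and smoothness of the
performative loss [L] give [|G(x_t)|^2 <= (2/alpha) (L(x_t) - L(x_(t+1))) + |e_t|^2],
which telescopes.

The dependence of expectations on the distribution parameter is controlled by the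
score: [\int f |p_b1 - p_b0| dmu] is at most the largest value of
[E_b |f <s_b, b1 - b0>|] for [b] on the segment (Fatou's lemma on Riemann sums of the
derivative of the density).  With Cauchy-Schwarz and the Fisher information this yields
the gradient of [L] and its Lipschitz constant, the dependence of [e] on the error of
[beta hat], and the continuity, hence measurability, of the sampling kernels.
Directions [b1 - b0] are orthogonal to the mean score, which allows the loss to be
centered and produces the constant [sqrt (M_l I_max)].

The Jacobian estimate deviates from the Jacobian by the noise of the estimators
(uncorrelated given the directions), the fluctuation of the average over the
directions, and a bias.  The bias is [n E[rho(u) u]], where [rho], the error of the
central difference at [u], is [H delta^2]-Lipschitz on the sphere; comparing [u] with
its reflection bounds it by [H delta^2] without any dimension factor.  As
[delta^6 = n / b], all three mean squares are [O(delta^4)]. *)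
Require Import Defs.
From HB Require Import structures.
From mathcomp Require Import all_boot all_order all_algebra.
From mathcomp Require Import all_classical all_reals all_analysis.
From mathcomp Require Import measurable_realfun ring lra.

Set Implicit Arguments.
Unset Strict Implicit.
Unset Printing Implicit Defensive.

Import Order.TTheory GRing.Theory Num.Theory.
Import numFieldNormedType.Exports.

Local Open Scope classical_set_scope.
Local Open Scope ring_scope.

(** * Euclidean geometry of column vectors *)

(** Two obstacles shape the details. Differentiation under the integral is available only along
    feasible directions of [Bset], so expansions of integrals are one-sided, and the mean score is
    not shown to vanish: it is only orthogonal to differences of points of [Bset]. This suffices,
    because every direction it is paired with lies in the range of the Jacobian (a limit of such
    differences, as [beta] maps [Theta] into [Bset]) or of its estimate (a combination of them, as
    [Pred] takes values in [Bset]). The draws are specified by product formulas on sets. Every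
    second moment therefore requires extending these formulas to functions, and the random
    quantities involved are kept bounded, by compactness, so that their integrals can be split
    freely. The radius is a balance: with n b directions the noise of the estimators has mean square
    of order (n / b) / delta^2, the fluctuation over directions n / b, and the bias delta^4. The
    first and the last agree for delta^6 = n / b; since b >= n gives delta <= 1, the middle one,
    delta^6, is no larger. *)

Section EuclideanGeometry.
Context {R : realType}.

Definition dot {k : nat} (x y : 'cV[R]_k) : R := \sum_(i < k) x i 0 * y i 0.

Lemma dotC k (x y : 'cV[R]_k) : dot x y = dot y x.
Proof. by apply: eq_bigr => i _; rewrite mulrC. Qed.

Lemma dotDl k (x y z : 'cV[R]_k) : dot (x + y) z = dot x z + dot y z.
Proof. by rewrite /dot -big_split/=; apply: eq_bigr => i _; rewrite mxE mulrDl. Qed.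

Lemma dotZl k a (x y : 'cV[R]_k) : dot (a *: x) y = a * dot x y.
Proof. by rewrite /dot mulr_sumr; apply: eq_bigr => i _; rewrite mxE mulrA. Qed.

Lemma dotNl k (x y : 'cV[R]_k) : dot (- x) y = - dot x y.
Proof. by rewrite -scaleN1r dotZl mulN1r. Qed.

Lemma dotBl k (x y z : 'cV[R]_k) : dot (x - y) z = dot x z - dot y z.
Proof. by rewrite dotDl dotNl. Qed.

Lemma dotDr k (x y z : 'cV[R]_k) : dot z (x + y) = dot z x + dot z y.
Proof. by rewrite dotC dotDl !(dotC z). Qed.

Lemma dotZr k a (x y : 'cV[R]_k) : dot y (a *: x) = a * dot y x.
Proof. by rewrite dotC dotZl (dotC y). Qed.

Lemma dotNr k (x y : 'cV[R]_k) : dot y (- x) = - dot y x.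
Proof. by rewrite dotC dotNl dotC. Qed.

Lemma dotBr k (x y z : 'cV[R]_k) : dot z (x - y) = dot z x - dot z y.
Proof. by rewrite dotDr dotNr. Qed.

Lemma dot0l k (y : 'cV[R]_k) : dot 0 y = 0.
Proof. by rewrite -(scale0r 0) dotZl mul0r. Qed.

Lemma dot0r k (y : 'cV[R]_k) : dot y 0 = 0.
Proof. by rewrite dotC dot0l. Qed.

Lemma dot_suml k (I : Type) (r : seq I) (P : pred I) (F : I -> 'cV[R]_k) y :
  dot (\sum_(i <- r | P i) F i) y = \sum_(i <- r | P i) dot (F i) y.
Proof.
elim/big_rec2: _ => [|i a b _ ab]; first exact: dot0l.
by rewrite dotDl ab.
Qed.

Lemma dot_ge0 k (x : 'cV[R]_k) : 0 <= dot x x.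
Proof. by apply: sumr_ge0 => i _; rewrite -expr2 sqr_ge0. Qed.

Lemma sqr_enorm k (x : 'cV[R]_k) : enorm x ^+ 2 = dot x x.
Proof.
rewrite /enorm sqr_sqrtr; first by apply: eq_bigr => i _; rewrite expr2.
by apply: sumr_ge0 => i _; rewrite sqr_ge0.
Qed.

Lemma sqr_enormE k (x : 'cV[R]_k) : enorm x ^+ 2 = \sum_(i < k) x i 0 ^+ 2.
Proof. by rewrite sqr_enorm; apply: eq_bigr => i _; rewrite expr2. Qed.

Lemma enorm_ge0 k (x : 'cV[R]_k) : 0 <= enorm x.
Proof. exact: sqrtr_ge0. Qed.

Lemma enorm_eq0 k (x : 'cV[R]_k) : enorm x = 0 -> x = 0.
Proof.
move=> x0; apply/matrixP => i j; rewrite (ord1 j) [RHS]mxE; apply/eqP.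
rewrite -sqrf_eq0 eq_le sqr_ge0 andbT.
have <- : enorm x ^+ 2 = 0 by rewrite x0 expr0n.
by rewrite sqr_enormE (bigD1 i)//= lerDl sumr_ge0// => l _; rewrite sqr_ge0.
Qed.

Lemma enorm0 k : enorm (0 : 'cV[R]_k) = 0.
Proof. by apply/eqP; rewrite -sqrf_eq0 sqr_enorm dot0l. Qed.

Lemma enorm_gt0 k (x : 'cV[R]_k) : x != 0 -> 0 < enorm x.
Proof.
move=> x0; rewrite lt_neqAle enorm_ge0 andbT eq_sym.
by apply: contra x0 => /eqP /enorm_eq0 ->.
Qed.

Lemma ler_sqr_enorm k (x : 'cV[R]_k) c : 0 <= c -> dot x x <= c ^+ 2 -> enorm x <= c.
Proof. by move=> c0; rewrite -sqr_enorm ler_pXn2r// nnegrE ?enorm_ge0. Qed.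

Lemma enormZ k a (x : 'cV[R]_k) : enorm (a *: x) = `|a| * enorm x.
Proof.
apply/eqP; rewrite -(eqrXn2 (_ : 0 < 2)%N)// ?enorm_ge0 ?mulr_ge0 ?enorm_ge0//.
by rewrite exprMn !sqr_enorm dotZl dotZr mulrA -expr2 real_normK ?num_real.
Qed.

Lemma enormN k (x : 'cV[R]_k) : enorm (- x) = enorm x.
Proof. by rewrite -scaleN1r enormZ normrN1 mul1r. Qed.

Lemma enormBC k (x y : 'cV[R]_k) : enorm (x - y) = enorm (y - x).
Proof. by rewrite -enormN opprB. Qed.

Lemma dot_le k (x y : 'cV[R]_k) : dot x y <= enorm x * enorm y.
Proof.
have [->|x0] := eqVneq x 0; first by rewrite dot0l enorm0 mul0r.
have [->|y0] := eqVneq y 0; first by rewrite dot0r enorm0 mulr0.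
have a0 := enorm_gt0 x0; have b0 := enorm_gt0 y0.
have := dot_ge0 (enorm y *: x - enorm x *: y).
rewrite !(dotBl, dotBr) !(dotZl, dotZr) -!sqr_enorm (dotC y x) => h.
have ab0 : 0 < enorm x * enorm y by rewrite mulr_gt0.
rewrite -(ler_pM2l ab0); nra.
Qed.

Lemma dot_normr_le k (x y : 'cV[R]_k) : `|dot x y| <= enorm x * enorm y.
Proof.
rewrite ler_norml dot_le andbT lerNl -dotNl.
by rewrite -(enormN x) dot_le.
Qed.

Lemma enormD k (x y : 'cV[R]_k) : enorm (x + y) <= enorm x + enorm y.
Proof.
apply: ler_sqr_enorm; first by rewrite addr_ge0 ?enorm_ge0.
rewrite !(dotDl, dotDr) -!sqr_enorm (dotC y x); have := dot_le x y; nra.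
Qed.

(** The case v = x suffices. This test reduces bounds on vector-valued expectations to scalar
    integrals. *)
Lemma enorm_dual k (x : 'cV[R]_k) c :
  0 <= c -> (forall v, dot x v <= c * enorm v) -> enorm x <= c.
Proof.
move=> c0 /(_ x); rewrite -sqr_enorm expr2.
have [->|x0] := eqVneq x 0; first by rewrite enorm0.
by rewrite ler_pM2r// enorm_gt0.
Qed.

Lemma normr_coord_le k (x : 'cV[R]_k) i : `|x i 0| <= enorm x.
Proof.
rewrite -(ler_pXn2r (_ : 0 < 2)%N)// ?nnegrE ?enorm_ge0// sqr_enormE.
rewrite real_normK ?num_real// (bigD1 i)//= lerDl sumr_ge0// => l _.
by rewrite sqr_ge0.
Qed.

Lemma mx_norm_le k l (A : 'M[R]_(k, l)) c :
  0 <= c -> (forall i j, `|A i j| <= c) -> `|A| <= c.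
Proof.
move=> c0 h; rewrite [`|A|]mx_normrE; apply/bigmax_leP; split => //= -[i j] _; apply: h.
Qed.

Lemma le_mx_norm k l (A : 'M[R]_(k, l)) i j : `|A i j| <= `|A|.
Proof.
by rewrite [`|A|]mx_normrE; apply/bigmax_geP; right => /=; exists (i, j).
Qed.

Lemma normr_le_enorm k (x : 'cV[R]_k) : `|x| <= enorm x.
Proof.
apply: mx_norm_le; first exact: enorm_ge0.
by move=> i j; rewrite (ord1 j) normr_coord_le.
Qed.

Lemma enorm_le_normr k (x : 'cV[R]_k) : enorm x <= k%:R * `|x|.
Proof.
case: k x => [|k] x.
  by rewrite mul0r (_ : x = 0) ?enorm0//; apply/matrixP => -[].
apply: ler_sqr_enorm; first by rewrite mulr_ge0.
rewrite exprMn; apply: (@le_trans _ _ (k.+1%:R * `|x| ^+ 2)).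
  rewrite -mulr_natl mulr1 -[X in _ <= X%:R * _]card_ord -sumr_const.
  rewrite mulr_suml; apply: ler_sum => i _.
  rewrite mul1r -expr2 -[leLHS]real_normK ?num_real//.
  by rewrite ler_pXn2r// ?nnegrE// le_mx_norm.
by rewrite ler_wpM2r ?sqr_ge0// expr2 ler_peMr// ler1n.
Qed.

Lemma enorm_lipschitz k (x y : 'cV[R]_k) : `|enorm x - enorm y| <= enorm (x - y).
Proof.
rewrite ler_norml; apply/andP; split.
  rewrite lerBrDr addrC -lerBrDr opprK addrC.
  by rewrite enormBC; have := enormD (y - x) x; rewrite subrK.
by rewrite lerBlDr; have := enormD (x - y) y; rewrite subrK.
Qed.

Lemma enorm_near k (x : 'cV[R]_k) e : 0 < e -> \forall y \near x, enorm (x - y) < e.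
Proof.
move=> e0; have d0 : 0 < e / k.+1%:R by rewrite divr_gt0.
apply/nbhs_ballP; exists (e / k.+1%:R) => //= y; rewrite -ball_normE /= => xy.
apply: le_lt_trans (enorm_le_normr _) _.
apply: (@le_lt_trans _ _ (k.+1%:R * `|x - y|)).
  by rewrite ler_wpM2r// ler_nat.
by rewrite mulrC -ltr_pdivlMr.
Qed.

Lemma enorm_continuous k : continuous (@enorm R k).
Proof.
move=> x; apply/(@cvgrPdist_lt _ _ _ (nbhs x)) => e e0.
apply: filterS (enorm_near x e0) => y; apply: le_lt_trans.
exact: enorm_lipschitz.
Qed.

Lemma dot_mulmx k l (A : 'M[R]_(k, l)) x y : dot (A *m x) y = dot x (A^T *m y).
Proof.
rewrite /dot.
transitivity (\sum_(i < k) \sum_(j < l) A i j * x j 0 * y i 0).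
  by apply: eq_bigr => i _; rewrite mxE mulr_suml.
rewrite exchange_big/=; apply: eq_bigr => j _; rewrite mxE mulr_sumr.
by apply: eq_bigr => i _; rewrite mxE; ring.
Qed.

(** Square of the Frobenius norm. It measures the Jacobian error because its expectation splits into
    second moments of entries, while its root still dominates the operator norm. *)
Definition frob2 {k l : nat} (A : 'M[R]_(k, l)) : R := \sum_i \sum_j A i j ^+ 2.

Lemma frob2_ge0 k l (A : 'M[R]_(k, l)) : 0 <= frob2 A.
Proof. by apply: sumr_ge0 => i _; apply: sumr_ge0 => j _; rewrite sqr_ge0. Qed.

Lemma enorm_mulmx_frob k l (A : 'M[R]_(k, l)) x :
  enorm (A *m x) <= Num.sqrt (frob2 A) * enorm x.
Proof.
apply: ler_sqr_enorm; first by rewrite mulr_ge0 ?enorm_ge0 ?sqrtr_ge0.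
rewrite exprMn sqr_sqrtr ?frob2_ge0// /frob2 mulr_suml -sqr_enorm sqr_enormE.
apply: ler_sum => i _.
have -> : (A *m x) i 0 = dot (row i A)^T x.
  by rewrite mxE; apply: eq_bigr => j _; rewrite !mxE.
have -> : \sum_j A i j ^+ 2 = enorm (row i A)^T ^+ 2.
  by rewrite sqr_enormE; apply: eq_bigr => j _; rewrite !mxE.
rewrite -exprMn -[leLHS]real_normK ?num_real// ler_pXn2r// ?nnegrE ?dot_normr_le//.
by rewrite mulr_ge0 ?enorm_ge0.
Qed.

Lemma enorm_mulmx_op k l (A : 'M[R]_(k, l)) x : enorm (A *m x) <= opnorm A * enorm x.
Proof.
have [->|x0] := eqVneq x 0; first by rewrite mulmx0 !enorm0 mulr0.
have n0 := enorm_gt0 x0.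
rewrite -ler_pdivrMr//.
have -> : enorm (A *m x) / enorm x = enorm (A *m ((enorm x)^-1 *: x)).
  by rewrite -scalemxAr enormZ ger0_norm ?invr_ge0 ?enorm_ge0// mulrC.
apply: ub_le_sup.
  exists (Num.sqrt (frob2 A)) => _ [y /= y1 <-].
  apply: le_trans (enorm_mulmx_frob _ _) _.
  by rewrite ler_piMr// sqrtr_ge0.
exists ((enorm x)^-1 *: x) => //=.
by rewrite enormZ ger0_norm ?invr_ge0 ?enorm_ge0// mulVf ?gt_eqF.
Qed.

Lemma dot_ebasis k (x : 'cV[R]_k) i : dot x (ebasis i) = x i 0.
Proof.
rewrite /dot (bigD1 i)//= big1 ?addr0; first by rewrite mxE !eqxx mulr1.
by move=> j ji; rewrite mxE (negbTE ji) mulr0.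
Qed.

Lemma ebasis_sum k (x : 'cV[R]_k) : x = \sum_i x i 0 *: ebasis i.
Proof.
apply/matrixP => i j; rewrite (ord1 j) summxE (bigD1 i)//= big1 ?addr0.
  by rewrite !mxE !eqxx mulr1.
by move=> l li; rewrite !mxE eq_sym (negbTE li) mulr0.
Qed.

Lemma enorm_ebasis k (i : 'I_k) : enorm (ebasis i : 'cV[R]_k) = 1.
Proof.
by apply/eqP; rewrite -(eqrXn2 (_ : 0 < 2)%N) ?enorm_ge0// expr1n sqr_enorm dot_ebasis mxE !eqxx.
Qed.

Lemma convexP k (C : set 'cV[R]_k) : convex_set C <->
  forall x y t, C x -> C y -> 0 <= t -> t <= 1 -> C (x + t *: (y - x)).
Proof.
have E (x y : 'cV[R]_k) t : x + t *: (y - x) = t *: y + (1 - t) *: x.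
  by apply/matrixP => i j; rewrite !mxE; ring.
split=> [cC x y t Cx Cy t0 t1|h].
  pose p : {i01 R} := Itv01 t0 t1.
  have := cC y x p; rewrite !inE => /(_ Cy Cx).
  by rewrite E.
move=> x y p; rewrite !inE => Cx Cy.
have := h y x p%:num Cy Cx; rewrite E; apply => //.
Qed.

(** * Projection onto a compact convex set *)

Section Projection.
Variables (k : nat) (C : set 'cV[R]_k).
Hypotheses (C0 : C !=set0) (cC : compact C) (vC : convex_set C).

(** [euclid_proj] is defined by [get], so it carries information only once a nearest point is known
    to exist. *)
Let proj_ex (x : 'cV[R]_k) : exists y, C y /\ forall y', C y' -> enorm (x - y) <= enorm (x - y').
Proof.
have cf : {within C, continuous (fun y : 'cV[R]_k => enorm (x - y))}.
  apply: continuous_subspaceT => y; apply/(@cvgrPdist_lt _ _ _ (nbhs y)) => e e0.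
  apply: filterS (enorm_near y e0) => z; apply: le_lt_trans.
  have := enorm_lipschitz (x - y) (x - z).
  rewrite [enorm (y - z)]enormBC (_ : x - y - (x - z) = z - y)//.
  by apply/matrixP => i j; rewrite !mxE; ring.
have [c cinC h] := compact_EVT_min C0 cC cf.
exists c; split; first by rewrite inE in cinC.
by move=> y' Cy'; apply: h; rewrite inE.
Qed.

Lemma euclid_projP x : C (euclid_proj C x) /\
  forall y', C y' -> enorm (x - euclid_proj C x) <= enorm (x - y').
Proof. by apply: (@getPex _ _ (proj_ex x)). Qed.

Lemma euclid_proj_in x : C (euclid_proj C x).
Proof. by have [] := euclid_projP x. Qed.

Lemma euclid_proj_vi x z : C z -> dot (x - euclid_proj C x) (z - euclid_proj C x) <= 0.
Proof.
move=> Cz; have [Cy h] := euclid_projP x; set y := euclid_proj C x in Cy h *.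
set a := dot _ _; rewrite leNgt; apply/negP => a0.
pose q := dot (z - y) (z - y).
have q0 : 0 <= q := dot_ge0 _.
(* Moving by t towards z changes the squared distance by - 2 t a + t^2 q. The minimiser a / q may
   exceed 1, and q may vanish; a / (a + q) is at most 1 and still decreases the distance. *)
pose t := a / (a + q).
have aq0 : 0 < a + q by rewrite ltr_wpDr.
have t0 : 0 < t by rewrite divr_gt0.
have t1 : t <= 1 by rewrite ler_pdivrMr// mul1r lerDl.
have := h _ ((convexP C).1 vC y z t Cy Cz (ltW t0) t1).
rewrite -(ler_pXn2r (_ : 0 < 2)%N) ?nnegrE ?enorm_ge0// !sqr_enorm.
rewrite (_ : x - (y + t *: (z - y)) = (x - y) - t *: (z - y)); last by rewrite opprD addrA.
rewrite (dotBl (x - y)) !(dotBr _ (t *: _)) !(dotZl, dotZr) (dotC (z - y) (x - y)) -/a -/q.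
have tE : t * (a + q) = a by rewrite /t divfK ?gt_eqF.
nra.
Qed.

(* The surrogate z |-> <g, z - x> + |z - x|^2/(2 alpha) is 1/alpha-strongly convex
   and is minimised over C by the exact step, whereas the step with e minimises it
   up to the linear term <e, z>. *)
Lemma inexact_proj_step (x g e : 'cV[R]_k) (alpha : R) : C x -> 0 < alpha ->
  forall y x', y = euclid_proj C (x - alpha *: g) ->
  x' = euclid_proj C (x - alpha *: (g + e)) ->
  2 * alpha * dot g (x' - x) + enorm (x' - x) ^+ 2 + enorm (x - y) ^+ 2
    <= alpha ^+ 2 * enorm e ^+ 2.
Proof.
move=> Cx a0 y x' yE x'E.
have := euclid_proj_vi (x - alpha *: g) Cx; rewrite -/y.
have := euclid_proj_vi (x - alpha *: (g + e)) (euclid_proj_in (x - alpha *: g)).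
rewrite -yE -x'E.
rewrite !sqr_enorm.
pose p := y - x; pose q := x' - x.
have -> : y - x' = p - q by apply/matrixP => i j; rewrite !mxE; ring.
have -> : x - alpha *: (g + e) - x' = - (alpha *: g + alpha *: e + q).
  by apply/matrixP => i j; rewrite !mxE; ring.
have -> : x - y = - p by rewrite opprB.
have -> : x - alpha *: g - y = - (alpha *: g + p).
  by apply/matrixP => i j; rewrite !mxE; ring.
rewrite -/q.
(* Young's inequality. The doubled sum of the two variational inequalities bounds 2 alpha <g, q> +
   |p|^2 + |q|^2 + |p - q|^2 by 2 alpha <e, p - q>; expanding the present square cancels the term |p
   - q|^2. *)
have h := dot_ge0 (alpha *: e - (p - q)).
move: h; rewrite !(dotBl, dotBr, dotDl, dotDr, dotNl, dotNr, dotZl, dotZr).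
rewrite (dotC y e) (dotC x e) (dotC x' e) (dotC y x) (dotC x' x) (dotC x' y).
nra.
Qed.

End Projection.

End EuclideanGeometry.

(** * Borel measurability of vector-valued maps *)

Section Measurability.
Context {R : realType}.

Lemma open_measurable_mx k l (A : set 'M[R]_(k, l)) :
  open A -> @measurable _ 'M[R]_(k, l) A.
Proof. exact: sub_sigma_algebra. Qed.

Lemma measurable_fun_ltset d (T : measurableType d) (f : T -> R) r :
  measurable_fun setT f -> measurable [set x | f x < r].
Proof.
move=> mf; rewrite (_ : mkset _ = setT `&` f @^-1` `]-oo, r[); first exact: mf.
by rewrite setTI; apply/seteqP; split => x /=; rewrite in_itv.
Qed.

Lemma measurable_fun_geset d (T : measurableType d) (f : T -> R) r :
  measurable_fun setT f -> measurable [set x | r <= f x].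
Proof.
move=> mf; rewrite (_ : mkset _ = setT `&` f @^-1` `[r, +oo[); first exact: mf.
by rewrite setTI; apply/seteqP; split => x /=; rewrite in_itv/= andbT.
Qed.

Lemma measurable_fun_gt d (T : measurableType d) (f : T -> R) :
  (forall a, measurable [set x | a < f x]) -> measurable_fun setT f.
Proof.
move=> h; apply: (measurability _ (RGenOInfty.measurableE R)) => //.
move=> _ [_ [a ->] <-]; rewrite setTI.
by rewrite (_ : _ @^-1` _ = [set x | a < f x])//; apply/seteqP; split => x /=; rewrite in_itv/= andbT.
Qed.

(* {g > a} is the preimage by Z of the union of the balls on which g o Z^-1
   stays above a. *)
Lemma measurable_fun_factor d (T : measurableType d) k (Z : T -> 'cV[R]_k) (g : T -> R) :
  measurable_fun setT Z ->
  (forall w (e : R), 0 < e -> exists2 r : R, 0 < r &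
     forall w', enorm (Z w - Z w') < r -> `|g w - g w'| < e) ->
  measurable_fun setT g.
Proof.
move=> mZ h; apply: measurable_fun_gt => a.
pose U := \bigcup_(p in [set p : T * R | 0 < p.2 /\ forall w', enorm (Z p.1 - Z w') < p.2 -> a < g w'])
  [set x | enorm (Z p.1 - x) < p.2].
have oU : open U.
  apply: bigcup_open => -[w r] [/= r0 _].
  rewrite openE => x /= xr; rewrite /interior /=.
  have e0 : 0 < r - enorm (Z w - x) by rewrite subr_gt0.
  apply: filterS (enorm_near x e0) => y; rewrite ltrBrDr => xy.
  apply: le_lt_trans xy; rewrite (addrC (enorm _)); apply: le_trans (enormD _ _).
  by rewrite addrA subrK.
have -> : [set x | a < g x] = Z @^-1` U.
  apply/seteqP; split => w /=.
    move=> aw; have [r r0 hr] : exists2 r, 0 < r &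
        forall w', enorm (Z w - Z w') < r -> `|g w - g w'| < g w - a.
      by apply: h; rewrite subr_gt0.
    exists (w, r) => /=; last by rewrite subrr enorm0.
    by split => // w' /hr; rewrite ltr_distl => /andP[_]; lra.
  by move=> [[w' r]/= [r0 hw']] /hw'.
by rewrite -[X in measurable X]setTI; apply: mZ => //; exact: open_measurable_mx.
Qed.

Lemma continuous_measurable_cV k (f : 'cV[R]_k -> R) :
  continuous f -> measurable_fun setT f.
Proof.
move=> cf; apply: (@measurable_fun_factor _ _ _ id) => //.
move=> x e e0; have /cvgrPdist_lt/(_ e e0)/nbhs_ballP[r /= r0 hr] := cf x.
exists r => // y xy; apply: hr; rewrite -ball_normE /=.
by apply: le_lt_trans xy; exact: normr_le_enorm.
Qed.

Let box k l (q : 'M[rat]_(k, l)) (r : rat) : set 'M[R]_(k, l) :=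
  [set x | forall i j, `|x i j - ratr (q i j)| < ratr r].

(** Every open set is a countable union of the rational boxes it contains, and the preimage of a box
    is a finite intersection of conditions on single entries. *)
Lemma measurable_fun_mx d (T : measurableType d) k l (X : T -> 'M[R]_(k, l)) :
  (forall i j, measurable_fun setT (fun w => X w i j)) -> measurable_fun setT X.
Proof.
move=> mX; apply: (@measurability _ _ T 'M[R]_(k, l) setT X (@open 'M[R]_(k, l)) erefl).
move=> _ [U oU <-]; rewrite setTI.
pose D := [set p : 'M[rat]_(k, l) * rat | box p.1 p.2 `<=` U].
have -> : X @^-1` U = \bigcup_(p in D) (X @^-1` (box p.1 p.2)).
  apply/seteqP; split => [w /= Uw|w [p Dp] /= bw]; last exact: Dp.
  have /nbhs_ballP[e /= e0 he] : nbhs (X w) U by exact: open_nbhs_nbhs.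
  have /rat_in_itvoo[r] : 0 < e / 2 by rewrite divr_gt0.
  rewrite in_itv/= => /andP[r0 re].
  have hq i j : exists q : rat, `|X w i j - ratr q| < ratr r.
    have /rat_in_itvoo[q] : X w i j - ratr r < X w i j + ratr r by lra.
    rewrite in_itv/= => /andP[q1 q2]; exists q.
    by rewrite ltr_norml; apply/andP; split; lra.
  pose q := \matrix_(i, j) projT1 (cid (hq i j)).
  have bq : box q r (X w) by move=> i j; rewrite mxE; case: cid.
  exists (q, r) => // y /= by_; apply: he; split => // i j /=.
  apply: (@le_lt_trans _ _ (`|X w i j - ratr (q i j)| + `|y i j - ratr (q i j)|)).
    by rewrite [X in _ <= _ + X]distrC -[X in `|X|](subrKA (ratr (q i j))) ler_normD.
  by have := bq i j; have := by_ i j; lra.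
rewrite bigcup_mkcond; apply: countable_bigcupT_measurable => // -[q r].
case: ifPn => _ //.
have -> : X @^-1` box q r = \bigcap_(p in [set: 'I_k * 'I_l])
    [set w | `|X w p.1 p.2 - ratr (q p.1 p.2)| < ratr r].
  by apply/seteqP; split => [w bw [i j] _ /=|w h i j]; [exact: bw|exact: (h (i, j))].
apply: fin_bigcap_measurable => [|[i j] _ /=]; first exact: finite_finset.

apply: measurable_fun_ltset.
by apply: measurableT_comp => //; apply: measurable_funB.
Qed.

Lemma measurable_coord k (i : 'I_k) : measurable_fun setT (fun x : 'cV[R]_k => x i 0).
Proof. by apply: continuous_measurable_cV; exact: coord_continuous. Qed.

Lemma measurable_fun_coord d (T : measurableType d) k (X : T -> 'cV[R]_k) i :
  measurable_fun setT X -> measurable_fun setT (fun w => X w i 0).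
Proof. by move=> mX; apply: (measurableT_comp (measurable_coord i) mX). Qed.

Lemma measurable_fun_cV d (T : measurableType d) k (X : T -> 'cV[R]_k) :
  (forall i, measurable_fun setT (fun w => X w i 0)) -> measurable_fun setT X.
Proof. by move=> mX; apply: measurable_fun_mx => i j; rewrite (ord1 j). Qed.

Lemma measurable_funD_cV d (T : measurableType d) k (X Y : T -> 'cV[R]_k) :
  measurable_fun setT X -> measurable_fun setT Y ->
  measurable_fun setT (fun w => X w + Y w).
Proof.
move=> mX mY; apply: measurable_fun_cV => i.
under eq_fun do rewrite mxE.
by apply: measurable_funD; apply: measurable_fun_coord.
Qed.

Lemma measurable_funZ_cV d (T : measurableType d) k a (X : T -> 'cV[R]_k) :
  measurable_fun setT X -> measurable_fun setT (fun w => a *: X w).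
Proof.
move=> mX; apply: measurable_fun_cV => i.
under eq_fun do rewrite mxE.
by apply: measurable_funM => //; apply: measurable_fun_coord.
Qed.

Lemma measurable_fun_enorm d (T : measurableType d) k (X : T -> 'cV[R]_k) :
  measurable_fun setT X -> measurable_fun setT (fun w => enorm (X w)).
Proof.
move=> mX; apply: (measurableT_comp _ mX).
by apply: continuous_measurable_cV; exact: enorm_continuous.
Qed.

Lemma measurable_fun_dot d (T : measurableType d) k (X Y : T -> 'cV[R]_k) :
  measurable_fun setT X -> measurable_fun setT Y ->
  measurable_fun setT (fun w => dot (X w) (Y w)).
Proof.
move=> mX mY; rewrite /dot; apply: measurable_sum => i.
by apply: measurable_funM; apply: measurable_fun_coord.
Qed.

End Measurability.

(** * Adaptedness as measurability for a sub-sigma-field *)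

Section SubSigmaField.
Context {R : realType} {dO} {Omega : measurableType dO}.

(** [F] is a bare family of sets. Passing to [g_sigma_algebraType F], which has the same sets since
    [F] is already a sigma-algebra, makes the closure properties of measurable functions available
    for adaptedness. *)
Lemma wrtP (F : set (set Omega)) dE (E : measurableType dE) (X : Omega -> E) :
  sub_sigma_field F ->
  wrt F X <-> @measurable_fun _ _ (g_sigma_algebraType F) E setT X.
Proof.
move=> [sF _]; split => [h _ A mA|h A mA].
  rewrite setTI; apply: sub_sigma_algebra; exact: h.
have := h measurableT A mA; rewrite setTI.
by rewrite measurable_g_measurableTypeE.
Qed.

Lemma wrt_measurable (F : set (set Omega)) dE (E : measurableType dE) (X : Omega -> E) :
  sub_sigma_field F -> wrt F X -> measurable_fun setT X.
Proof. by move=> [_ sF] h _ A mA; rewrite setTI; apply: sF; apply: h. Qed.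

End SubSigmaField.

(** * Bounded measurable functions and conditional draws *)

Section BoundedMeasurable.
Context {R : realType} {d} {T : measurableType d}.

(** An algebra of functions integrable for every probability: linearity and monotonicity of the
    real-valued integral then hold with no further integrability to check. *)
Definition bmf (f : T -> R) :=
  measurable_fun setT f /\ exists C, forall w, `|f w| <= C.

Lemma bmf_measurable f : bmf f -> measurable_fun setT f. Proof. by case. Qed.

Lemma bmf_bound f : bmf f -> exists2 C, 0 < C & forall w, `|f w| <= C.
Proof.
move=> [_ [C hC]]; exists (`|C| + 1); first by rewrite ltr_wpDl.
move=> w; apply: le_trans (hC w) _; apply: le_trans (ler_norm C) _.
by rewrite lerDl.
Qed.

Lemma bmf_cst c : bmf (cst c).
Proof. by split => //; exists `|c|. Qed.

Lemma bmfD f g : bmf f -> bmf g -> bmf (fun w => f w + g w).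
Proof.
move=> [mf [C hC]] [mg [D hD]]; split; first exact: measurable_funD.
by exists (C + D) => w; apply: le_trans (ler_normD _ _) _; apply: lerD.
Qed.

Lemma bmfN f : bmf f -> bmf (fun w => - f w).
Proof.
move=> [mf [C hC]]; split; first exact: measurableT_comp.
by exists C => w; rewrite normrN.
Qed.

Lemma bmfB f g : bmf f -> bmf g -> bmf (fun w => f w - g w).
Proof. by move=> bf bg; apply: bmfD => //; exact: bmfN. Qed.

Lemma bmfM f g : bmf f -> bmf g -> bmf (fun w => f w * g w).
Proof.
move=> [mf [C hC]] [mg [D hD]]; split; first exact: measurable_funM.
by exists (C * D) => w; rewrite normrM; apply: ler_pM.
Qed.

Lemma bmfX f n : bmf f -> bmf (fun w => f w ^+ n).
Proof.
move=> [mf [C hC]]; split; first exact: measurable_funX.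
by exists (C ^+ n) => w; rewrite normrX lerXn2r// nnegrE// (le_trans _ (hC w)).
Qed.

Lemma bmf_sum (I : Type) (r : seq I) (P : pred I) (F : I -> T -> R) :
  (forall i, P i -> bmf (F i)) -> bmf (fun w => \sum_(i <- r | P i) F i w).
Proof.
move=> h; elim: r => [|i r IH].
  by under eq_fun do rewrite big_nil; exact: bmf_cst.
under eq_fun do rewrite big_cons.
have [Pi|Pi] := boolP (P i); last exact: IH.
by apply: bmfD => //; exact: h.
Qed.

Lemma bmf_indic (A : set T) : measurable A -> bmf \1_A.
Proof.
move=> mA; split; first exact: measurable_indic.
by exists 1 => w; rewrite indicE ger0_norm// lern1; case: (_ \in _).
Qed.

Variable P : probability T R.

Lemma bmf_integrable f : bmf f -> P.-integrable setT (EFin \o f).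
Proof.
move=> [mf [C hC]]; apply: measurable_bounded_integrable => //.
  exact: le_lt_trans (probability_le1 P measurableT) (ltry _).
exists C; split; first exact: num_real.
by move=> M CM w _; apply: le_trans (hC w) (ltW CM).
Qed.

Lemma RintD f g : bmf f -> bmf g ->
  \int[P]_w (f w + g w) = \int[P]_w f w + \int[P]_w g w.
Proof. by move=> bf bg; apply: RintegralD => //; exact: bmf_integrable. Qed.

Lemma RintB f g : bmf f -> bmf g ->
  \int[P]_w (f w - g w) = \int[P]_w f w - \int[P]_w g w.
Proof. by move=> bf bg; apply: RintegralB => //; exact: bmf_integrable. Qed.

Lemma RintZ f c : bmf f -> \int[P]_w (c * f w) = c * \int[P]_w f w.
Proof. by move=> bf; apply: RintegralZl => //; exact: bmf_integrable. Qed.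

Lemma Rint_cst c : \int[P]_w c = c.
Proof.
by rewrite (Rintegral_cst P measurableT) [X in fine X](_ : _ = 1%E) ?mulr1//; exact: probability_setT.
Qed.

Lemma Rint_sum (I : Type) (r : seq I) (Q : pred I) (F : I -> T -> R) :
  (forall i, Q i -> bmf (F i)) ->
  \int[P]_w (\sum_(i <- r | Q i) F i w) = \sum_(i <- r | Q i) \int[P]_w F i w.
Proof.
move=> h; elim: r => [|i r IH].
  by under eq_Rintegral do rewrite big_nil; rewrite big_nil Rint_cst.
under eq_Rintegral do rewrite big_cons; rewrite big_cons.
have [Qi|Qi] := boolP (Q i); last exact: IH.
by rewrite RintD ?IH//; [exact: h|exact: bmf_sum].
Qed.

Lemma eq_Rint f g : (forall w, f w = g w) -> \int[P]_w f w = \int[P]_w g w.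
Proof. by move=> fg; apply: eq_Rintegral => w _; exact: fg. Qed.

Lemma le_Rint f g : bmf f -> bmf g -> (forall w, f w <= g w) ->
  \int[P]_w f w <= \int[P]_w g w.
Proof. by move=> bf bg fg; apply: le_Rintegral => //; exact: bmf_integrable. Qed.

Lemma le_norm_Rint f c : bmf f -> (forall w, `|f w| <= c) -> `|\int[P]_w f w| <= c.
Proof.
move=> bf fc; have h w : - c <= f w <= c by rewrite -ler_norml.
have hl := le_Rint (bmf_cst (- c)) bf (fun w => proj1 (andP (h w))).
have hr := le_Rint bf (bmf_cst c) (fun w => proj2 (andP (h w))).
by rewrite !Rint_cst in hl hr; rewrite ler_norml hl.
Qed.

Lemma EFin_Rint f : bmf f -> (\int[P]_w f w)%:E = (\int[P]_w (f w)%:E)%E.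
Proof. by move=> bf; rewrite /Rintegral fineK//; apply: integrable_fin_num => //; exact: bmf_integrable. Qed.

Lemma Rint_indic (A : set T) : measurable A -> \int[P]_w \1_A w = fine (P A).
Proof. by move=> mA; rewrite /Rintegral integral_indic// setIT. Qed.

End BoundedMeasurable.

Lemma bmf_comp {R : realType} d d' (T : measurableType d) (T' : measurableType d')
    (X : T -> T') (f : T' -> R) :
  measurable_fun setT X -> bmf f -> bmf (fun w => f (X w)).
Proof.
move=> mX [mf [C hC]]; split; first exact: measurableT_comp.
by exists C.
Qed.

(** * From indicators to bounded functions: layer cake and kernels *)

Section LayerCake.
Context {R : realType} {d} {E : measurableType d}.

Let sum_ltn (t K : nat) : (t <= K)%N -> (\sum_(k < K) (k < t) = t)%N.
Proof.
elim: K t => [|K IH] t; first by rewrite leqn0 big_ord0 => /eqP ->.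
rewrite leq_eqVlt => /orP[/eqP ->|tK].
  rewrite (eq_bigr (fun=> 1%N)) => [|i _]; last by rewrite ltn_ord.
  by rewrite sum1_card card_ord.
by rewrite big_ord_recr/= IH// ltnNge -ltnS tK addn0.
Qed.

(** The number of k >= 1 with k / N <= phi x + C is the integer part of N (phi x + C), so counting
    the superlevel sets that contain x recovers phi up to 1 / N. The error is uniform, hence
    survives integration against any probability. *)
Lemma layer_cake (phi : E -> R) C N : measurable_fun setT phi ->
  0 <= C -> (forall x, `|phi x| <= C) -> (0 < N)%N ->
  exists (K : nat) (S : nat -> set E), (forall k, measurable (S k)) /\
  forall x, `|phi x - (\sum_(k < K) N%:R^-1 * \1_(S k) x - C)| <= N%:R^-1.
Proof.
move=> mphi C0 hC N0.
have N0' : 0 < N%:R :> R by rewrite ltr0n.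
pose K := (Num.truncn (2 * C * N%:R)).+1.
exists K, (fun k => [set x | k.+1%:R / N%:R - C <= phi x]); split.
  by move=> k; exact: measurable_fun_geset.
move=> x; set y := (phi x + C) * N%:R.
have /andP[xl xu] : - C <= phi x <= C by rewrite -ler_norml.
have y0 : 0 <= y by apply: mulr_ge0; [lra|exact: ltW].
have yK : (Num.truncn y <= K)%N.
  by apply/leqW/le_truncn/ler_wpM2r; [exact: ltW|lra].
have -> : \sum_(k < K) N%:R^-1 * \1_[set x | k.+1%:R / N%:R - C <= phi x] x
    = (Num.truncn y)%:R / N%:R :> R.
  rewrite -mulr_sumr mulrC -(sum_ltn yK) natr_sum; congr (_ / _).
  apply: eq_bigr => k _; rewrite indicE; congr (_%:R); congr nat_of_bool.
  rewrite truncn_gt_nat.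
  by apply/idP/idP; rewrite inE/= lerBlDr ler_pdivrMr.
have := truncn_itv y0 => /andP[t1 t2].
rewrite opprB addrA.
have -> : phi x + C = y / N%:R by rewrite /y mulfK ?gt_eqF.
rewrite -mulrBl normrM [`|N%:R^-1|]ger0_norm ?invr_ge0 ?ler0n//.
rewrite ler_piMl ?invr_ge0 ?ler0n// ger0_norm ?subr_ge0//.
by rewrite lerBlDr addrC natr1; exact: ltW.
Qed.

End LayerCake.

Lemma le_invn_eq0 {R : realType} (x c : R) :
  (forall N, `|x| <= c / N.+1%:R) -> x = 0.
Proof.
move=> h; apply/eqP; rewrite -normr_eq0 eq_le normr_ge0 andbT.
apply/ler_addgt0Pr => e e0; rewrite add0r.
apply: le_trans (h (Num.truncn (c / e))) _.
rewrite ler_pdivrMr ?ltr0n// mulrC -ler_pdivrMr//.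
by apply: ltW; exact: truncnS_gt.
Qed.

Section Kernel.
Context {R : realType} {dO} {Omega : measurableType dO} (P : probability Omega R).
Context {dE} {E : measurableType dE}.

Lemma bmf_prob (kappa : Omega -> probability E R) S :
  measurable_fun setT (fun w => fine (kappa w S)) -> measurable S ->
  bmf (fun w => fine (kappa w S)).
Proof.
move=> mk mS; split => //; exists 1 => w.
rewrite ger0_norm ?fine_ge0// -lee_fin fineK ?probability_le1//.
exact: fin_num_measure.
Qed.

(** Both sides are linear in [phi] and stable under uniform limits, so the identity passes from
    indicators to layer-cake sums and then to [phi]. The weights [V] and [V'] may differ so that the
    lemma can be iterated: [V] may contain a draw that [V'] has already replaced by its conditional
    mean. *)
Lemma Rint_kernel (V V' : Omega -> R) (X : Omega -> E)
    (kappa : Omega -> probability E R) (phi : E -> R) :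
  bmf V -> bmf V' -> measurable_fun setT X ->
  (forall S, measurable S -> measurable_fun setT (fun w => fine (kappa w S))) ->
  (forall S, measurable S ->
    \int[P]_w (V w * \1_S (X w)) = \int[P]_w (V' w * fine (kappa w S))) ->
  bmf phi ->
  bmf (fun w => \int[kappa w]_x phi x) /\
  \int[P]_w (V w * phi (X w)) = \int[P]_w (V' w * \int[kappa w]_x phi x).
Proof.
move=> bV bV' mX mk h bphi.
have [C C0 hC] := bmf_bound bphi.
have approx N : exists (K : nat) (S : nat -> set E), (forall k, measurable (S k)) /\
    forall x, `|phi x - (\sum_(k < K) N.+1%:R^-1 * \1_(S k) x - C)| <= N.+1%:R^-1.
  by apply: layer_cake => //; [exact: bmf_measurable bphi|exact: ltW].
have bs N K (S : nat -> set E) : (forall k, measurable (S k)) ->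
    bmf (fun x => \sum_(k < K) N.+1%:R^-1 * \1_(S k) x - C).
  move=> mS; apply: bmfB; last exact: bmf_cst.
  by apply: bmf_sum => k _; apply: bmfM; [exact: bmf_cst|exact: bmf_indic].
pose ks N K (S : nat -> set E) w := \sum_(k < K) N.+1%:R^-1 * fine (kappa w (S k)) - C.
have ksE N K (S : nat -> set E) w : (forall k, measurable (S k)) ->
    \int[kappa w]_x (\sum_(k < K) N.+1%:R^-1 * \1_(S k) x - C) = ks N K S w.
  move=> mS; rewrite RintB; last 2 first.
  - by apply: bmf_sum => k _; apply: bmfM; [exact: bmf_cst|exact: bmf_indic].
  - exact: bmf_cst.
  rewrite Rint_cst Rint_sum; last first.
    by move=> k _; apply: bmfM; [exact: bmf_cst|exact: bmf_indic].
  congr (_ - _); apply: eq_bigr => k _; rewrite RintZ ?Rint_indic//.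
  exact: bmf_indic.
have bks N K (S : nat -> set E) : (forall k, measurable (S k)) -> bmf (ks N K S).
  move=> mS; apply: bmfB; last exact: bmf_cst.
  by apply: bmf_sum => k _; apply: bmfM; [exact: bmf_cst|apply: bmf_prob => //; exact: mk].
have kd N K (S : nat -> set E) w : (forall k, measurable (S k)) ->
    (forall x, `|phi x - (\sum_(k < K) N.+1%:R^-1 * \1_(S k) x - C)| <= N.+1%:R^-1) ->
    `|\int[kappa w]_x phi x - ks N K S w| <= N.+1%:R^-1.
  move=> mS hS; rewrite -ksE// -RintB//; last exact: bs.
  by apply: le_norm_Rint => //; apply: bmfB => //; exact: bs.
have bk : bmf (fun w => \int[kappa w]_x phi x).
  split; last by exists C => w; exact: le_norm_Rint.
  pose g N w := ks N (projT1 (cid (approx N))) (projT1 (cid (projT2 (cid (approx N))))) w.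
  apply: (@measurable_fun_cvg _ _ _ setT g).
    move=> N; rewrite /g; case: cid => K /= hK; case: cid => S [mS _] /=.
    exact: bmf_measurable (bks _ _ _ _).
  move=> w _; apply/cvgrPdist_le => e e0.
  near=> N; apply: (@le_trans _ _ N.+1%:R^-1).
    by rewrite /g; case: cid => K /= hK; case: cid => S [mS hS] /=; exact: kd.
  by apply: ltW; near: N; exact: (near_infty_natSinv_lt (PosNum e0)).
split => //.
have [D D0 hD] := bmf_bound bV.
have [D' D0' hD'] := bmf_bound bV'.
apply/eqP; rewrite -subr_eq0; apply/eqP.
apply: (@le_invn_eq0 _ _ (D + D')) => N.
have [K [S [mS hS]]] := approx N.
pose s x := \sum_(k < K) N.+1%:R^-1 * \1_(S k) x - C.
have bsS : bmf s by exact: bs.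
have bsX : bmf (fun w => s (X w)) by exact: bmf_comp.
have bphX : bmf (fun w => phi (X w)) by exact: bmf_comp.
have bI k : bmf (fun w => \1_(S k) (X w)) by apply: bmf_comp => //; exact: bmf_indic.
have bI' k : bmf (fun w => fine (kappa w (S k))) by apply: bmf_prob => //; exact: mk.
have sE : \int[P]_w (V w * s (X w)) = \int[P]_w (V' w * ks N K S w).
  have e1 w : V w * s (X w) = \sum_(k < K) N.+1%:R^-1 * (V w * \1_(S k) (X w)) - C * V w.
    rewrite /s mulrBr mulr_sumr [V w * C]mulrC; congr (_ - _).
    by apply: eq_bigr => k _; rewrite mulrCA.
  have e2 w : V' w * ks N K S w = \sum_(k < K) N.+1%:R^-1 * (V' w * fine (kappa w (S k))) - C * V' w.
    rewrite /ks mulrBr mulr_sumr [V' w * C]mulrC; congr (_ - _).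
    by apply: eq_bigr => k _; rewrite mulrCA.
  under eq_Rintegral do rewrite e1.
  under [RHS]eq_Rintegral do rewrite e2.
  have bVI k : bmf (fun w => V w * \1_(S k) (X w)) by exact: bmfM.
  have bVI' k : bmf (fun w => V' w * fine (kappa w (S k))) by exact: bmfM.
  rewrite !RintB ?RintZ//; last 4 first.
  - by apply: bmf_sum => k _; apply: bmfM => //; exact: bmf_cst.
  - by apply: bmfM => //; exact: bmf_cst.
  - by apply: bmf_sum => k _; apply: bmfM => //; exact: bmf_cst.
  - by apply: bmfM => //; exact: bmf_cst.
  congr (_ - _); last first.
    (* The additive constant of the layer-cake sum calls for equal integrals of [V] and [V']; this
       is the hypothesis at S = [setT]. *)
    congr (_ * _); transitivity (\int[P]_w (V w * \1_setT (X w))).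
      by apply: eq_Rint => w; rewrite indicT/= mulr1.
    rewrite h//; apply: eq_Rint => w.
    by rewrite [X in fine X](_ : _ = 1%E) ?mulr1//; exact: probability_setT.
  rewrite !Rint_sum; last 2 first.
  - by move=> k _; apply: bmfM => //; exact: bmf_cst.
  - by move=> k _; apply: bmfM => //; exact: bmf_cst.
  by apply: eq_bigr => k _; rewrite !RintZ// h.
have d1 : `|\int[P]_w (V w * phi (X w)) - \int[P]_w (V w * s (X w))| <= D / N.+1%:R.
  rewrite -RintB; [|exact: bmfM|exact: bmfM].
  apply: le_norm_Rint => [|w]; first by apply: bmfB; exact: bmfM.
  by rewrite -mulrBr normrM; apply: ler_pM.
have d2 : `|\int[P]_w (V' w * ks N K S w) - \int[P]_w (V' w * \int[kappa w]_x phi x)| <= D' / N.+1%:R.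
  have bK := bks N K S mS.
  rewrite -RintB; [|exact: bmfM|exact: bmfM].
  apply: le_norm_Rint => [|w]; first by apply: bmfB; exact: bmfM.
  by rewrite -mulrBr normrM; apply: ler_pM => //; rewrite distrC; exact: kd.
rewrite mulrDl; apply: le_trans (lerD d1 d2).
by rewrite sE; exact: ler_distD.
Unshelve. all: by end_near. Qed.

End Kernel.

(** An instance of [Rint_kernel]: the draw is the identity from [Omega] to [Omega] equipped with
    [F], its kernel is the Dirac mass at w, and [W] is a bounded measurable function of this
    draw. *)
Lemma Rint_wrt {R : realType} {dO} {Omega : measurableType dO}
    (P : probability Omega R) (F : set (set Omega)) (V V' W : Omega -> R) :
  sub_sigma_field F -> bmf V -> bmf V' ->
  wrt F W -> (exists C, forall w, `|W w| <= C) ->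
  (forall A, F A -> \int[P]_w (V w * \1_A w) = \int[P]_w (V' w * \1_A w)) ->
  \int[P]_w (V w * W w) = \int[P]_w (V' w * W w).
Proof.
move=> sF bV bV' FW hW h.
pose E : measurableType _ := g_sigma_algebraType F.
have ES (A : set Omega) : @measurable _ E A -> F A.
  by rewrite measurable_g_measurableTypeE//; case: sF.
have mid : measurable_fun (setT : set Omega) (id : Omega -> E).
  by move=> _ A /ES FA; rewrite setTI; case: sF => _; apply.
have bW : @bmf _ _ E W by split => //; exact/wrtP.
have [||_] := @Rint_kernel _ _ _ P _ E V V' id (fun w => \d_(w : E)) W bV bV' mid _ _ bW.
- move=> S /ES FS; rewrite (_ : (fun w => _) = \1_S).
    by apply: measurable_indic; case: sF => _; apply.
  by apply/funext => w; rewrite /= /dirac.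
- move=> S /ES FS; rewrite h//; apply: eq_Rintegral => w _.
- move=> ->; apply: eq_Rintegral => w _; congr (_ * _).
  rewrite /Rintegral integral_dirac//; last by apply/measurable_EFinP; case: bW.
  by rewrite diracT mul1e.
Qed.

(** * Conditional draws tested against bounded functions *)

Section ConditionalDraws.
Context {R : realType} {dO} {Omega : measurableType dO} (P : probability Omega R).
Variable F : set (set Omega).
Hypothesis sF : sub_sigma_field F.
Context {I : finType} {dE} {E : measurableType dE}.
Variables (X : I -> Omega -> E) (kappa : I -> Omega -> probability E R).
Hypothesis mX : forall i, measurable_fun setT (X i).
Hypothesis mk : forall i S, measurable S ->
  measurable_fun setT (fun w => fine (kappa i w S)).
Hypothesis cX : cond_indep_draws P F X kappa.

Let F_measurable A : F A -> measurable A.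
Proof. by case: sF => _; apply. Qed.

Let draw_sets A (S : I -> set E) : F A -> (forall i, measurable (S i)) ->
  \int[P]_w (\1_A w * \prod_i \1_(S i) (X i w)) =
  \int[P]_w (\1_A w * \prod_i fine (kappa i w (S i))).
Proof.
move=> FA mS; have mA := F_measurable FA.
have mB : measurable (A `&` \bigcap_i (X i @^-1` S i)).
  apply: measurableI => //; apply: fin_bigcap_measurable.
    exact: finite_finset.
  by move=> i _; rewrite -[X in measurable X]setTI; exact: mX.
transitivity (fine (P (A `&` \bigcap_i (X i @^-1` S i)))).
  rewrite -Rint_indic//; apply: eq_Rintegral => w _.
  rewrite !indicE in_setI -mulnb natrM; congr (_ * _).
  have [h|h] := boolP (w \in _).
    by rewrite big1// => i _; move: h; rewrite inE => /(_ i Logic.I) h; rewrite indicE mem_set.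
  apply/eqP; apply: contraNT h => /prodf_neq0 h; rewrite inE => i _.
  by have := h i isT; rewrite indicE pnatr_eq0 eqb0 negbK inE.
rewrite cX// -[fine _]/(\int[P]_(w in A) _) Rintegral_mkcond.
apply: eq_Rintegral => w _; rewrite patchE indicE.
by case: ifPn => _; rewrite ?mul1r ?mul0r.
Qed.

(** Leaving the other draws unconstrained isolates draw k in the product formula. The extension goes
    from sets of values to [phi], then from events of [F] to [W]. *)
Lemma cond_draw1 (W : Omega -> R) k (phi : E -> R) :
  wrt F W -> (exists C, forall w, `|W w| <= C) -> bmf phi ->
  bmf (fun w => \int[kappa k w]_x phi x) /\
  \int[P]_w (W w * phi (X k w)) = \int[P]_w (W w * \int[kappa k w]_x phi x).
Proof.
move=> FW hW bphi.
have h0 A S : F A -> measurable S ->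
    \int[P]_w (\1_A w * \1_S (X k w)) = \int[P]_w (\1_A w * fine (kappa k w S)).
  move=> FA mS.
  pose S' i : set E := if i == k then S else setT.
  transitivity (\int[P]_w (\1_A w * \prod_i \1_(S' i) (X i w))).
    apply: eq_Rint => w; rewrite (bigD1 k)//= /S' eqxx big1 ?mulr1//.
    by move=> i /negbTE ->; rewrite indicT.
  rewrite draw_sets//; last by move=> i; rewrite /S'; case: ifP.
  apply: eq_Rint => w; rewrite (bigD1 k)//= /S' eqxx big1 ?mulr1//.
  move=> i /negbTE ->.
  by rewrite [X in fine X](_ : _ = 1%E)//; exact: probability_setT.
have bA A : F A -> bmf (\1_A : Omega -> R) by move=> /F_measurable; exact: bmf_indic.
have h1 A (FA : F A) := @Rint_kernel _ _ _ P _ _ \1_A \1_A (X k) (kappa k) phi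
  (bA A FA) (bA A FA) (mX k) (mk k) (fun S => @h0 A S FA) bphi.
have FT : F setT by case: (sF) => -[s0 sC _] _; have := sC _ s0; rewrite setD0.
have [bk _] := h1 setT FT; split => //.
under eq_Rintegral do rewrite mulrC.
under [RHS]eq_Rintegral do rewrite mulrC.
apply: (Rint_wrt sF) => // [|A FA]; first exact: bmf_comp.
have [_ e] := h1 A FA.
under eq_Rintegral do rewrite mulrC.
by rewrite e; apply: eq_Rintegral => w _; rewrite mulrC.
Qed.

(** The two draws are extended one after the other: first [phi], with the indicator of the second
    draw kept in the weight; then [phi'], with phi (X k) on the left and its conditional mean on the
    right as weights. *)
Lemma cond_draw2 (W : Omega -> R) k k' (phi phi' : E -> R) :
  wrt F W -> (exists C, forall w, `|W w| <= C) -> k != k' -> bmf phi -> bmf phi' ->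
  \int[P]_w (W w * (phi (X k w) * phi' (X k' w))) =
  \int[P]_w (W w * (\int[kappa k w]_x phi x * \int[kappa k' w]_x phi' x)).
Proof.
move=> FW hW kk' bphi bphi'.
have h0 A S S' : F A -> measurable S -> measurable S' ->
    \int[P]_w (\1_A w * \1_S' (X k' w) * \1_S (X k w)) =
    \int[P]_w (\1_A w * fine (kappa k' w S') * fine (kappa k w S)).
  move=> FA mS mS'.
  pose S0 i : set E := if i == k then S else if i == k' then S' else setT.
  have kk0 : k' == k = false by rewrite eq_sym (negbTE kk').
  transitivity (\int[P]_w (\1_A w * \prod_i \1_(S0 i) (X i w))).
    apply: eq_Rint => w; rewrite (bigD1 k)//= (bigD1 k')/=; last by rewrite eq_sym.
    rewrite /S0 eqxx kk0 eqxx big1 ?mulr1.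
      by rewrite -mulrA; congr (_ * _); rewrite mulrC.
    by move=> i /andP[/negbTE -> /negbTE ->]; rewrite indicT.
  rewrite draw_sets//; last by move=> i; rewrite /S0; case: ifP => // _; case: ifP.
  apply: eq_Rint => w; rewrite (bigD1 k)//= (bigD1 k')/=; last by rewrite eq_sym.
  rewrite /S0 eqxx kk0 eqxx big1 ?mulr1.
    by rewrite -mulrA; congr (_ * _); rewrite mulrC.
  move=> i /andP[/negbTE -> /negbTE ->].
  by rewrite [X in fine X](_ : _ = 1%E)//; exact: probability_setT.
have bI i S : measurable S -> bmf (fun w => \1_S (X i w) : R).
  by move=> mS; apply: bmf_comp => //; exact: bmf_indic.
have bK i S : measurable S -> bmf (fun w => fine (kappa i w S)).
  by move=> mS; apply: bmf_prob => //; exact: mk.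
have bA A : F A -> bmf (\1_A : Omega -> R) by move=> /F_measurable; exact: bmf_indic.
have bphX : bmf (fun w => phi (X k w)) by exact: bmf_comp.
have bphX' : bmf (fun w => phi' (X k' w)) by exact: bmf_comp.
have [bk _] := @cond_draw1 W k phi FW hW bphi.
have [bk' _] := @cond_draw1 W k' phi' FW hW bphi'.
have h1 A S' : F A -> measurable S' ->
    \int[P]_w (\1_A w * phi (X k w) * \1_S' (X k' w)) =
    \int[P]_w (\1_A w * \int[kappa k w]_x phi x * fine (kappa k' w S')).
  move=> FA mS'.
  have [|||_ +] := @Rint_kernel _ _ _ P _ _ (fun w => \1_A w * \1_S' (X k' w))
    (fun w => \1_A w * fine (kappa k' w S')) (X k) (kappa k) phi _ _ (mX k) (mk k) _ bphi.
  - by apply: bmfM; [exact: bA|exact: bI].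
  - by apply: bmfM; [exact: bA|exact: bK].
  - by move=> S mS; exact: h0.
  - move=> e; under eq_Rintegral do rewrite mulrAC.
    by rewrite e; apply: eq_Rintegral => w _; rewrite mulrAC.
have h2 A : F A ->
    \int[P]_w (phi (X k w) * phi' (X k' w) * \1_A w) =
    \int[P]_w ((\int[kappa k w]_x phi x * \int[kappa k' w]_x phi' x) * \1_A w).
  move=> FA.
  have [|||_ +] := @Rint_kernel _ _ _ P _ _ (fun w => \1_A w * phi (X k w))
    (fun w => \1_A w * \int[kappa k w]_x phi x) (X k') (kappa k') phi' _ _ (mX k') (mk k') _ bphi'.
  - by apply: bmfM => //; exact: bA.
  - by apply: bmfM => //; exact: bA.
  - by move=> S mS; exact: h1.
  - move=> e; under eq_Rintegral do rewrite mulrC mulrA.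
    by rewrite e; apply: eq_Rint => w; ring.
under eq_Rintegral do rewrite mulrC.
under [RHS]eq_Rintegral do rewrite mulrC.
by apply: (Rint_wrt sF) => //; [exact: bmfM|apply: bmfM].
Qed.

End ConditionalDraws.

(** * Independence of a fixed law: Fubini and orthogonality *)

Section Independence.
Context {R : realType} {d} {T : measurableType d} (P : probability T R).
Context {d1} {E1 : measurableType d1} {d2} {E2 : measurableType d2}.
Variable Q : probability E2 R.

(** The formula on rectangles identifies the law of (Y, U) with a product measure; the rest is
    Fubini. *)
Lemma Rint_indep (Y : T -> E1) (U : T -> E2) (g : E1 * E2 -> R) :
  measurable_fun setT Y -> measurable_fun setT U ->
  (forall A S, measurable A -> measurable S ->
     P (Y @^-1` A `&` U @^-1` S) = (P (Y @^-1` A) * Q S)%E) ->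
  bmf g ->
  bmf (fun y => \int[Q]_x g (y, x)) /\
  \int[P]_w g (Y w, U w) = \int[P]_w (\int[Q]_x g (Y w, x)).
Proof.
move=> mY mU h bg.
pose Y' : {mfun T >-> E1} := HB.pack Y (isMeasurableFun.Build _ _ _ _ Y mY).
have mYU : measurable_fun setT (fun w => (Y w, U w)) by exact: measurable_fun_pair.
pose YU : {mfun T >-> (E1 * E2)%type} := HB.pack (fun w => (Y w, U w)) (isMeasurableFun.Build _ _ _ _ _ mYU).
have E : forall X, measurable X -> (distribution P Y' \x Q)%E X = distribution P YU X.
  by apply: product_measure_unique => A S mA mS; rewrite -h.
have [mg [C hC]] := bg.
have b1 y : bmf (fun x => g (y, x)).
  by split; [exact: measurableT_comp|exists C].
have ig : ((distribution P Y' \x Q)%E : measure _ _).-integrable setT (EFin \o g).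
  exact: (@bmf_integrable _ _ _ (distribution P Y' \x Q)%E).
have mF := measurable_fubini_F ig.
have bF : bmf (fun y => \int[Q]_x g (y, x)).
  split; last by exists C => y; apply: le_norm_Rint.
  by apply: (measurableT_comp _ mF).
split => //.
rewrite [LHS]/Rintegral.
transitivity (fine (\int[distribution P YU]_z (g z)%:E)).
  rewrite integral_distribution//; first by apply/measurable_EFinP.
  by apply: bmf_integrable; apply: (bmf_comp mYU).
rewrite (@eq_measure_integral _ _ _ _ (distribution P Y' \x Q)%E); last first.
  by move=> A mA _; exact: esym (E A mA).
rewrite -integral12_prod_meas1//.
rewrite [RHS]/Rintegral; congr fine.
transitivity (\int[distribution P Y']_y (\int[Q]_x g (y, x))%:E)%E.
  by apply: eq_integral => y _; rewrite EFin_Rint.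
rewrite integral_distribution//; first by apply/measurable_EFinP; case: bF.
exact: bmf_integrable (bmf_comp mY bF).
Qed.

(** For fixed S' both sides are finite measures in B that agree on rectangles, which form a
    generating class stable under intersection. *)
Lemma indep_pair_step (Y : T -> E1) (U U' : T -> E2) :
  measurable_fun setT Y -> measurable_fun setT U -> measurable_fun setT U' ->
  (forall A S S', measurable A -> measurable S -> measurable S' ->
     P (Y @^-1` A `&` U @^-1` S `&` U' @^-1` S') =
     (P (Y @^-1` A `&` U @^-1` S) * Q S')%E) ->
  forall B S', measurable B -> measurable S' ->
     P ((fun w => (Y w, U w)) @^-1` B `&` U' @^-1` S') =
     (P ((fun w => (Y w, U w)) @^-1` B) * Q S')%E.
Proof.
move=> mY mU mU' h B S' mB mS'.
have mYU : measurable_fun setT (fun w => (Y w, U w)) by exact: measurable_fun_pair.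
pose YU : {mfun T >-> (E1 * E2)%type} := HB.pack (fun w => (Y w, U w)) (isMeasurableFun.Build _ _ _ _ _ mYU).
have mUS : measurable (U' @^-1` S') by rewrite -[X in measurable X]setTI; exact: mU'.
have q0 : 0 <= fine (Q S') by rewrite fine_ge0.
pose G : set (set (E1 * E2)) :=
  [set C | exists A, measurable A /\ exists S, measurable S /\ C = A `*` S].
have GI : setI_closed G.
  move=> /= _ _ [X1 [mX1 [X2 [mX2 ->]]]] [Y1 [mY1 [Y2 [mY2 ->]]]].
  rewrite -setXI; exists (X1 `&` Y1); split; first exact: measurableI.
  by exists (X2 `&` Y2); split => //; exact: measurableI.
have QE : (fine (Q S'))%:E = Q S' by rewrite fineK// fin_num_measure.
suff : pushforward (mrestr P mUS) YU B = mscale (NngNum q0) (pushforward P YU) B.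
  by move=> /(_ mYU); rewrite /mscale/= QE muleC.
move=> mYU0; apply: (measure_unique G (fun=> setT)) => //.
- rewrite measurable_prod_measurableType; congr (<<s _ >>).
  rewrite predeqE; split => [[A mA [S mS <-]]|[A [mA [S [mS ->]]]]].
    by exists A; split => //; exists S.
  by exists A => //; exists S.
- by move=> _; exists setT; split => //; exists setT; split => //; rewrite setXTT.
- by rewrite bigcup_const//; exists 0%N.
- move=> A [A1 [mA1 [A2 [mA2 ->]]]].
  by have e := h A1 A2 S' mA1 mA2 mS'; rewrite -QE muleC in e; exact: e.
- move=> _; have mTU := measurableI _ _ measurableT mUS.
  exact: le_lt_trans (probability_le1 P mTU) (ltry _).
Qed.

End Independence.

(** Integrating out U' with (Y, U) fixed annihilates the second factor. This orthogonality is what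
    makes the variance of an average over directions decay with their number. *)
Lemma Rint_indep_pair {R : realType} d (T : measurableType d) (P : probability T R)
    d1 (E1 : measurableType d1) d2 (E2 : measurableType d2) (Q : probability E2 R)
    (Y : T -> E1) (U U' : T -> E2) (g : E1 * E2 -> R) :
  measurable_fun setT Y -> measurable_fun setT U -> measurable_fun setT U' ->
  (forall A S S', measurable A -> measurable S -> measurable S' ->
     P (Y @^-1` A `&` U @^-1` S `&` U' @^-1` S') =
     (P (Y @^-1` A `&` U @^-1` S) * Q S')%E) ->
  bmf g -> (forall y, \int[Q]_x g (y, x) = 0) ->
  \int[P]_w (g (Y w, U w) * g (Y w, U' w)) = 0.
Proof.
move=> mY mU mU' h bg g0.
pose g2 (p : E1 * E2 * E2) := g p.1 * g (p.1.1, p.2).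
have bg2 : bmf g2.
  apply: bmfM; apply: bmf_comp => //.
  by apply: measurable_fun_pair => //; exact: measurableT_comp.
have mYU : measurable_fun setT (fun w => (Y w, U w)) by exact: measurable_fun_pair.
have [_] := Rint_indep mYU mU' (indep_pair_step mY mU mU' h) bg2.
rewrite /g2/= => ->; rewrite -[RHS](Rint_cst P); apply: eq_Rint => w.
rewrite RintZ ?g0 ?mulr0//.
have [mg [C hC]] := bg; split; last by exists C.
exact: (measurableT_comp mg).
Qed.

(** * Moments of the uniform law on the sphere *)

Section Sphere.
Context {R : realType} {n : nat}.
Local Notation V := 'cV[R]_n.

(** Householder reflection in the hyperplane orthogonal to v. The orthogonal invariance of the
    uniform law is exploited through these matrices. *)
Definition reflection (v : V) : 'M[R]_n := 1%:M - (2 / dot v v) *: (v *m v^T).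

Lemma reflectionE (v x : V) :
  reflection v *m x = x - (2 / dot v v * dot x v) *: v.
Proof.
rewrite mulmxBl mul1mx -scalemxAl -mulmxA; congr (_ - _).
rewrite -scalerA; congr (_ *: _).
apply/matrixP => i j; rewrite !mxE (ord1 j) big_ord1 mulrC; congr (_ * _).
by rewrite mxE; apply: eq_bigr => l _; rewrite mxE mulrC.
Qed.

Lemma trmx_reflection (v : V) : (reflection v)^T = reflection v.
Proof. by rewrite /reflection linearB/= trmx1 linearZ/= trmx_mul trmxK. Qed.

Lemma dot_reflection (v x y : V) : dot (reflection v *m x) y = dot x (reflection v *m y).
Proof. by rewrite dot_mulmx trmx_reflection. Qed.

Lemma reflectionK (v x : V) : v != 0 -> reflection v *m (reflection v *m x) = x.
Proof.
move=> v0; have d0 : dot v v != 0 by rewrite -sqr_enorm sqrf_eq0 gt_eqF// enorm_gt0.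
rewrite !reflectionE dotBl dotZl -addrA -opprD -scalerDl.
by rewrite [X in X *: _](_ : _ = 0) ?scale0r ?subr0//; field.
Qed.

Lemma reflection_orthogonal (v : V) : v != 0 -> (reflection v)^T *m reflection v = 1%:M.
Proof.
move=> v0; rewrite trmx_reflection; apply/matrixP => i j.
have := reflectionK (ebasis j) v0; rewrite mulmxA => /matrixP/(_ i 0).
by rewrite /ebasis -colE !mxE eqxx andbT.
Qed.

Lemma reflection_self (v : V) : reflection v *m v = - v.
Proof.
have [->|v0] := eqVneq v 0; first by rewrite mulmx0 oppr0.
have d0 : dot v v != 0 by rewrite -sqr_enorm sqrf_eq0 gt_eqF// enorm_gt0.
by rewrite reflectionE divfK// scaler_nat mulr2n opprD addNKr.
Qed.

Lemma enorm_reflection (v x : V) : v != 0 -> enorm (reflection v *m x) = enorm x.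
Proof.
move=> v0; apply/eqP; rewrite -(eqrXn2 (_ : 0 < 2)%N) ?enorm_ge0// !sqr_enorm.
by rewrite dot_reflection reflectionK.
Qed.

Lemma measurable_sphere : @measurable _ V sphere.
Proof.
have -> : @sphere R n = setT `&` enorm @^-1` [set 1].
  by rewrite setTI.
by apply: measurable_fun_enorm => //; exact: measurable_set1.
Qed.

Lemma measurable_mulmx (A : 'M[R]_n) : measurable_fun setT (fun x : V => A *m x).
Proof.
apply: measurable_fun_cV => i; under eq_fun do rewrite mxE.
apply: measurable_sum => j; apply: measurable_funM => //.
exact: measurable_coord.
Qed.

Variable nu : probability V R.
Hypothesis unu : unif_sphere nu.

Lemma Rint_reflection (v : V) f : v != 0 -> bmf f ->
  \int[nu]_u f (reflection v *m u) = \int[nu]_u f u.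
Proof.
move=> v0 bf.
pose Q : {mfun V >-> V} := HB.pack (fun u => reflection v *m u)
  (isMeasurableFun.Build _ _ _ _ _ (measurable_mulmx (reflection v))).
have -> : \int[nu]_u f u = \int[distribution nu Q]_u f u.
  rewrite /Rintegral; congr fine; apply: eq_measure_integral => A mA _.
  by case: unu => _ h; apply/esym/h => //; exact: reflection_orthogonal.
rewrite /Rintegral integral_distribution//.
  by apply/measurable_EFinP; case: bf.
apply: bmf_integrable; exact: (bmf_comp (measurable_mulmx (reflection v)) bf).
Qed.

Lemma indic_sphere_reflection (v u : V) : v != 0 ->
  \1_sphere (reflection v *m u) = \1_sphere u :> R.
Proof.
by move=> v0; rewrite !indicE; congr (_%:R); congr nat_of_bool;
  apply/idP/idP; rewrite !inE /sphere/= enorm_reflection.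
Qed.

Lemma Rint_sphere1 : \int[nu]_u \1_sphere u = 1.
Proof.
by rewrite Rint_indic; [case: unu => -> _|exact: measurable_sphere].
Qed.

(** [nu] lives on the whole space and is merely concentrated on the sphere; the indicator restores
    boundedness there. *)
Lemma bmf_sphere (f : V -> R) C : measurable_fun setT f ->
  (forall u, sphere u -> `|f u| <= C) -> bmf (fun u => \1_sphere u * f u).
Proof.
move=> mf hC; split.
  by apply: measurable_funM => //; apply: measurable_indic; exact: measurable_sphere.
exists `|C| => u; rewrite indicE normrM.
have [|] := boolP (u \in sphere); rewrite ?inE => uS.
  by rewrite normr1 mul1r (le_trans (hC _ uS))// ler_norm.
by rewrite normr0 mul0r.
Qed.

Let dot_bound (v u : V) : sphere u -> `|dot u v| <= enorm v.
Proof. by move=> u1; have := dot_normr_le u v; rewrite u1 mul1r. Qed.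

Let measurable_dot (v : V) : measurable_fun setT (dot^~ v).
Proof. exact: measurable_fun_dot. Qed.

Let bM (v w : V) : bmf (fun u => \1_sphere u * (dot u v * dot u w)).
Proof.
apply: (@bmf_sphere _ (enorm v * enorm w)).
  by apply: measurable_funM; exact: measurable_dot.
by move=> u Su; rewrite normrM; apply: ler_pM => //; exact: dot_bound.
Qed.

(** The second moment form is invariant under reflections. Reflecting along e_k changes the sign of
    the off-diagonal entries in row k, reflecting along e_k - e_l exchanges two diagonal entries,
    and the trace is the mean of |u|^2 = 1. *)
Lemma sphere_second_moment (v w : V) :
  \int[nu]_u (\1_sphere u * (dot u v * dot u w)) = dot v w / n%:R.
Proof.
pose M v w := \int[nu]_u (\1_sphere u * (dot u v * dot u w)).
rewrite -/(M v w).
have MR a x y : a != 0 -> M (reflection a *m x) (reflection a *m y) = M x y.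
  move=> a0; rewrite /M -[RHS](Rint_reflection a0)//.
  by apply: eq_Rint => u; rewrite indic_sphere_reflection// !dot_reflection.
have Ddot (k l : 'I_n) : dot (ebasis k : V) (ebasis l) = (k == l)%:R.
  by rewrite dot_ebasis mxE eqxx andbT eq_sym.
have e0 (k : 'I_n) : (ebasis k : V) != 0.
  apply/eqP => h; have := enorm_ebasis (R := R) k; rewrite h enorm0 => /eqP.
  by rewrite eq_sym oner_eq0.
have M0 (k l : 'I_n) : k != l -> M (ebasis k) (ebasis l) = 0.
  move=> kl; have := MR _ (ebasis k) (ebasis l) (e0 k).
  rewrite reflection_self reflectionE !Ddot (eq_sym l k) (negbTE kl) mulr0 scale0r subr0.
  rewrite {1}/M => h; have {h} : - M (ebasis k) (ebasis l) = M (ebasis k) (ebasis l).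
    rewrite -[RHS]h -mulN1r /M -RintZ//; apply: eq_Rint => u; rewrite dotNr; ring.
  by move=> h; lra.
have Mkl (k l : 'I_n) : M (ebasis k) (ebasis k) = M (ebasis l) (ebasis l).
  have [->//|kl] := eqVneq k l.
  have a0 : (ebasis k - ebasis l : V) != 0.
    apply/eqP => h; have := dotBl (ebasis k) (ebasis l) (ebasis k : V).
    rewrite h dot0l !Ddot eqxx (eq_sym l k) (negbTE kl) subr0 => /eqP.
    by rewrite eq_sym oner_eq0.
  rewrite -(MR _ (ebasis k) (ebasis k) a0).
  have -> : reflection (ebasis k - ebasis l) *m ebasis k = (ebasis l : V).
    rewrite reflectionE !(dotBl, dotBr) !Ddot !eqxx (eq_sym l) (negbTE kl).
    rewrite !subr0 sub0r opprK mulr1 divff; first by rewrite scale1r opprB addrC subrK.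
    by rewrite pnatr_eq0.
  by [].
have Msum : \sum_(k < n) M (ebasis k) (ebasis k) = 1.
  rewrite -Rint_sphere1 /M -Rint_sum//; apply: eq_Rint => u.
  rewrite -mulr_sumr indicE.
  have [|] := boolP (u \in sphere); rewrite ?inE ?mul0r// => Su.
  rewrite mul1r; transitivity (enorm u ^+ 2); last by rewrite Su expr1n.
  by rewrite sqr_enorm; apply: eq_bigr => k _; rewrite dot_ebasis.
have Mk (k : 'I_n) : M (ebasis k) (ebasis k) = n%:R^-1.
  have n0 : n%:R != 0 :> R by rewrite pnatr_eq0 -lt0n (leq_ltn_trans _ (ltn_ord k)).
  apply: (mulfI n0); rewrite divff//; transitivity (\sum_(l < n) M (ebasis l) (ebasis l)) => //.
  rewrite (eq_bigr (fun=> M (ebasis k) (ebasis k))).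
    by rewrite sumr_const card_ord mulr_natl.
  by move=> l _; exact: Mkl.
have ME : M v w = \sum_k \sum_l v k 0 * w l 0 * M (ebasis k) (ebasis l).
  transitivity (\int[nu]_u \sum_k \sum_l v k 0 * w l 0 *
      (\1_sphere u * (dot u (ebasis k) * dot u (ebasis l)))).
    apply: eq_Rint => u; rewrite /dot mulr_suml mulr_sumr; apply: eq_bigr => k _.
    rewrite mulr_sumr mulr_sumr; apply: eq_bigr => l _.
    rewrite -!/(dot _ _) !dot_ebasis; ring.
  rewrite Rint_sum; last first.
    by move=> k _; apply: bmf_sum => l _; apply: bmfM => //; exact: bmf_cst.
  apply: eq_bigr => k _; rewrite Rint_sum; last first.
    by move=> l _; apply: bmfM => //; exact: bmf_cst.
  by apply: eq_bigr => l _; rewrite RintZ.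
rewrite ME /dot mulr_suml; apply: eq_bigr => k _.
rewrite (bigD1 k)//= big1 ?addr0 ?Mk// => l lk.
by rewrite M0 ?mulr0// eq_sym.
Qed.

(* Reflecting u in the hyperplane orthogonal to v changes the sign of <u, v> and
   moves u by 2|<u, v>|/|v|, so only the variation of rho enters. *)
Lemma sphere_first_moment_lipschitz (rho : V -> R) K (b : V) : (0 < n)%N ->
  measurable_fun setT rho -> 0 <= K ->
  (exists C, forall u, sphere u -> `|rho u| <= C) ->
  (forall u u', sphere u -> sphere u' -> `|rho u - rho u'| <= K * enorm (u - u')) ->
  (forall l, b l 0 = \int[nu]_u (\1_sphere u * (rho u * u l 0))) ->
  n%:R * enorm b <= K.
Proof.
move=> n0 mrho K0 [C hC] hK bE.
have [->|v0] := eqVneq b 0; first by rewrite enorm0 mulr0.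
have nb := enorm_gt0 v0.
have n0' : 0 < n%:R :> R by rewrite ltr0n.
have bl l : bmf (fun u => \1_sphere u * (rho u * u l 0)).
  apply: (@bmf_sphere _ C); first by apply: measurable_funM => //; exact: measurable_coord.
  move=> u Su; rewrite normrM -[leRHS]mulr1; apply: ler_pM => //; first exact: hC.
  by have := normr_coord_le u l; rewrite Su.
have bd : bmf (fun u => \1_sphere u * (rho u * dot u b)).
  apply: (@bmf_sphere _ (C * enorm b)); first by apply: measurable_funM => //; exact: measurable_dot.
  by move=> u Su; rewrite normrM; apply: ler_pM => //; [exact: hC|exact: dot_bound].
have bbE : enorm b ^+ 2 = \int[nu]_u (\1_sphere u * (rho u * dot u b)).
  transitivity (\sum_l b l 0 * \int[nu]_u (\1_sphere u * (rho u * u l 0))).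
    by rewrite sqr_enorm; apply: eq_bigr => l _; rewrite -bE.
  under eq_bigr do rewrite -RintZ//.
  rewrite -Rint_sum; last by move=> l _; apply: bmfM => //; exact: bmf_cst.
  apply: eq_Rint => u; rewrite /dot !mulr_sumr; apply: eq_bigr => l _; ring.
have bbE' : enorm b ^+ 2 = - \int[nu]_u (\1_sphere u * (rho (reflection b *m u) * dot u b)).
  rewrite bbE -(Rint_reflection v0)// -mulN1r -RintZ.
    apply: eq_Rint => u; rewrite indic_sphere_reflection// dot_reflection reflection_self dotNr.
    ring.
  apply: (@bmf_sphere _ (C * enorm b)).
    apply: measurable_funM; last exact: measurable_dot.
    by apply: measurableT_comp => //; exact: measurable_mulmx.
  move=> u Su; rewrite normrM; apply: ler_pM => //; last exact: dot_bound.
  by apply: hC; rewrite /sphere/= enorm_reflection.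
have bd' : bmf (fun u => \1_sphere u * (rho (reflection b *m u) * dot u b)).
  apply: (@bmf_sphere _ (C * enorm b)).
    apply: measurable_funM; last exact: measurable_dot.
    by apply: measurableT_comp => //; exact: measurable_mulmx.
  move=> u Su; rewrite normrM; apply: ler_pM => //; last exact: dot_bound.
  by apply: hC; rewrite /sphere/= enorm_reflection.
(* Adding the two expressions of |b|^2 leaves the integral of (rho u - rho (R u)) <u, b>, with R the
   reflection, at most 2 K <u, b>^2 / |b| pointwise. The second moment then supplies the factor 1 /
   n that offsets the n of the statement. *)
have h2 : 2 * enorm b ^+ 2 <= 2 * (K / enorm b * (enorm b ^+ 2 / n%:R)).
  have -> : 2 * enorm b ^+ 2 = \int[nu]_u (\1_sphere u * (rho u * dot u b)) -
      \int[nu]_u (\1_sphere u * (rho (reflection b *m u) * dot u b)).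
    by rewrite -bbE -bbE'; ring.
  rewrite -RintB//.
  rewrite sqr_enorm -sphere_second_moment -!RintZ//; last by apply: bmfM => //; exact: bmf_cst.
  apply: le_Rint.
  - exact: bmfB.
  - by apply: bmfM; [exact: bmf_cst|apply: bmfM => //; exact: bmf_cst].
  move=> u; rewrite -mulrBr -mulrBl indicE.
  have [|] := boolP (u \in sphere); rewrite ?inE ?mul0r ?mulr0// => Su.
  rewrite !mul1r; apply: le_trans (ler_norm _) _; rewrite normrM.
  have Su' : sphere (reflection b *m u) by rewrite /sphere/= enorm_reflection.
  have := hK _ _ Su Su'; rewrite reflectionE opprB addrCA subrr addr0.
  rewrite enormZ normrM (@ger0_norm _ (2 / dot b b)); last by rewrite divr_ge0// dot_ge0.
  rewrite -sqr_enorm => h.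
  apply: le_trans (ler_wpM2r (normr_ge0 _) h) _.
  rewrite [leRHS](_ : _ = 2 * K / enorm b * (dot u b) ^+ 2); last by rewrite expr2; ring.
  rewrite -(real_normK (num_real (dot u b))) le_eqVlt; apply/orP; left; apply/eqP.
  by field; rewrite gt_eqF.
move: h2; rewrite ler_pM2l//.
rewrite (_ : K / enorm b * (enorm b ^+ 2 / n%:R) = (K / n%:R) * enorm b); last first.
  by field; rewrite !gt_eqF.
by rewrite expr2 ler_pM2r// ler_pdivlMr// mulrC.
Qed.

End Sphere.

(** * Calculus along segments *)

Section Calculus.
Context {R : realType}.

Lemma derive_grad k (f : 'cV[R]_k -> R) x v : differentiable f x ->
  'D_v f x = dot (grad f x) v.
Proof.
move=> df; rewrite {1}(ebasis_sum v) deriveE// linear_sum/=.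
by apply: eq_bigr => i _; rewrite linearZ/= mxE deriveE// mulrC.
Qed.

Lemma derive_coord k l (V : normedModType R) (f : V -> 'M[R]_(k, l)) x v i j :
  derivable f x v -> 'D_v (fun y => f y i j) x = ('D_v f x) i j.
Proof. by move=> df; rewrite derive_mx// mxE. Qed.

Lemma derive_jac k l (f : 'cV[R]_k -> 'cV[R]_l) x v : differentiable f x ->
  'D_v f x = jac f x *m v.
Proof.
move=> df; rewrite {1}(ebasis_sum v) deriveE// linear_sum/=.
apply/matrixP => i j; rewrite (ord1 j) summxE mxE.
by apply: eq_bigr => h _; rewrite linearZ/= !mxE deriveE// mulrC.
Qed.

Lemma differentiable_entry k l (V : normedModType R) (f : V -> 'M[R]_(k, l)) x i j :
  differentiable f x -> differentiable (fun y => f y i j) x.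
Proof.
move=> df; apply: (differentiable_comp (f := f) (g := fun A : 'M[R]_(k, l) => A i j)) => //.
exact: differentiable_coord.
Qed.

Lemma jac_coord k l (f : 'cV[R]_k -> 'cV[R]_l) x i j : differentiable f x ->
  jac f x i j = grad (fun y => f y i 0) x j 0.
Proof.
by move=> df; rewrite !mxE derive_coord//; exact: diff_derivable.
Qed.

Lemma is_derive_line (V W : normedModType R) (f : V -> W) (x w : V) (s : R) :
  derivable f (x + s *: w) w ->
  is_derive s 1 (fun s : R => f (x + s *: w)) ('D_w f (x + s *: w)).
Proof.
move=> df.
have E : (fun h : R => h^-1 *: (((fun s : R => f (x + s *: w)) \o shift s) (h *: (1 : R^o)) - f (x + s *: w)))
    = (fun h : R => h^-1 *: ((f \o shift (x + s *: w)) (h *: w) - f (x + s *: w))).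
  apply/funext => h /=; congr (_ *: (f _ - _)).
  by rewrite [h *: (1 : R^o)]mulr1 scalerDl addrCA.
by split; [rewrite /derivable E|rewrite /derive E].
Qed.

Lemma mvt_itv (phi dphi : R -> R) (a b : R) : a < b ->
  (forall s : R, a <= s -> s <= b -> is_derive s 1 phi (dphi s)) ->
  exists2 c, a < c < b & phi b - phi a = dphi c * (b - a).
Proof.
move=> ab h; have [||c] := @MVT R phi dphi a b ab.
- by move=> s; rewrite in_itv/= => /andP[s0 s1]; apply: h; exact: ltW.
- apply: continuous_in_subspaceT => s; rewrite inE/= in_itv/= => /andP[s0 s1].
  apply/differentiable_continuous/derivable1_diffP.
  by have [] := h s s0 s1.
by rewrite in_itv/= => cab e; exists c.
Qed.

Lemma mvt01 (phi dphi : R -> R) :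
  (forall s : R, 0 <= s -> s <= 1 -> is_derive s 1 phi (dphi s)) ->
  exists2 c, 0 < c < 1 & phi 1 - phi 0 = dphi c.
Proof. by move=> /(mvt_itv ltr01)[c c01]; rewrite subr0 mulr1; exists c. Qed.

(** Subtracting the primitive A s + c s^2 / 2 of the bound leaves a function whose derivative is
    nonpositive at the mean value point. *)
Lemma second_order_le (phi dphi : R -> R) (A c : R) :
  (forall s : R, 0 <= s -> s <= 1 -> is_derive s 1 phi (dphi s)) ->
  (forall s, 0 <= s -> s <= 1 -> dphi s <= A + c * s) ->
  phi 1 <= phi 0 + A + c / 2.
Proof.
move=> h hA.
pose psi s := phi s - (A * s + c / 2 * s ^+ 2).
have hpsi (s : R) : 0 <= s -> s <= 1 -> is_derive s 1 psi (dphi s - (A + c * s)).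
  move=> s0 s1; have ds := h s s0 s1.
  apply: is_deriveB.
  apply: is_derive_eq.
  by rewrite /GRing.scale/=; field.
have [x /andP[x0 x1]] := mvt01 hpsi.
have := hA x (ltW x0) (ltW x1); rewrite /psi; lra.
Qed.

(** The mean value point of each cell is moved to the left endpoint, at a cost of K / (N + 1)^2 per
    cell. Fixed nodes matter: intermediate points would vary with the data point z, and
    measurability of the sum in z would be lost. *)
Lemma riemann_variation_le (phi dphi : R -> R) K :
  (forall s : R, 0 <= s -> s <= 1 -> is_derive s 1 phi (dphi s)) ->
  (forall s s' : R, 0 <= s -> s <= s' -> s' <= 1 -> `|dphi s' - dphi s| <= K * (s' - s)) ->
  forall N, `|phi 1 - phi 0| <=
    N.+1%:R^-1 * (\sum_(k < N.+1) `|dphi (k%:R / N.+1%:R)|) + K / N.+1%:R.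
Proof.
move=> h hK N; set h0 := N.+1%:R^-1.
have h00 : 0 < h0 by rewrite invr_gt0.
have K0 : 0 <= K.
  by have := hK 0 1 (lexx _) ler01 (lexx _); rewrite subr0 mulr1; apply: le_trans.
have step k : (k < N.+1)%N ->
    `|phi (k.+1%:R * h0) - phi (k%:R * h0)| <= h0 * `|dphi (k%:R * h0)| + h0 * (K * h0).
  move=> kN.
  have k0 : 0 <= k%:R * h0 by rewrite mulr_ge0// ltW.
  have k1 : k.+1%:R * h0 <= 1 by rewrite ler_pdivrMr// mul1r ler_nat.
  have kS : k.+1%:R * h0 = k%:R * h0 + h0 by rewrite -natr1 mulrDl mul1r.
  have kk : k%:R * h0 < k.+1%:R * h0 by rewrite kS ltrDl.
  have [c /andP[c0 c1] ->] := mvt_itv kk (fun s s0 s1 => h s (le_trans k0 s0) (le_trans s1 k1)).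
  have -> : k.+1%:R * h0 - k%:R * h0 = h0 by rewrite kS addrAC subrr add0r.
  rewrite normrM (ger0_norm (ltW h00)) mulrC -mulrDr ler_pM2l//.
  rewrite -lerBlDl; apply: le_trans (lerB_dist _ _) _.
  apply: le_trans (hK _ _ k0 (ltW c0) (le_trans (ltW c1) k1)) _.
  by rewrite ler_wpM2l// lerBlDl -kS ltW.
have -> : phi 1 - phi 0 = \sum_(k < N.+1) (phi (k.+1%:R * h0) - phi (k%:R * h0)).
  rewrite -(big_mkord xpredT (fun k => phi (k.+1%:R * h0) - phi (k%:R * h0))).
  by rewrite telescope_sumr// mul0r mulfV.
apply: le_trans (ler_norm_sum _ _ _) _.
apply: (@le_trans _ _ (\sum_(k < N.+1) (h0 * `|dphi (k%:R * h0)| + h0 * (K * h0)))).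
  by apply: ler_sum => k _; exact: step.
rewrite big_split/= mulr_sumr lerD2l sumr_const card_ord -mulr_natl mulrA.
by rewrite mulfV// mul1r.
Qed.

Lemma differentiable_cV k (V : normedModType R) (g : V -> 'cV[R]_k) x :
  (forall i, differentiable (fun y => g y i 0) x) -> differentiable g x.
Proof.
move=> h; have -> : g = \sum_(i < k) (fun y => g y i 0 *: ebasis i).
  apply/funext => y; rewrite fct_sumE {1}(ebasis_sum (g y)).
  by [].
by apply: differentiable_sum => i; apply: differentiableZl.
Qed.

Lemma differentiable_dotl k (V : normedModType R) (g : V -> 'cV[R]_k) v x :
  differentiable g x -> differentiable (fun y => dot (g y) v) x.
Proof.
move=> dg; have -> : (fun y => dot (g y) v) = \sum_(i < k) (fun y => v i 0 *: g y i 0).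
  by apply/funext => y; rewrite fct_sumE; apply: eq_bigr => i _; exact: mulrC.
by apply: differentiable_sum => i; apply: differentiableZ; exact: differentiable_entry.
Qed.

Lemma derive_dotl k (V : normedModType R) (g : V -> 'cV[R]_k) v x w :
  derivable g x w -> 'D_w (fun y => dot (g y) v) x = dot ('D_w g x) v.
Proof.
move=> dg; have dgi i : derivable (fun y => g y i 0) x w.
  by move/derivable_mxP : dg; exact.
have -> : (fun y => dot (g y) v) = \sum_(i < k) (fun y => v i 0 *: g y i 0).
  by apply/funext => y; rewrite fct_sumE; apply: eq_bigr => i _; exact: mulrC.
rewrite derive_sum => [|i]; last exact: derivableZ.
by apply: eq_bigr => i _; rewrite deriveZ// derive_coord// mulrC.
Qed.

Lemma mvt_vec k l (g : 'cV[R]_k -> 'cV[R]_l) (x w : 'cV[R]_k) K :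
  (forall s, 0 <= s -> s <= 1 -> differentiable g (x + s *: w)) ->
  (forall s, 0 <= s -> s <= 1 -> enorm (jac g (x + s *: w) *m w) <= K) ->
  enorm (g (x + w) - g x) <= K.
Proof.
move=> dg hK; have K0 : 0 <= K := le_trans (enorm_ge0 _) (hK 0 (lexx _) ler01).
apply: enorm_dual => // v.
have h (s : R) : 0 <= s -> s <= 1 ->
    is_derive s 1 (fun s : R => dot (g (x + s *: w)) v) (dot (jac g (x + s *: w) *m w) v).
  move=> s0 s1; have df := dg s s0 s1.
  rewrite -derive_jac// -derive_dotl; last exact: diff_derivable.
  have dgv := diff_derivable (v := w) (differentiable_dotl v df).
  exact: (@is_derive_line _ _ (fun y => dot (g y) v) x w s dgv).
have [t /andP[t0 t1]] := mvt01 h; rewrite scale1r scale0r addr0 dotBl => ->.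
apply: le_trans (dot_le _ _) _; rewrite ler_wpM2r ?enorm_ge0//.
by apply: hK; exact: ltW.
Qed.

Lemma taylor1 k (f : 'cV[R]_k -> R) (x w : 'cV[R]_k) K :
  (forall s, 0 <= s -> s <= 1 -> differentiable f (x + s *: w)) ->
  (forall s, 0 <= s -> s <= 1 -> enorm (grad f (x + s *: w) - grad f x) <= K) ->
  `|f (x + w) - f x - dot (grad f x) w| <= K * enorm w.
Proof.
move=> df hK.
have h (s : R) : 0 <= s -> s <= 1 ->
    is_derive s 1 (fun s : R => f (x + s *: w)) (dot (grad f (x + s *: w)) w).
  move=> s0 s1; have d := df s s0 s1.
  rewrite -derive_grad//.
  exact: (@is_derive_line _ _ f x w s (diff_derivable d)).
have [t /andP[t0 t1]] := mvt01 h; rewrite scale1r scale0r addr0 => ->.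
rewrite -dotBl; apply: le_trans (dot_normr_le _ _) _.
by rewrite ler_wpM2r ?enorm_ge0//; apply: hK; exact: ltW.
Qed.

Lemma cvg_at_right0_le (f : R -> R) (l e : R) : f t @[t --> (0 : R)^'+] --> l -> 0 < e ->
  exists2 r, 0 < r & forall h, 0 < h -> h < r -> `|f h - l| <= e.
Proof.
move=> /cvgrPdist_le fl e0; have [r /= r0 hr] := fl e e0.
exists r => // h h0 hlt; rewrite distrC; apply: hr => //=.
by rewrite sub0r normrN gtr0_norm.
Qed.

(** Feasible directions yield expansions on one side at a time. In the interior the two sides
    together give a derivative; at the endpoints one side still gives the continuity required by the
    mean value theorem. *)
Lemma mvt_onesided (phi g : R -> R) :
  (forall t, 0 <= t -> t < 1 -> forall e, 0 < e -> exists2 r, 0 < r &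
     forall h, 0 < h -> h < r -> `|phi (t + h) - phi t - g t * h| <= e * h) ->
  (forall t, 0 < t -> t <= 1 -> forall e, 0 < e -> exists2 r, 0 < r &
     forall h, 0 < h -> h < r -> `|phi (t - h) - phi t + g t * h| <= e * h) ->
  exists2 c, 0 < c < 1 & phi 1 - phi 0 = g c.
Proof.
move=> hr hl.
have right t : 0 <= t -> t < 1 -> phi x @[x --> t^'+] --> phi t.
  move=> t0 t1; apply/cvgrPdist_le => e e0.
  have [r r0 h] := hr t t0 t1 1 ltr01.
  (* The expansion with error 1 bounds the increment over h by (1 + |g t|) h. *)
  pose c := 1 + `|g t|.
  have c0 : 0 < c by rewrite ltr_wpDr.
  exists (Num.min r (e / c)); first by rewrite /= lt_min r0 divr_gt0.
  move=> x /=; rewrite lt_min => /andP[xr xe] tx; rewrite distrC.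
  have xt : 0 < x - t by rewrite subr_gt0.
  rewrite distrC gtr0_norm// in xr; rewrite distrC gtr0_norm// in xe.
  have := h _ xt xr; rewrite (addrC t) subrK => h1.
  rewrite -[_ - _](subrK (g t * (x - t))); apply: le_trans (ler_normD _ _) _.
  move: xe; rewrite ltr_pdivlMr// => xe.
  rewrite normrM (gtr0_norm xt); rewrite /c in xe; nra.
have left t : 0 < t -> t <= 1 -> phi x @[x --> t^'-] --> phi t.
  move=> t0 t1; apply/cvgrPdist_le => e e0.
  have [r r0 h] := hl t t0 t1 1 ltr01.
  pose c := 1 + `|g t|.
  have c0 : 0 < c by rewrite ltr_wpDr.
  exists (Num.min r (e / c)); first by rewrite /= lt_min r0 divr_gt0.
  move=> x /=; rewrite lt_min => /andP[xr xe] tx; rewrite distrC.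
  have xt : 0 < t - x by rewrite subr_gt0.
  rewrite gtr0_norm// in xr; rewrite gtr0_norm// in xe.
  have := h _ xt xr; rewrite opprB (addrC t) subrK => h1.
  rewrite -[_ - _](addrK (g t * (t - x))); apply: le_trans (ler_normB _ _) _.
  move: xe; rewrite ltr_pdivlMr// => xe.
  rewrite normrM (gtr0_norm xt); rewrite /c in xe; nra.
have dphi (t : R) : t \in `]0, 1[ -> is_derive t 1 phi (g t).
  rewrite in_itv/= => /andP[t0 t1].
  have cvgd : (fun h : R => h^-1 *: ((phi \o shift t) (h *: (1 : R^o)) - phi t)) @ (0 : R)^' --> g t.
    apply/cvgrPdist_le => e e0.
    have [r r0 h1] := hr t (ltW t0) t1 e e0.
    have [r' r0' h2] := hl t t0 (ltW t1) e e0.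
    exists (Num.min r r'); first by rewrite /= lt_min r0.
    move=> h /=; rewrite sub0r normrN lt_min => /andP[hr1 hr2] hn.
    rewrite [h *: (1 : R^o)]mulr1 [_ *: _]mulrC.
    have hn0 : 0 < `|h| by rewrite normr_gt0.
    rewrite -(ler_pM2r hn0) -normrM mulrBl divfK//.
    have [h0|h0|h0] := ltgtP h 0; last by rewrite h0 eqxx in hn.
      rewrite (ltr0_norm h0) in hr2 *.
      have nh : 0 < - h by rewrite oppr_gt0.
      move: (h2 _ nh hr2); rewrite opprK (addrC t) -normrN /=.
      by rewrite [X in `|X| <= _](_ : _ = g t * h - (phi (h + t) - phi t)); last by ring.
    rewrite (gtr0_norm h0) in hr1 *.
    by move: (h1 _ h0 hr1); rewrite (addrC t) distrC.
  split; first by apply/cvg_ex; exists (g t).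
  exact: cvg_lim.
have cphi : {within `[0, 1], continuous phi}.
  apply/continuous_within_itvP => //; split.
  - move=> t /dphi[dt _]; apply/differentiable_continuous.
    by apply/derivable1_diffP.
  - exact: right.
  - exact: left.
have [c] := MVT (@ltr01 R) dphi cphi.
by rewrite in_itv/= subr0 mulr1 => c01 ->; exists c.
Qed.

End Calculus.

(** * Densities, Cauchy-Schwarz and Fatou bounds *)

Section Density.
Local Open Scope ereal_scope.
Context {R : realType} {d} {T : measurableType d}.
Variables (mu : {measure set T -> \bar R}) (P : probability T R) (p : T -> R).
Hypotheses (mp : measurable_fun setT p) (p0 : forall x, (0 <= p x)%R).
Hypothesis PE : forall A, measurable A -> P A = \int[mu]_(x in A) (p x)%:E.

Let mpE : measurable_fun setT (EFin \o p). Proof. exact/measurable_EFinP. Qed.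

Import HBNNSimple.

Lemma ge0_integral_density (f : T -> \bar R) :
  measurable_fun setT f -> (forall x, 0 <= f x) ->
  \int[P]_x f x = \int[mu]_x (f x * (p x)%:E).
Proof.
move=> mf f0; pose h := nnsfun_approx measurableT mf.
have -> : \int[P]_x f x = lim (\int[P]_x (EFin \o h n) x @[n --> \oo]).
  have fE x : f x = lim ((EFin \o h n) x @[n --> \oo]).
    by apply/esym/cvg_lim => //; exact: cvg_nnsfun_approx.
  under eq_integral do rewrite fE.
  apply: monotone_convergence => //.
  - by move=> n; apply/measurable_EFinP.
  - by move=> n x _ /=; rewrite lee_fin.
  - by move=> x _ a b ab; rewrite lee_fin; exact/lefP/nd_nnsfun_approx.
have -> : \int[mu]_x (f x * (p x)%:E) =
    lim (\int[mu]_x ((EFin \o h n) x * (p x)%:E) @[n --> \oo]).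
  have fE x : f x * (p x)%:E = lim (((EFin \o h n) x * (p x)%:E) @[n --> \oo]).
    by apply/esym/cvg_lim => //; apply: cvgeZr => //; exact: cvg_nnsfun_approx.
  under eq_integral do rewrite fE.
  apply: monotone_convergence => //.
  - by move=> n; apply: emeasurable_funM => //; apply/measurable_EFinP.
  - by move=> n x _ /=; rewrite mule_ge0 ?lee_fin.
  - move=> x _ a b ab/=; rewrite lee_wpmul2r ?lee_fin//.
    exact/lefP/nd_nnsfun_approx.
suff E n : \int[P]_x (EFin \o h n) x = \int[mu]_x ((EFin \o h n) x * (p x)%:E).
  by under eq_fun do rewrite E.
transitivity (\int[P]_x (\sum_(y \in range (h n)) (y * \1_(h n @^-1` [set y]) x)%:E)).
  by apply: eq_integral => t tE; rewrite /= fimfunE -fsumEFin.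
have mI y : measurable (h n @^-1` [set y]) by exact: measurable_funPTI.
rewrite ge0_integral_fsum//; last 2 first.
- by move=> y; apply/measurable_EFinP; apply: measurable_funM.
- by move=> m y _; exact: nnfun_muleindic_ge0.
transitivity (\int[mu]_x ((\sum_(y \in range (h n)) (y * \1_(h n @^-1` [set y]) x)%:E) * (p x)%:E)).
  rewrite (_ : (fun x => _) = (fun x => \sum_(y \in range (h n)) ((y * \1_(h n @^-1` [set y]) x)%:E * (p x)%:E))); last first.
    apply/funext => x; rewrite ge0_mule_fsuml// => y.
    exact: nnfun_muleindic_ge0.
  rewrite ge0_integral_fsum//; last 2 first.
  - move=> y; apply: emeasurable_funM => //; apply/measurable_EFinP; exact: measurable_funM.
  - by move=> y x _; rewrite mule_ge0// ?lee_fin//; exact: nnfun_muleindic_ge0.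
  apply: eq_fsbigr => y; rewrite inE => -[z _ zy].
  have y0 : (0 <= y)%R by rewrite -zy.
  under eq_integral do rewrite EFinM.
  rewrite ge0_integralZl//; last by apply/measurable_EFinP.
  have -> : \int[P]_x (\1_(h n @^-1` [set y]) x)%:E =
      \int[mu]_(x in h n @^-1` [set y]) (p x)%:E.
    by rewrite integral_indic// setIT; exact: PE.
  under [RHS]eq_integral do rewrite EFinM -muleA.
  rewrite ge0_integralZl//; last 2 first.
  - by apply: emeasurable_funM => //; apply/measurable_EFinP.
  - by move=> x _; rewrite mule_ge0 ?lee_fin.
  congr (_ * _); rewrite integral_mkcond; apply: eq_integral => x _.
  by rewrite patchE indicE; case: ifPn => _; rewrite ?mul1e ?mul0e.
by apply: eq_integral => x _; rewrite /= [in RHS]fimfunE -fsumEFin.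
Qed.

Lemma integrable_density (f : T -> R) : P.-integrable setT (EFin \o f) ->
  mu.-integrable setT (fun x => (f x * p x)%:E) /\
  (\int[P]_x f x = \int[mu]_x (f x * p x))%R.
Proof.
move=> /[dup] fi /integrableP[/measurable_EFinP mf foo]; split.
  apply/integrableP; split; first by apply/measurable_EFinP; exact: measurable_funM.
  move: foo; rewrite ge0_integral_density//; last by do 2 apply: measurableT_comp => //.
  by under eq_integral do rewrite -EFinM -[X in (_ * X)%R]ger0_norm// -normrM.
rewrite /Rintegral; congr fine; rewrite integralE [RHS]integralE.
rewrite !ge0_integral_density//; last 2 first.
- by apply: measurable_funeneg; apply/measurable_EFinP.
- by apply: measurable_funepos; apply/measurable_EFinP.
congr (_ - _); apply: eq_integral => x _.
  by rewrite !funeposE EFinM maxe_pMl ?mul0e// lee_fin.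
by rewrite !funenegE EFinM -mulNe maxe_pMl ?mul0e// lee_fin.
Qed.

End Density.

Section CauchySchwarz.
Context {R : realType} {d} {T : measurableType d}.
Variables (mu : {measure set T -> \bar R}).

(** The optimal t is B / A. Either number may vanish, so both are first enlarged by r > 0. *)
Lemma amgm_le (x A B : R) : 0 <= A -> 0 <= B ->
  (forall t, 0 < t -> x <= (t * A ^+ 2 + t^-1 * B ^+ 2) / 2) -> x <= A * B.
Proof.
move=> A0 B0 h; apply/ler_addgt0Pr => e e0.
have h1 (r : R) : 0 < r -> x <= (A + r) * (B + r).
  move=> r0; have a0 : 0 < A + r by rewrite ltr_wpDl.
  have b0 : 0 < B + r by rewrite ltr_wpDl.
  apply: le_trans (h ((B + r) / (A + r)) _) _; first by rewrite divr_gt0.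
  rewrite invf_div.
  apply: (@le_trans _ _ (((B + r) / (A + r) * (A + r) ^+ 2 + (A + r) / (B + r) * (B + r) ^+ 2) / 2)).
    rewrite ler_pM2r// lerD//.
      by apply: ler_wpM2l; [rewrite ltW// divr_gt0|apply: lerXn2r; rewrite ?nnegrE; lra].
    by apply: ler_wpM2l; [rewrite ltW// divr_gt0|apply: lerXn2r; rewrite ?nnegrE; lra].
  rewrite le_eqVlt; apply/orP; left; apply/eqP.
  by field; rewrite !gt_eqF.
pose r := Num.min 1 (e / (A + B + 1)).
have c0 : 0 < A + B + 1 by lra.
have r0 : 0 < r by rewrite lt_min ltr01 divr_gt0.
have r1 : r <= 1 by rewrite ge_min lexx.
have re : r * (A + B + 1) <= e by rewrite -ler_pdivlMr// ge_min lexx orbT.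
apply: le_trans (h1 _ r0) _; nra.
Qed.

Local Open Scope ereal_scope.

(** Young's inequality is integrated for every t, then optimised by [amgm_le]. Working with extended
    integrals makes finiteness of the product part of the conclusion. *)
Lemma cauchy_schwarz_le (f g : T -> R) (A B : R) :
  measurable_fun setT f -> measurable_fun setT g -> (0 <= A)%R -> (0 <= B)%R ->
  \int[mu]_x (f x ^+ 2)%:E <= (A ^+ 2)%:E ->
  \int[mu]_x (g x ^+ 2)%:E <= (B ^+ 2)%:E ->
  \int[mu]_x `|f x * g x|%:E <= (A * B)%:E.
Proof.
move=> mf mg A0 B0 hf hg.
have mf2 : measurable_fun setT (fun x => (f x ^+ 2)%:E).
  by apply/measurable_EFinP; exact: measurable_funX.
have mg2 : measurable_fun setT (fun x => (g x ^+ 2)%:E).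
  by apply/measurable_EFinP; exact: measurable_funX.
have mfg : measurable_fun setT (fun x => `|f x * g x|%:E).
  by apply/measurable_EFinP; apply: measurableT_comp => //; exact: measurable_funM.
have key t : (0 < t)%R ->
    \int[mu]_x `|f x * g x|%:E <= ((t * A ^+ 2 + t^-1 * B ^+ 2) / 2)%:E.
  move=> t0; have ti0 : (0 < t^-1)%R by rewrite invr_gt0.
  apply: (@le_trans _ _ (\int[mu]_x ((t / 2)%:E * (f x ^+ 2)%:E + (t^-1 / 2)%:E * (g x ^+ 2)%:E))).
    apply: ge0_le_integral => //.
      by apply: emeasurable_funD; apply: emeasurable_funM.
    move=> x _; rewrite -!EFinM -EFinD lee_fin normrM.
    have h : (0 <= (t * `|f x| - `|g x|) ^+ 2)%R by exact: sqr_ge0.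
    rewrite -(real_normK (num_real (f x))) -(real_normK (num_real (g x))).
    set a := (`|f x|)%R in h *; set b := (`|g x|)%R in h *.
    rewrite -subr_ge0 (_ : _ - _ = t^-1 / 2 * (t * a - b) ^+ 2)%R.
      by rewrite mulr_ge0// divr_ge0// ltW.
    by field; rewrite gt_eqF.
  rewrite ge0_integralD//; last 4 first.
  - by move=> x _; rewrite -EFinM lee_fin mulr_ge0 ?sqr_ge0// divr_ge0// ltW.
  - by apply: emeasurable_funM.
  - by move=> x _; rewrite -EFinM lee_fin mulr_ge0 ?sqr_ge0// divr_ge0// ltW.
  - by apply: emeasurable_funM.
  rewrite !ge0_integralZl//; last 4 first.
  - by move=> x _; rewrite lee_fin sqr_ge0.
  - by rewrite lee_fin divr_ge0// ltW.
  - by move=> x _; rewrite lee_fin sqr_ge0.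
  - by rewrite lee_fin divr_ge0// ltW.
  rewrite mulrDl EFinD; apply: leeD.
    by rewrite (mulrAC t) [leRHS]EFinM; apply: lee_wpmul2l => //; rewrite lee_fin divr_ge0// ltW.
  by rewrite (mulrAC t^-1%R) [leRHS]EFinM; apply: lee_wpmul2l => //; rewrite lee_fin divr_ge0// ltW.
have i0 : 0 <= \int[mu]_x `|f x * g x|%:E by exact: integral_ge0.
have ifin : \int[mu]_x `|f x * g x|%:E \is a fin_num.
  rewrite ge0_fin_numE//; apply: le_lt_trans (key 1%R ltr01) _; exact: ltry.
rewrite -(fineK ifin) lee_fin; apply: amgm_le => // t t0.
by rewrite -lee_fin (fineK ifin); exact: key.
Qed.

Lemma integrable_mul (f g : T -> R) :
  measurable_fun setT f -> measurable_fun setT g ->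
  \int[mu]_x (f x ^+ 2)%:E < +oo -> \int[mu]_x (g x ^+ 2)%:E < +oo ->
  mu.-integrable setT (fun x => (f x * g x)%:E).
Proof.
move=> mf mg hf hg; apply/integrableP; split.
  by apply/measurable_EFinP; exact: measurable_funM.
have P (h : T -> R) : \int[mu]_x (h x ^+ 2)%:E < +oo ->
    exists2 A, (0 <= A)%R & \int[mu]_x (h x ^+ 2)%:E <= (A ^+ 2)%:E.
  move=> hh; have h0 : 0 <= \int[mu]_x (h x ^+ 2)%:E.
    by apply: integral_ge0 => x _; rewrite lee_fin sqr_ge0.
  exists (Num.sqrt (fine (\int[mu]_x (h x ^+ 2)%:E))); first exact: sqrtr_ge0.
  by rewrite sqr_sqrtr ?fine_ge0// fineK// ge0_fin_numE.
have [A A0 hA] := P _ hf; have [B B0 hB] := P _ hg.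
by apply: le_lt_trans (cauchy_schwarz_le mf mg A0 B0 hA hB) _; exact: ltry.
Qed.

End CauchySchwarz.

Section FatouBound.
Local Open Scope ereal_scope.
Context {R : realType} {d} {T : measurableType d}.
Variables (mu : {measure set T -> \bar R}).

(** The constant K may depend on x arbitrarily: the error K / (N + 1) disappears in the pointwise
    lower limit, before any integration. *)
Lemma fatou_bound (a : T -> R) (u : nat -> T -> R) (C : R) :
  measurable_fun setT a -> (forall x, 0 <= a x)%R ->
  (forall N, measurable_fun setT (u N)) -> (forall N x, 0 <= u N x)%R ->
  (forall x, exists K, forall N, a x <= u N x + K / N.+1%:R)%R ->
  (forall N, \int[mu]_x (u N x)%:E <= C%:E) ->
  \int[mu]_x (a x)%:E <= C%:E.
Proof.
move=> ma a0 mu_ u0 hau hC.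
have mE N : measurable_fun setT (fun x => (u N x)%:E) by apply/measurable_EFinP.
have le1 x : (a x)%:E <= limn_einf (fun N => (u N x)%:E).
  have [K hK] := hau x.
  apply/lee_addgt0Pr => e e0; rewrite -leeBlDr// -EFinB limn_einf_lim.
  apply: lime_ge; first exact: is_cvg_einfs.
  near=> N; apply: le_ereal_inf_tmp => _ [k /= Nk <-]; rewrite lee_fin lerBlDr.
  apply: le_trans (hK k) _; rewrite lerD2l.
  rewrite ler_pdivrMr// mulrC -ler_pdivrMr//.
  apply: (@le_trans _ _ N%:R); last by rewrite ler_nat ltnW.
  near: N; exact: nbhs_infty_ger.
have le2 : \int[mu]_x (a x)%:E <= \int[mu]_x limn_einf (fun N => (u N x)%:E).
  apply: ge0_le_integral => //.
  - by move=> x _; rewrite lee_fin.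
  - by apply/measurable_EFinP.
  - have E x : limn_einf (fun N => (u N x)%:E) = - limn_esup (fun N => - (u N x)%:E).
      rewrite -limn_einfN; congr limn_einf; apply/funext => N.
      by apply/esym; exact: oppeK.
    under eq_fun do rewrite E.
    apply: measurableT_comp => //.
    by apply: measurable_fun_limn_esup => N; apply: measurableT_comp.
apply: le_trans le2 _; apply: le_trans (fatou mu measurableT mE _) _.
  by move=> N x _; rewrite lee_fin.
rewrite limn_einf_lim; apply: lime_le; first exact: is_cvg_einfs.
near=> N; apply: le_trans (hC N); apply: ereal_inf_lbound; exists N => //=.
Unshelve. all: by end_near. Qed.

End FatouBound.

(** * Densities and score of the model *)

Lemma measurable_inv {R : realType} : measurable_fun setT (@GRing.inv R).
Proof.
have -> : [set: R] = [set 0] `|` ~` [set 0] by rewrite setUv.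
apply/measurable_funU => //; first exact: measurableC.
split; first exact: measurable_fun_set1.
apply: open_continuous_measurable_fun.
  by apply: closed_openC; exact: closed_eq.
by move=> x; rewrite inE/= => /eqP x0; exact: inv_continuous.
Qed.

Section ModelDensity.
Context {R : realType} {n m d : nat} (M : model R n m d).
Hypotheses (HS : model_setting M) (HB : convex_set (Bset M)).
Hypothesis HD : assumption_densities M.

Local Notation B := (Bset M).
Local Notation p := (dens M).

Definition segm (b0 b1 : 'cV[R]_m) (t : R) : 'cV[R]_m := b0 + t *: (b1 - b0).

Lemma segm_in b0 b1 t : B b0 -> B b1 -> 0 <= t -> t <= 1 -> B (segm b0 b1 t).
Proof. by move=> h0 h1 t0 t1; apply: (convexP _).1. Qed.

Lemma dens_differentiable z b : B b -> differentiable (p z) b.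
Proof. by move=> Bb; have [U [_ BU _ h]] := dens_C2 HD; have [+ _] := h z; apply; exact: BU. Qed.

Lemma D_dens_differentiable z b v : B b -> differentiable (fun b => 'D_v (p z) b) b.
Proof.
move=> Bb; have [U [_ BU _ h]] := dens_C2 HD.
by have [_ /(_ v)[+ _]] := h z; apply; exact: BU.
Qed.

Lemma D2_dens_continuous z b v v' : B b ->
  {for b, continuous (fun b => 'D_v' (fun b => 'D_v (p z) b) b)}.
Proof.
move=> Bb; have [U [_ BU _ h]] := dens_C2 HD.
by have [_ /(_ v)[_ /(_ v')]] := h z; apply; exact: BU.
Qed.

Lemma dens_supp0 z b0 b : B b0 -> B b -> ~ supp M b0 z -> p z b = 0.
Proof.
move=> B0 Bb; rewrite (supp_common HD B0 Bb) /supp/= => /negP.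
by rewrite -leNgt => h; apply/eqP; rewrite eq_le h dens_ge0.
Qed.

Lemma D_dens_score z b v : B b -> supp M b z ->
  'D_v (p z) b = dot (score M z b) v * p z b.
Proof.
move=> Bb pz; have df := dens_differentiable z Bb.
have dln : differentiable (@ln R) (p z b).
  by apply/derivable1_diffP; apply: ex_derive; exact: is_derive1_ln.
have dlp : differentiable (fun b => ln (p z b)) b.
  by apply: (differentiable_comp (f := p z) (g := @ln R)).
rewrite /score pz -derive_grad//.
have -> : 'D_v (fun b => ln (p z b)) b = (p z b)^-1 * 'D_v (p z) b.
  rewrite !deriveE// (diff_comp (f := p z) (g := @ln R))//= deriv1E; last first.
    by apply: ex_derive; exact: is_derive1_ln.
  have /= [_ e] := is_derive1_ln pz.
  by rewrite derive1E e mulrC.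
by rewrite mulrAC mulVf ?mul1r// gt_eqF.
Qed.

Lemma measurable_dens b : B b -> measurable_fun setT (p ^~ b).
Proof. exact: dens_measurable. Qed.

(** A limit of difference quotients. Their nodes b + v / (N + 1) may leave [Bset], so measurability
    of the density is taken from the open neighbourhood U of [dens_C2], where the nodes lie from
    some N0 on. *)
Lemma measurable_D_dens b v : B b -> measurable_fun setT (fun z => 'D_v (p z) b).
Proof.
move=> Bb; have [U [oU BU mU h]] := dens_C2 HD.
have [N0 hN0] : exists N0, forall N, (N0 <= N)%N -> U (N.+1%:R^-1 *: v + b).
  have /nbhs_ballP[e /= e0 he] : nbhs b U by apply: open_nbhs_nbhs; split => //; exact: BU.
  exists (Num.truncn (`|v| / e)) => N N0N; apply: he.
  rewrite -ball_normE/= opprD addrA addrAC subrr add0r normrN normrZ ger0_norm ?invr_ge0//.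
  rewrite mulrC ltr_pdivrMr// mulrC -ltr_pdivrMr//.
  by apply: lt_le_trans (truncnS_gt _) _; rewrite ler_nat.
pose g N z := (N + N0).+1%:R * (p z ((N + N0).+1%:R^-1 *: v + b) - p z b).
apply: (@measurable_fun_cvg _ _ _ setT g).
  move=> N; apply: measurable_funM => //; apply: measurable_funB.
    by apply: mU; apply: hN0; exact: leq_addl.
  exact: measurable_dens.
move=> z _; have df := diff_derivable (v := v) (dens_differentiable z Bb).
have c1 : (fun N => (N + N0).+1%:R^-1 : R) @ \oo --> (0 : R)^'.
  move=> A [e /= e0 hA]; exists (Num.truncn e^-1) => // N /= eN.
  have nz : (N + N0).+1%:R^-1 != 0 :> R by rewrite invr_eq0 pnatr_eq0.
  apply: (hA _ _ nz); rewrite /= sub0r normrN ger0_norm ?invr_ge0//.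
  rewrite invf_plt ?posrE//.
  apply: lt_le_trans (truncnS_gt _) _; rewrite ler_nat ltnS.
  exact: leq_trans (leq_addr _ _).
apply: cvg_trans (cvg_comp _ _ c1 df).
by apply: near_eq_cvg; near=> N; rewrite /g/= invrK.
Unshelve. all: by end_near. Qed.

(** Off the support both sides are 0, the inverse of 0 being 0; the formula thus holds for all z and
    makes the score measurable. *)
Lemma score_coordE z b i : B b -> score M z b i 0 = 'D_(ebasis i) (p z) b / p z b.
Proof.
move=> Bb; have := dens_ge0 HS z Bb; rewrite le_eqVlt => /predU1P[pz|pz].
  by rewrite /score -pz ltxx mxE invr0 mulr0.
by rewrite D_dens_score// dot_ebasis mulfK// gt_eqF.
Qed.

Lemma measurable_score b : B b -> measurable_fun setT (fun z => score M z b).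
Proof.
move=> Bb; apply: measurable_fun_cV => i; under eq_fun do rewrite score_coordE//.
apply: measurable_funM; first exact: measurable_D_dens.
by apply: (measurableT_comp measurable_inv); exact: measurable_dens.
Qed.

Lemma segm_continuous b0 b1 t : {for t, continuous (segm b0 b1)}.
Proof.
by apply/differentiable_continuous; apply: differentiableD.
Qed.

Lemma is_derive_dens z b0 b1 (t : R) : B b0 -> B b1 -> 0 <= t -> t <= 1 ->
  is_derive t 1 (fun t => p z (segm b0 b1 t)) ('D_(b1 - b0) (p z) (segm b0 b1 t)).
Proof.
move=> h0 h1 t0 t1; apply: is_derive_line; apply: diff_derivable.
by apply: dens_differentiable; exact: segm_in.
Qed.

(** The second derivative along the segment is continuous, hence bounded on [0, 1]. The bound
    depends on z with no control, which [fatou_bound] tolerates. *)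
Lemma D_dens_lipschitz z b0 b1 : B b0 -> B b1 -> exists K, forall s s' : R,
  0 <= s -> s <= s' -> s' <= 1 ->
  `|'D_(b1 - b0) (p z) (segm b0 b1 s') - 'D_(b1 - b0) (p z) (segm b0 b1 s)|
    <= K * (s' - s).
Proof.
move=> h0 h1; set w := b1 - b0.
pose q (t : R) := 'D_w (p z) (segm b0 b1 t).
pose q' (t : R) := 'D_w (fun b => 'D_w (p z) b) (segm b0 b1 t).
have cq : {within `[(0 : R), 1], continuous (fun t => `|q' t|)}.
  apply: continuous_in_subspaceT => t; rewrite inE/= in_itv/= => /andP[t0 t1].
  apply: (@continuous_comp _ _ _ q' (fun x : R => `|x|)); last exact: norm_continuous.
  apply: (@continuous_comp _ _ _ (segm b0 b1) (fun b => 'D_w (fun b => 'D_w (p z) b) b) t); first exact: segm_continuous.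
  by apply: D2_dens_continuous; exact: segm_in.
have [c _ hc] := EVT_max ler01 cq.
exists `|q' c| => s s' s0 ss' s1.
have [->|ne] := eqVneq s s'; first by rewrite !subrr normr0 mulr0.
have lt : s < s' by rewrite lt_neqAle ne.
have dq (t : R) : s <= t -> t <= s' -> is_derive t 1 q (q' t).
  move=> st ts'.
  suff Bt : B (segm b0 b1 t).
    exact: (@is_derive_line R _ _ (fun b => 'D_w (p z) b) b0 w t
              (diff_derivable (D_dens_differentiable z w Bt))).
  apply: segm_in => //; first exact: le_trans st.
  exact: le_trans s1.
have [x /andP[sx xs] ->] := mvt_itv lt dq.
have hx : `|q' x| <= `|q' c|.
  by apply: hc; rewrite in_itv/= (le_trans s0 (ltW sx))/= (le_trans (ltW xs)).
have ss0 : 0 <= s' - s by rewrite subr_ge0.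
move: (q' x) hx => y hy.
by rewrite normrM (ger0_norm ss0) ler_wpM2r.
Qed.

Lemma Dist_ge0_integral b (f : 'cV[R]_d -> R) : B b -> measurable_fun setT f ->
  (forall z, 0 <= f z) ->
  (\int[Dist M b]_z (f z)%:E = \int[mu M]_z (f z * p z b)%:E)%E.
Proof.
move=> Bb mf f0; rewrite (@ge0_integral_density _ _ _ (mu M) _ (p ^~ b))//.
- exact: measurable_dens.
- by move=> z; exact: dens_ge0.
- by move=> A mA; exact: DistE.
- exact/measurable_EFinP.
Qed.

(* Differentiating the density along the segment, with Fatou's lemma applied to
   Riemann sums of the derivative. *)
Lemma dens_variation_le b0 b1 (f : 'cV[R]_d -> R) (C : R) : B b0 -> B b1 ->
  measurable_fun setT f -> (forall z, 0 <= f z) ->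
  (forall t, 0 <= t -> t <= 1 ->
    (\int[Dist M (segm b0 b1 t)]_z
       (f z * `|dot (score M z (segm b0 b1 t)) (b1 - b0)|)%:E <= C%:E)%E) ->
  (\int[mu M]_z (f z * `|p z b1 - p z b0|)%:E <= C%:E)%E.
Proof.
move=> h0 h1 mf f0 hC; set w := b1 - b0.
have segk N (k : 'I_N.+1) : B (segm b0 b1 (k%:R / N.+1%:R)).
  apply: segm_in => //; by rewrite ler_pdivrMr// mul1r ler_nat ltnW.
pose v N (k : 'I_N.+1) z := f z * `|dot (score M z (segm b0 b1 (k%:R / N.+1%:R))) w|.
have mv N k : measurable_fun setT (@v N k).
  apply: measurable_funM => //; apply: measurableT_comp => //.
  by apply: measurable_fun_dot => //; apply: measurable_score; exact: segk.
have v0 N k z : 0 <= @v N k z by rewrite mulr_ge0.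
(* The Riemann sum of the derivative of the density, each term rewritten as score times density at
   its node, so that its integral is an expectation under the law of that node. *)
pose u N z := N.+1%:R^-1 * \sum_(k < N.+1) v N k z * p z (segm b0 b1 (k%:R / N.+1%:R)).
have mvp N (k : 'I_N.+1) : measurable_fun setT (fun z => v N k z * p z (segm b0 b1 (k%:R / N.+1%:R))).
  by apply: measurable_funM => //; apply: measurable_dens; exact: segk.
have vp0 N (k : 'I_N.+1) z : 0 <= v N k z * p z (segm b0 b1 (k%:R / N.+1%:R)).
  by rewrite mulr_ge0// dens_ge0.
apply: (@fatou_bound _ _ _ (mu M) _ u).
- apply: measurable_funM => //; apply: measurableT_comp => //.
  by apply: measurable_funB; exact: measurable_dens.
- by move=> z; rewrite mulr_ge0.
- by move=> N; apply: measurable_funM => //; apply: measurable_sum.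
- by move=> N z; rewrite mulr_ge0 ?invr_ge0// sumr_ge0.
- move=> z; have [sz|sz] := pselect (supp M b0 z); last first.
    exists 0 => N; rewrite mul0r addr0 (dens_supp0 h0 h1 sz) (dens_supp0 h0 h0 sz).
    by rewrite subrr normr0 mulr0 mulr_ge0 ?invr_ge0// sumr_ge0.
  have [K hK] := D_dens_lipschitz z h0 h1; exists (f z * K) => N.
  have := riemann_variation_le (fun s => @is_derive_dens z b0 b1 s h0 h1) hK N.
  rewrite /segm scale1r scale0r addr0 subrKC => /(ler_wpM2l (f0 z)).
  move=> h; apply: le_trans h _.
  rewrite mulrDr [f z * (K / _)]mulrA lerD2r /u mulrCA.
  rewrite ler_pM2l// mulr_sumr; apply: ler_sum => k _.
  rewrite /v -mulrA ler_wpM2l// -/(segm b0 b1 (k%:R / N.+1%:R)).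
  rewrite D_dens_score//; last by rewrite -(supp_common HD h0).
  by rewrite normrM (ger0_norm (dens_ge0 HS z (segk N k))).
- move=> N; rewrite /u.
  under eq_integral do rewrite EFinM -sumEFin.
  rewrite ge0_integralZl//; last 2 first.
  + by apply: emeasurable_sum => k; apply/measurable_EFinP.
  + by move=> z _; apply: sume_ge0 => k _; rewrite lee_fin.
  rewrite ge0_integral_sum//; last 2 first.
  + by move=> k; apply/measurable_EFinP.
  + by move=> k z _; rewrite lee_fin.
  apply: (@le_trans _ _ (N.+1%:R^-1%:E * \sum_(k < N.+1) C%:E)%E).
    apply: lee_wpmul2l; first by rewrite lee_fin invr_ge0.
    apply: lee_sum => k _; rewrite -Dist_ge0_integral//.
    apply: hC => //; by rewrite ler_pdivrMr// mul1r ler_nat ltnW.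
  by rewrite sumEFin -EFinM lee_fin sumr_const card_ord -[C *+ _]mulr_natl mulrA mulVf ?mul1r// pnatr_eq0.
Qed.

End ModelDensity.

(** * Moment bounds of the model *)

Section ModelMoments.
Context {R : realType} {n m d : nat} (M : model R n m d) (c : constants R).
Hypotheses (HS : model_setting M) (HB : convex_set (Bset M)).
Hypotheses (HD : assumption_densities M) (HG : assumption_growth M).
Hypothesis HC : valid_constants M c.

Local Notation B := (Bset M).
Local Notation p := (dens M).
Local Notation D := (Dist M).
Local Notation s := (score M).

(** The law has a density that vanishes off the support, so a comparison on the support is enough;
    the growth bounds hold only there or on [Zset]. *)
Lemma Dist_le b (f g : 'cV[R]_d -> R) : B b ->
  measurable_fun setT f -> measurable_fun setT g ->
  (forall z, 0 <= f z) -> (forall z, 0 <= g z) ->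
  (forall z, supp M b z -> f z <= g z) ->
  (\int[D b]_z (f z)%:E <= \int[D b]_z (g z)%:E)%E.
Proof.
move=> Bb mf mg f0 g0 fg; rewrite !Dist_ge0_integral//.
apply: ge0_le_integral => //.
- by move=> z _; rewrite lee_fin mulr_ge0// dens_ge0.
- by apply/measurable_EFinP; apply: measurable_funM => //; exact: measurable_dens.
- by apply/measurable_EFinP; apply: measurable_funM => //; exact: measurable_dens.
move=> z _; rewrite lee_fin; have := dens_ge0 HS z Bb.
rewrite le_eqVlt => /predU1P[<-|pz]; first by rewrite !mulr0.
by rewrite ler_wpM2r ?(ltW pz)//; exact: fg.
Qed.

Lemma supp_Zset b z : supp M b z -> Zset M z.
Proof.
move=> sz; apply: contrapT => nz; move: sz.
by rewrite /supp/= dens_out// ltxx.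
Qed.

Lemma measurable_enormX k : measurable_fun setT (fun z : 'cV[R]_d => enorm z ^+ k).
Proof. by apply: measurable_funX; exact: measurable_fun_enorm. Qed.

Lemma Dist_poly_le b K k (Mk : R) : B b -> 0 <= K ->
  (\int[D b]_z (enorm z ^+ k)%:E <= Mk%:E)%E ->
  (\int[D b]_z (K * (1 + enorm z ^+ k))%:E <= (K * (1 + Mk))%:E)%E.
Proof.
move=> Bb K0 h; have mk := measurable_enormX k.
under eq_integral do rewrite EFinM EFinD.
rewrite ge0_integralZl//; last 2 first.
- by apply: emeasurable_funD => //; apply/measurable_EFinP.
- by move=> z _; rewrite -EFinD lee_fin addr_ge0// exprn_ge0// enorm_ge0.
rewrite EFinM lee_wpmul2l ?lee_fin// ge0_integralD//; last 2 first.
- by move=> z _; rewrite lee_fin exprn_ge0// enorm_ge0.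
- by apply/measurable_EFinP.
rewrite integral_cst// mul1e EFinD leeD//.
by have := probability_le1 (D b) measurableT.
Qed.

Let sqr_poly (x : R) q : 0 <= x -> (1 + x ^+ q) ^+ 2 <= 2 * (1 + x ^+ (2 * q)).
Proof.
move=> x0; rewrite mulnC exprM; have := sqr_ge0 (1 - x ^+ q); nra.
Qed.

Let sq_lty b (f : 'cV[R]_d -> R) K q (Mk : R) : B b -> measurable_fun setT f ->
  0 <= K -> (forall z, 0 <= f z) ->
  (forall z, supp M b z -> f z <= K * (1 + enorm z ^+ q)) ->
  (\int[D b]_z (enorm z ^+ (2 * q))%:E <= Mk%:E)%E ->
  (\int[D b]_z (f z ^+ 2)%:E < +oo)%E.
Proof.
move=> Bb mf K0 f0 hf hM; have mk := measurable_enormX (2 * q).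
apply: (@le_lt_trans _ _ (\int[D b]_z ((K ^+ 2 * 2) * (1 + enorm z ^+ (2 * q)))%:E)%E).
  apply: Dist_le => //.
  - exact: measurable_funX.
  - by apply: measurable_funM => //; apply: measurable_funD.
  - by move=> z; rewrite sqr_ge0.
  - by move=> z; rewrite mulr_ge0 ?mulr_ge0 ?sqr_ge0// addr_ge0// exprn_ge0// enorm_ge0.
  move=> z sz; rewrite -mulrA; apply: (@le_trans _ _ ((K * (1 + enorm z ^+ q)) ^+ 2)).
    by apply: lerXn2r; rewrite ?nnegrE//; [exact: le_trans (hf z sz)|exact: hf].
  by rewrite exprMn ler_wpM2l ?sqr_ge0// sqr_poly// enorm_ge0.
apply: le_lt_trans (Dist_poly_le Bb _ hM) (ltry _).
by rewrite mulr_ge0// sqr_ge0.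
Qed.

Lemma score_sqr_lty b : B b -> (\int[D b]_z (enorm (s z b) ^+ 2)%:E < +oo)%E.
Proof.
move=> Bb; have [_ [K1 [K2 [K3 [K4 [K5 [q1 [q2 [q3 [q4 [q5 [Mk]]]]]]]]]]]] := HG.
move=> [[K10 _ _ _ _] hs _ /= hM].
apply: (sq_lty (q := q1) (Mk := Mk (2 * q1)%N) Bb _ K10) => //.
- by apply: measurable_fun_enorm; exact: measurable_score.
- by move=> z; exact: enorm_ge0.
- by have [+ _] := hs b Bb.
- by apply: hM => //; rewrite leq_max leq_addr.
Qed.

Let F (zt : 'cV[R]_d * 'cV[R]_n) := loss M zt.1 zt.2.

Let F_C2 : Ck 2 setT F. Proof. by case: HG. Qed.

Let dF zt : differentiable F zt. Proof. by have [+ _] := F_C2; apply. Qed.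

Let dDF v zt : differentiable (fun y => 'D_v F y) zt.
Proof. by have [_ /(_ v)[+ _]] := F_C2; apply. Qed.

Let pair_differentiable z t : differentiable (fun t : 'cV[R]_n => (z : 'cV[R]_d, t)) t.
Proof. by apply: differentiable_pair. Qed.

Let pair_continuous t : continuous (fun z : 'cV[R]_d => (z, t : 'cV[R]_n)).
Proof. by move=> z; apply/differentiable_continuous; apply: differentiable_pair. Qed.

Lemma loss_differentiable z t : differentiable (loss M z) t.
Proof. exact: (differentiable_comp (f := fun t => (z, t)) (g := F)). Qed.

(** The loss is C^2 jointly in (z, theta). Viewing a derivative in theta as a derivative along (0,
    v) transfers differentiability in theta and continuity, hence measurability, in z. *)
Lemma D_loss z t v : 'D_v (loss M z) t = 'D_(0, v) F (z, t).
Proof.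
have E : (fun h : R => h^-1 *: ((loss M z \o shift t) (h *: v) - loss M z t)) =
    (fun h : R => h^-1 *: ((F \o shift (z, t)) (h *: ((0 : 'cV[R]_d), v)) - F (z, t))).
  by apply/funext => h /=; rewrite /F/= scaler0 add0r.
by rewrite /derive E.
Qed.

Lemma grad_loss_differentiable z t : differentiable (grad (loss M z)) t.
Proof.
apply: differentiable_cV => i.
rewrite (_ : (fun y => _) = (fun y => 'D_(0, ebasis i) F (z, y))).
  exact: (differentiable_comp (f := fun t => (z, t)) (g := fun y => 'D_(0, ebasis i) F y)).
by apply/funext => y; rewrite mxE D_loss.
Qed.

Lemma measurable_loss t : measurable_fun setT (fun z => loss M z t).
Proof.
apply: continuous_measurable_cV => z.
apply: (@continuous_comp _ _ _ (fun z => (z, t)) F); first exact: pair_continuous.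
exact: differentiable_continuous.
Qed.

Lemma measurable_grad_loss t : measurable_fun setT (fun z => grad (loss M z) t).
Proof.
apply: measurable_fun_cV => i; apply: continuous_measurable_cV => z.
rewrite (_ : (fun y => _) = (fun y => 'D_(0, ebasis i) F (y, t))); last first.
  by apply/funext => y; rewrite mxE D_loss.
apply: (@continuous_comp _ _ _ (fun z => (z, t)) (fun y => 'D_(0, ebasis i) F y)).
  exact: pair_continuous.
exact: differentiable_continuous.
Qed.

Lemma loss_sqr_lty b t : B b -> Theta M t -> (\int[D b]_z (loss M z t ^+ 2)%:E < +oo)%E.
Proof.
move=> Bb Tt; have [_ [K1 [K2 [K3 [K4 [K5 [q1 [q2 [q3 [q4 [q5 [Mk]]]]]]]]]]]] := HG.
move=> [[_ _ K30 _ _] _ hl /= hM].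
rewrite (_ : (fun z => _) = (fun z => (`|loss M z t| ^+ 2)%:E)); last first.
  by apply/funext => z; rewrite real_normK// num_real.
apply: (sq_lty (q := q3) (Mk := Mk (2 * q3)%N) Bb _ K30) => //.
- by apply: measurableT_comp => //; exact: measurable_loss.
- by move=> z /supp_Zset; have [+ _ _] := hl t Tt; apply.
- by apply: hM => //; rewrite !leq_max leqnn !orbT.
Qed.

Lemma hess_loss_bound : exists (H : 'cV[R]_d -> R) (C : R),
  [/\ measurable_fun setT H, (forall z, 0 <= H z), 0 <= C,
      (forall t z, Theta M t -> Zset M z -> opnorm (hess (loss M z) t) <= H z) &
      forall b, B b -> (\int[D b]_z (H z)%:E <= C%:E)%E].
Proof.
have [_ [K1 [K2 [K3 [K4 [K5 [q1 [q2 [q3 [q4 [q5 [Mk]]]]]]]]]]]] := HG.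
move=> [[_ _ _ _ K50] _ hl /= hM].
exists (fun z => K5 * (1 + enorm z ^+ q5)), (K5 * (1 + `|Mk q5|)); split.
- by apply: measurable_funM => //; apply: measurable_funD => //; exact: measurable_enormX.
- by move=> z; rewrite mulr_ge0// addr_ge0// exprn_ge0// enorm_ge0.
- by rewrite mulr_ge0// addr_ge0.
- by move=> t z Tt Zz; have [_ _ +] := hl t Tt; apply.
- move=> b Bb; apply: Dist_poly_le => //.
  apply: le_trans (hM q5 b _ Bb) _; first by rewrite !leq_max leqnn !orbT.
  by rewrite lee_fin ler_norm.
Qed.

(** The trace of the Fisher information is the expected squared norm of the score. Its entries are
    real-valued integrals, which read 0 where the extended integral is infinite; finiteness has to
    come first, from the growth bounds. *)
Lemma score_sqr_le b : B b -> (\int[D b]_z (enorm (s z b) ^+ 2)%:E <= (I_max c)%:E)%E.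
Proof.
move=> Bb; apply: le_trans (_ : (\tr (fisher M b))%:E <= _)%E; last first.
  by rewrite lee_fin; exact: cst_I_max HC b Bb.
have ms i : measurable_fun setT (fun z => s z b i 0).
  by apply: measurable_fun_coord; exact: measurable_score.
have si i : (\int[D b]_z (s z b i 0 ^+ 2)%:E < +oo)%E.
  apply: le_lt_trans (score_sqr_lty Bb); apply: Dist_le => //.
  - exact: measurable_funX.
  - by apply: measurable_funX; apply: measurable_fun_enorm; exact: measurable_score.
  - by move=> z; rewrite sqr_ge0.
  - by move=> z; rewrite sqr_ge0.
  - move=> z _; rewrite -[leLHS]real_normK ?num_real//.
    by apply: lerXn2r; rewrite ?nnegrE ?enorm_ge0// normr_coord_le.
under eq_integral do rewrite sqr_enormE -sumEFin.
rewrite ge0_integral_sum//; last 2 first.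
- by move=> i; apply/measurable_EFinP; exact: measurable_funX.
- by move=> i z _; rewrite lee_fin sqr_ge0.
rewrite /mxtrace -sumEFin; apply: lee_sum => i _.
rewrite mxE /Rintegral fineK.
  by rewrite le_eqVlt; apply/orP; left; apply/eqP; apply: eq_integral => z _;
    rewrite mxE big_ord1 !mxE expr2.
under eq_integral do rewrite mxE big_ord1 mxE -expr2.
by rewrite ge0_fin_numE//; apply: integral_ge0 => z _; rewrite lee_fin sqr_ge0.
Qed.

Lemma score_dot_sqr_le b v : B b ->
  (\int[D b]_z (dot (s z b) v ^+ 2)%:E <= ((Num.sqrt (I_max c) * enorm v) ^+ 2)%:E)%E.
Proof.
move=> Bb; have ms : measurable_fun setT (fun z => s z b) by exact: measurable_score.
have [_ _ [_ _ I0]] := cst_ge0 HC.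
apply: (@le_trans _ _ (\int[D b]_z ((enorm v ^+ 2) * enorm (s z b) ^+ 2)%:E)%E).
  apply: Dist_le => //.
  - by apply: measurable_funX; exact: measurable_fun_dot.
  - by apply: measurable_funM => //; apply: measurable_funX; exact: measurable_fun_enorm.
  - by move=> z; rewrite sqr_ge0.
  - by move=> z; rewrite mulr_ge0// sqr_ge0.
  - move=> z _; rewrite -[leLHS]real_normK ?num_real// -exprMn mulrC.
    by apply: lerXn2r; rewrite ?nnegrE ?mulr_ge0 ?enorm_ge0// dot_normr_le.
under eq_integral do rewrite EFinM.
rewrite ge0_integralZl//; last 3 first.
- by apply/measurable_EFinP; apply: measurable_funX; exact: measurable_fun_enorm.
- by move=> z _; rewrite lee_fin sqr_ge0.
- by rewrite lee_fin sqr_ge0.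
have -> : ((Num.sqrt (I_max c) * enorm v) ^+ 2)%:E = ((enorm v ^+ 2)%:E * (I_max c)%:E)%E.
  by rewrite -EFinM; congr EFin; rewrite [LHS]exprMn sqr_sqrtr// mulrC.
rewrite lee_wpmul2l ?lee_fin ?sqr_ge0//.
exact: score_sqr_le.
Qed.

Lemma score_cauchy_schwarz b (f : 'cV[R]_d -> R) A v : B b -> measurable_fun setT f ->
  0 <= A -> (\int[D b]_z (f z ^+ 2)%:E <= (A ^+ 2)%:E)%E ->
  (\int[D b]_z (`|f z| * `|dot (s z b) v|)%:E <= (A * (Num.sqrt (I_max c) * enorm v))%:E)%E.
Proof.
move=> Bb mf A0 hf; under eq_integral do rewrite -normrM.
apply: cauchy_schwarz_le => //.
- by apply: measurable_fun_dot => //; exact: measurable_score.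
- by rewrite mulr_ge0 ?sqrtr_ge0 ?enorm_ge0.
- exact: score_dot_sqr_le.
Qed.

End ModelMoments.

(** * Variation of expectations with the distribution parameter *)

Section Integrability.
Context {R : realType} {d} {T : measurableType d} (P : probability T R).

Lemma integrable_of_sqr (f : T -> R) : measurable_fun setT f ->
  (\int[P]_x (f x ^+ 2)%:E < +oo)%E -> P.-integrable setT (EFin \o f).
Proof.
move=> mf f2; have := integrable_mul mf (measurable_cst (1 : R)) f2 _.
under eq_integral do rewrite expr1n.
rewrite integral_cst//= mul1e => h.
have := h (le_lt_trans (probability_le1 P measurableT) (ltry 1)).
by apply: eq_integrable => // x _ /=; rewrite mulr1.
Qed.

Lemma Rint_sum_integrable (I : Type) (r : seq I) (F : I -> T -> R) :
  (forall i, P.-integrable setT (EFin \o F i)) ->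
  P.-integrable setT (EFin \o (fun x => \sum_(i <- r) F i x)) /\
  \int[P]_x (\sum_(i <- r) F i x) = \sum_(i <- r) \int[P]_x F i x.
Proof.
move=> iF; elim: r => [|i r [ih1 ih2]].
  split; last by rewrite big_nil -[RHS](Rint_cst P); apply: eq_Rint => x; rewrite big_nil.
  apply: (@eq_integrable _ _ _ P setT _ (fun=> 0%E)) => //; last exact: integrable0.
  by move=> x _ /=; rewrite big_nil.
split.
  apply: (@eq_integrable _ _ _ P setT _ ((EFin \o F i) \+ (EFin \o (fun x => \sum_(i <- r) F i x)))) => //.
    by move=> x _ /=; rewrite big_cons EFinD.
  exact: integrableD.
rewrite big_cons -ih2 -RintegralD//.
by apply: eq_Rint => x; rewrite big_cons.
Qed.

Lemma dot_expect k (X : T -> 'cV[R]_k) v :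
  (forall i, P.-integrable setT (fun w => (X w i 0)%:E)) ->
  dot (expect P X) v = \int[P]_w dot (X w) v.
Proof.
move=> iX; rewrite /dot.
have iXv i : P.-integrable setT (EFin \o (fun w => X w i 0 * v i 0)).
  by have := integrableZr measurableT (v i 0) (iX i); apply: eq_integrable => // w _.
have [_ ->] := Rint_sum_integrable (index_enum 'I_k) iXv.
by apply: eq_bigr => i _; rewrite mxE RintegralZr//; exact: iX.
Qed.

End Integrability.

Section ModelVariation.
Context {R : realType} {n m d : nat} (M : model R n m d) (c : constants R).
Hypotheses (HS : model_setting M) (HB : convex_set (Bset M)).
Hypotheses (HD : assumption_densities M) (HG : assumption_growth M).
Hypothesis HC : valid_constants M c.

Local Notation B := (Bset M).
Local Notation p := (dens M).
Local Notation D := (Dist M).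
Local Notation s := (score M).

Lemma integrable_dens b (f : 'cV[R]_d -> R) : B b -> (D b).-integrable setT (EFin \o f) ->
  (mu M).-integrable setT (fun z => (f z * p z b)%:E) /\
  \int[D b]_z f z = \int[mu M]_z (f z * p z b).
Proof.
move=> Bb; apply: (@integrable_density _ _ _ (mu M)).
- exact: measurable_dens.
- by move=> z; exact: dens_ge0.
- by move=> A mA; exact: DistE.
Qed.

Lemma Dist_integral_variation b0 b1 (f : 'cV[R]_d -> R) C : B b0 -> B b1 ->
  measurable_fun setT f ->
  (D b0).-integrable setT (EFin \o f) -> (D b1).-integrable setT (EFin \o f) ->
  (forall t, 0 <= t -> t <= 1 ->
    (\int[D (segm b0 b1 t)]_z (`|f z| * `|dot (s z (segm b0 b1 t)) (b1 - b0)|)%:E <= C%:E)%E) ->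
  `|\int[D b1]_z f z - \int[D b0]_z f z| <= C.
Proof.
move=> h0 h1 mf i0 i1 hC.
have [j0 ->] := integrable_dens h0 i0; have [j1 ->] := integrable_dens h1 i1.
rewrite -RintegralB//; apply: le_trans (le_normr_Rintegral measurableT _) _.
  have := integrableB measurableT j1 j0.
  by apply: eq_integrable => // z _ /=; rewrite EFinB.
have mabs : measurable_fun setT (fun z => `|f z|) by apply: measurableT_comp.
have := dens_variation_le HS HB HD h0 h1 mabs (fun z => normr_ge0 (f z)) hC.
rewrite /Rintegral (_ : (fun z => (`|f z| * _)%:E) = (fun z => (`|f z * p z b1 - f z * p z b0|)%:E)); last first.
  by apply/funext => z; rewrite -mulrBr normrM.
set I := (\int[_]_z _)%E => hI.
have I0 : (0 <= I)%E by apply: integral_ge0 => z _; rewrite lee_fin.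
rewrite -lee_fin fineK// ge0_fin_numE//.
exact: le_lt_trans hI (ltry _).
Qed.

Lemma Dist_sqr_variation b0 b1 (f : 'cV[R]_d -> R) A : B b0 -> B b1 ->
  measurable_fun setT f -> 0 <= A ->
  (forall b, B b -> (\int[D b]_z (f z ^+ 2)%:E <= (A ^+ 2)%:E)%E) ->
  `|\int[D b1]_z f z - \int[D b0]_z f z| <= A * (Num.sqrt (I_max c) * enorm (b1 - b0)).
Proof.
move=> h0 h1 mf A0 hA.
apply: Dist_integral_variation => //.
- by apply: integrable_of_sqr => //; exact: le_lt_trans (hA _ h0) (ltry _).
- by apply: integrable_of_sqr => //; exact: le_lt_trans (hA _ h1) (ltry _).
move=> t t0 t1; have Bt : B (segm b0 b1 t) by exact: segm_in.
by apply: score_cauchy_schwarz => //; exact: hA.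
Qed.

Lemma Dist_tv_lipschitz b0 b1 (f : 'cV[R]_d -> R) : B b0 -> B b1 ->
  measurable_fun setT f -> (forall z, `|f z| <= 1) ->
  `|\int[D b1]_z f z - \int[D b0]_z f z| <= Num.sqrt (I_max c) * enorm (b1 - b0).
Proof.
move=> h0 h1 mf f1; rewrite -[leRHS]mul1r; apply: Dist_sqr_variation => // b Bb.
apply: (@le_trans _ _ (\int[D b]_z (1 : R)%:E)%E).
  apply: ge0_le_integral => //.
  - by move=> z _; rewrite lee_fin sqr_ge0.
  - by apply/measurable_EFinP; exact: measurable_funX.
  - by move=> z _; rewrite lee_fin -[leLHS]real_normK ?num_real// expr_le1.
by rewrite integral_cst// mul1e expr1n; exact: probability_le1.
Qed.

Lemma loss_integrable b t : B b -> Theta M t -> (D b).-integrable setT (fun z => (loss M z t)%:E).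
Proof.
move=> Bb Tt; apply: integrable_of_sqr; first exact: measurable_loss.
exact: loss_sqr_lty.
Qed.

Lemma grad_loss_sqr_le b t : B b -> Theta M t ->
  (\int[D b]_z (enorm (grad (loss M z) t) ^+ 2)%:E <= (L_l_Lip c ^+ 2)%:E)%E.
Proof.
move=> Bb Tt; have [[l0 _ _] _ _] := cst_ge0 HC.
have := cst_l_Lip HC Tt Bb; set I := (\int[_]_z _)%E => h.
have I0 : (0 <= I)%E by apply: integral_ge0 => z _; rewrite lee_fin sqr_ge0.
have -> : I = ((I `^ 2^-1) `^ 2)%E.
  by rewrite -poweRrM mulVf ?pnatr_eq0// poweRe1.
have -> : (L_l_Lip c ^+ 2)%:E = ((L_l_Lip c)%:E `^ 2)%E :> \bar R.
  by rewrite poweR_EFin powR_mulrn.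
apply: gt0_ler_poweR => //.
- by rewrite in_itv/= poweR_ge0 leey.
- by rewrite in_itv/= lee_fin l0 leey.
Qed.

Lemma dot_grad_loss_sqr_le b t v : B b -> Theta M t ->
  (\int[D b]_z (dot (grad (loss M z) t) v ^+ 2)%:E <= ((L_l_Lip c * enorm v) ^+ 2)%:E)%E.
Proof.
move=> Bb Tt; have mg := measurable_grad_loss HG t.
apply: (@le_trans _ _ (\int[D b]_z ((enorm v ^+ 2) * enorm (grad (loss M z) t) ^+ 2)%:E)%E).
  apply: ge0_le_integral => //.
  - by move=> z _; rewrite lee_fin sqr_ge0.
  - by apply/measurable_EFinP; apply: measurable_funX; exact: measurable_fun_dot.
  - apply/measurable_EFinP; apply: measurable_funM => //.
    by apply: measurable_funX; exact: measurable_fun_enorm.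
  - move=> z _; rewrite lee_fin -[leLHS]real_normK ?num_real// -exprMn mulrC.
    by apply: lerXn2r; rewrite ?nnegrE ?mulr_ge0 ?enorm_ge0// dot_normr_le.
under eq_integral do rewrite EFinM.
rewrite ge0_integralZl//; last 3 first.
- by apply/measurable_EFinP; apply: measurable_funX; exact: measurable_fun_enorm.
- by move=> z _; rewrite lee_fin sqr_ge0.
- by rewrite lee_fin sqr_ge0.
have -> : ((L_l_Lip c * enorm v) ^+ 2)%:E = ((enorm v ^+ 2)%:E * (L_l_Lip c ^+ 2)%:E)%E.
  by rewrite -EFinM; congr EFin; rewrite [LHS]exprMn mulrC.
rewrite lee_wpmul2l ?lee_fin ?sqr_ge0//.
exact: grad_loss_sqr_le.
Qed.

Lemma grad_loss_integrable b t i : B b -> Theta M t ->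
  (D b).-integrable setT (fun z => (grad (loss M z) t i 0)%:E).
Proof.
move=> Bb Tt; apply: integrable_of_sqr.
  by apply: measurable_fun_coord; exact: measurable_grad_loss.
have := dot_grad_loss_sqr_le (ebasis i) Bb Tt.
under eq_integral do rewrite dot_ebasis.
by move=> /le_lt_trans; apply; rewrite ltry.
Qed.

Lemma expect_grad_loss_lipschitz b0 b1 t : B b0 -> B b1 -> Theta M t ->
  enorm (expect (D b1) (fun z => grad (loss M z) t) - expect (D b0) (fun z => grad (loss M z) t))
    <= L_l_Lip c * Num.sqrt (I_max c) * enorm (b1 - b0).
Proof.
move=> h0 h1 Tt; have [[l0 _ _] _ _] := cst_ge0 HC.
apply: enorm_dual => [|v]; first by rewrite !mulr_ge0 ?sqrtr_ge0 ?enorm_ge0.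
rewrite dotBl !dot_expect; last 2 first.
- by move=> i; exact: grad_loss_integrable.
- by move=> i; exact: grad_loss_integrable.
apply: le_trans (ler_norm _) _.
apply: le_trans (@Dist_sqr_variation b0 b1 _ (L_l_Lip c * enorm v) h0 h1 _ _ _) _.
- by apply: measurable_fun_dot => //; exact: measurable_grad_loss.
- by rewrite mulr_ge0 ?enorm_ge0.
- by move=> b Bb; exact: dot_grad_loss_sqr_le.
- by rewrite mulrAC -!mulrA mulrCA !mulrA.
Qed.

Lemma Rint_supp b b' (f g : 'cV[R]_d -> R) : B b -> B b' ->
  (D b').-integrable setT (EFin \o g) ->
  (forall z, supp M b z -> f z = g z * p z b') ->
  \int[mu M]_(z in supp M b) f z = \int[D b']_z g z.
Proof.
move=> Bb Bb' ig fg; have [_ ->] := integrable_dens Bb' ig.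
rewrite Rintegral_mkcond; congr fine; apply: eq_integral => z _; congr EFin.
rewrite /patch; case: ifPn => [/[!inE] /fg//|].
by rewrite notin_setE => /(dens_supp0 HS HD Bb Bb')->; rewrite mulr0.
Qed.

Lemma score_integrable b v : B b -> (D b).-integrable setT (fun z => (dot (s z b) v)%:E).
Proof.
move=> Bb; apply: integrable_of_sqr.
  by apply: measurable_fun_dot => //; exact: measurable_score.
exact: le_lt_trans (score_dot_sqr_le HS HD HG HC v Bb) (ltry _).
Qed.

(** The total mass is 1 at every point of the segment, so the one-sided difference quotients of
    [diff_int_dens] are all 0. The step t is kept at most 1 to remain on the segment. *)
Lemma score_mean0 b b1 : B b -> B b1 -> \int[D b]_z dot (s z b) (b1 - b) = 0.
Proof.
move=> Bb Bb1; have [_ _] := diff_int_dens HD Bb Bb1.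
rewrite (Rint_supp (f := fun z => 'D_(b1 - b) (p z) b) (b' := b) (g := fun z => dot (s z b) (b1 - b)))//; last 2 first.
- exact: score_integrable.
- by move=> z sz; exact: D_dens_score.
move=> h; apply/eqP; rewrite -normr_le0; apply/ler_addgt0Pr => e e0; rewrite add0r.
have [r r0 hr] := cvg_at_right0_le h e0.
pose t := Num.min (r / 2) 1.
have t0 : 0 < t by rewrite lt_min ltr01 divr_gt0.
have tr : t < r by rewrite gt_min ltr_pdivrMr// ltr_pMr// ltr1n.
have t1 : t <= 1 by rewrite ge_min lexx orbT.
have mass b' : B b' -> \int[mu M]_(z in supp M b) p z b' = 1.
  move=> Bb'; rewrite (Rint_supp (b' := b') (g := cst 1))//.
  - exact: Rint_cst.
  - exact: bmf_integrable (bmf_cst 1).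
  - by move=> z _; rewrite mul1r.
have := hr t t0 tr; rewrite !mass// ?subrr ?mulr0 ?sub0r ?normrN//.
exact: (segm_in HB Bb Bb1 (ltW t0) t1).
Qed.

Lemma loss_score_integrable b t v : B b -> Theta M t ->
  (D b).-integrable setT (fun z => (loss M z t * dot (s z b) v)%:E).
Proof.
move=> Bb Tt; apply: integrable_mul.
- exact: measurable_loss.
- by apply: measurable_fun_dot => //; exact: measurable_score.
- exact: loss_sqr_lty.
- exact: le_lt_trans (score_dot_sqr_le HS HD HG HC v Bb) (ltry _).
Qed.

Lemma Gvec_dot b t v : B b -> Theta M t ->
  dot (Gvec M t b) v = \int[D b]_z (loss M z t * dot (s z b) v).
Proof.
move=> Bb Tt; rewrite dot_expect; first by apply: eq_Rint => z; rewrite dotZl.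
move=> i; have := loss_score_integrable (ebasis i) Bb Tt.
by apply: eq_integrable => // z _; rewrite dot_ebasis mxE.
Qed.

Lemma loss_variance_le b t : B b -> Theta M t ->
  (\int[D b]_z ((loss M z t - \int[D b]_z loss M z t) ^+ 2)%:E <= ((Num.sqrt (M_l c)) ^+ 2)%:E)%E.
Proof.
move=> Bb Tt; have [_ _ [_ Ml0 _]] := cst_ge0 HC.
rewrite sqr_sqrtr//; apply: le_trans (cst_M_l HC Tt Bb).
rewrite /variance covariance.unlock expectation.unlock.
by rewrite le_eqVlt; apply/orP; left; apply/eqP; apply: eq_integral => z _; rewrite /= expr2.
Qed.

(* The loss may be centered, as v is orthogonal to the mean of the score. *)
Lemma Gvec_dot_le b t v : B b -> Theta M t -> \int[D b]_z dot (s z b) v = 0 ->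
  `|dot (Gvec M t b) v| <= Num.sqrt (M_l c * I_max c) * enorm v.
Proof.
move=> Bb Tt v0; have [_ _ [_ Ml0 I0]] := cst_ge0 HC.
rewrite Gvec_dot//; set e := \int[D b]_z loss M z t.
have ils := loss_score_integrable v Bb Tt; have is_ := score_integrable v Bb.
have ies : (D b).-integrable setT (EFin \o (fun z => e * dot (s z b) v)).
  by have := integrableZl measurableT e is_; apply: eq_integrable => // z _.
have idif : (D b).-integrable setT (EFin \o (fun z => (loss M z t - e) * dot (s z b) v)).
  have := integrableB measurableT ils ies.
  by apply: eq_integrable => // z _ /=; rewrite mulrBl EFinB.
have -> : \int[D b]_z (loss M z t * dot (s z b) v) =
    \int[D b]_z ((loss M z t - e) * dot (s z b) v).
  transitivity (\int[D b]_z (loss M z t * dot (s z b) v - e * dot (s z b) v)).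
    by rewrite RintegralB// (RintegralZl _ measurableT is_) v0 mulr0 subr0.
  by apply: eq_Rint => z; rewrite mulrBl.
apply: le_trans (le_normr_Rintegral measurableT idif) _.
rewrite -lee_fin /Rintegral fineK; last first.
  have /integrableP[_ h] := idif; rewrite ge0_fin_numE; last first.
    by apply: integral_ge0 => z _; rewrite lee_fin.
  by apply: le_lt_trans h.
rewrite sqrtrM// -mulrA; under eq_integral do rewrite normrM.
apply: score_cauchy_schwarz => //.
- by apply: measurable_funB => //; exact: measurable_loss.
- exact: loss_variance_le.
Qed.

(** By duality the product is tested on the directions A y, all orthogonal to the mean score.
    Abstracting A covers both the difference of two Jacobians and the error of the Jacobian
    estimate. *)
Lemma enorm_mulmx_Gvec k b t (A : 'M[R]_(m, k)) a : B b -> Theta M t -> 0 <= a ->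
  (forall y, \int[D b]_z dot (s z b) (A *m y) = 0) ->
  (forall y, enorm (A *m y) <= a * enorm y) ->
  enorm (A^T *m Gvec M t b) <= Num.sqrt (M_l c * I_max c) * a.
Proof.
move=> Bb Tt a0 A0 hA; apply: enorm_dual => [|y]; first by rewrite mulr_ge0 ?sqrtr_ge0.
rewrite dotC -dot_mulmx dotC; apply: le_trans (ler_norm _) _.
apply: le_trans (Gvec_dot_le Bb Tt (A0 y)) _.
by rewrite -mulrA ler_wpM2l ?sqrtr_ge0.
Qed.

Lemma D_loss_dens t z b v : B b -> supp M b z ->
  'D_v (fun b => loss M z t * p z b) b = (loss M z t * dot (s z b) v) * p z b.
Proof.
move=> Bb sz; rewrite -mulrA -(D_dens_score HD v Bb sz).
exact: (deriveZ (loss M z t) (diff_derivable (dens_differentiable HD z Bb))).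
Qed.

Lemma Rint_loss_onesided b b1 t : B b -> B b1 -> Theta M t ->
  forall e : R, 0 < e -> exists2 r : R, 0 < r & forall h, 0 < h -> h < r ->
    `|\int[D (segm b b1 h)]_z loss M z t - \int[D b]_z loss M z t
      - h * dot (Gvec M t b) (b1 - b)| <= e * h.
Proof.
move=> Bb Bb1 Tt e e0; have [_ _] := diff_int_loss HD Tt Bb Bb1.
rewrite (Rint_supp (f := fun z => 'D_(b1 - b) (fun b => loss M z t * p z b) b) (b' := b)
  (g := fun z => loss M z t * dot (s z b) (b1 - b)))//; last 2 first.
- exact: loss_score_integrable.
- by move=> z sz; exact: D_loss_dens.
rewrite -Gvec_dot// => h; have [r r0 hr] := cvg_at_right0_le h e0.
exists (Num.min r 1); first by rewrite lt_min r0 ltr01.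
move=> x x0; rewrite lt_min => /andP[xr x1].
have mass b' : B b' -> \int[mu M]_(z in supp M b) (loss M z t * p z b') = \int[D b']_z loss M z t.
  by move=> Bb'; rewrite (Rint_supp (b' := b') (g := fun z => loss M z t))//; exact: loss_integrable.
have := hr x x0 xr; rewrite !mass//; last exact: (segm_in HB Bb Bb1 (ltW x0) (ltW x1)).
rewrite -/(segm b b1 x); move: (\int[D (segm _ _ _)]_z _) (\int[D b]_z _) (dot _ _) => a2 a1 g hg.
have -> : a2 - a1 - x * g = (x^-1 * (a2 - a1) - g) * x by field; rewrite gt_eqF.
by rewrite normrM (gtr0_norm x0) ler_wpM2r// ltW.
Qed.

(** From an interior point of the segment both endpoints are feasible targets, which gives the right
    and left expansions of [mvt_onesided]; the Lipschitz bound on G then moves the intermediate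
    point to b0. *)
Lemma Rint_loss_taylor b0 b1 t : B b0 -> B b1 -> Theta M t ->
  `|\int[D b1]_z loss M z t - \int[D b0]_z loss M z t - dot (Gvec M t b0) (b1 - b0)|
    <= L_G_b c * enorm (b1 - b0) ^+ 2.
Proof.
move=> h0 h1 Tt; have [_ [_ _ LG0] _] := cst_ge0 HC.
set w := b1 - b0.
have [||x /andP[x0 x1]] := @mvt_onesided _ (fun x => \int[D (segm b0 b1 x)]_z loss M z t)
  (fun x => dot (Gvec M t (segm b0 b1 x)) w).
- move=> x x0 x1 e e0; have Bx : B (segm b0 b1 x) by apply: segm_in => //; exact: ltW.
  have y0 : 0 < 1 - x by rewrite subr_gt0.
  have ey : 0 < e * (1 - x) by rewrite mulr_gt0.
  have [r r0 hr] := Rint_loss_onesided Bx h1 Tt ey.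
  exists (r * (1 - x)); first by rewrite mulr_gt0.
  (* The remaining segment to b1 is (1 - x) times the whole, so an increment h along w is an
     increment h / (1 - x) towards b1. Backwards, towards b0, the ratio is x. *)
  move=> h h0' hlt; have := hr (h / (1 - x)).
  rewrite divr_gt0// ltr_pdivrMr// => /(_ isT hlt).
  have wE : b1 - segm b0 b1 x = (1 - x) *: w.
    by rewrite /segm scalerBl scale1r opprD addrA.
  have -> : segm (segm b0 b1 x) b1 (h / (1 - x)) = segm b0 b1 (x + h).
    by rewrite {1}/segm wE scalerA divfK ?gt_eqF// /segm -addrA -scalerDl.
  rewrite wE dotZr mulrA divfK ?gt_eqF// -mulrA (mulrC (1 - x)) divfK ?gt_eqF//.
  by rewrite (mulrC h).
- move=> x x0 x1 e e0; have Bx : B (segm b0 b1 x) by apply: segm_in => //; exact: ltW.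
  have ey : 0 < e * x by rewrite mulr_gt0.
  have [r r0 hr] := Rint_loss_onesided Bx h0 Tt ey.
  exists (r * x); first by rewrite mulr_gt0.
  move=> h h0' hlt; have := hr (h / x).
  rewrite divr_gt0// ltr_pdivrMr// => /(_ isT hlt).
  have wE : b0 - segm b0 b1 x = (- x) *: w.
    by rewrite /segm opprD addrA subrr sub0r scaleNr.
  have -> : segm (segm b0 b1 x) b0 (h / x) = segm b0 b1 (x - h).
    by rewrite {1}/segm wE scalerA mulrN divfK ?gt_eqF// /segm -addrA -scalerDl.
  rewrite wE dotZr mulrA mulrN divfK ?gt_eqF// mulNr opprK -mulrA (mulrC x) divfK ?gt_eqF//.
  by rewrite (mulrC h).
have s1 : segm b0 b1 1 = b1 by rewrite /segm scale1r subrKC.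
have s0 : segm b0 b1 0 = b0 by rewrite /segm scale0r addr0.
rewrite s1 s0 => ->; rewrite -dotBl; apply: le_trans (dot_normr_le _ _) _.
rewrite expr2 mulrA ler_wpM2r ?enorm_ge0//.
have Bx : B (segm b0 b1 x) by apply: segm_in => //; exact: ltW.
apply: le_trans (cst_G HC Tt Tt Bx h0) _.
rewrite subrr enorm0 mulr0 addr0 ler_wpM2l//.
rewrite /segm [b0 + _]addrC addrK enormZ gtr0_norm//.
by rewrite ler_piMl ?enorm_ge0// ltW.
Qed.

End ModelVariation.

(** * Gradient and smoothness of the performative loss *)

Section Derivatives.
Context {R : realType} {V : normedModType R}.

(** The performative loss is known only through an expansion; it inherits its derivative from a
    differentiable g that it follows up to second order. *)
Lemma derive_approx (f g : V -> R) (x w : V) (K r : R) : derivable g x w -> 0 < r ->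
  (forall h, `|h| < r -> `|f (x + h *: w) - f x - (g (x + h *: w) - g x)| <= K * h ^+ 2) ->
  is_derive x w f ('D_w g x).
Proof.
move=> dg r0 hK.
suff cf : h^-1 *: ((f \o shift x) (h *: w) - f x) @[h --> (0 : R)^'] --> 'D_w g x.
  split; first by apply/cvg_ex; exists ('D_w g x).
  exact: cvg_lim.
apply/cvgrPdist_le => e e0.
have e2 : 0 < e / 2 by rewrite divr_gt0.
have := dg => /cvgrPdist_le/(_ _ e2)[/= r1 r10 h1].
pose r2 := e / 2 / (1 + `|K|).
have K0 : 0 < 1 + `|K| by rewrite ltr_wpDr.
exists (Num.min r (Num.min r1 r2)); first by rewrite /= !lt_min r0 r10 divr_gt0.
move=> h /=; rewrite sub0r normrN !lt_min => /andP[hr /andP[hr1 hr2]] hn.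
have := h1 h; rewrite /= sub0r normrN => /(_ hr1 hn).
have := hK h hr; rewrite -[lim _]/('D_w g x) ![h *: w + x]addrC ![_ *: (_ - _)]mulrC.
move: (f (x + _)) (f x) (g (x + _)) (g x) ('D_w g x) => f1 f0 g1 g0 dd A1 A2.
have h0 : 0 < `|h| by rewrite normr_gt0.
have -> : dd - (f1 - f0) * h^-1 = (dd - (g1 - g0) * h^-1) - (f1 - f0 - (g1 - g0)) * h^-1 by ring.
apply: le_trans (ler_normB _ _) _; rewrite (splitr e) lerD// normrM normfV.
rewrite ler_pdivrMr//; apply: le_trans A1 _.
move: hr2; rewrite /r2 ltr_pdivlMr// => hr2.
rewrite -[h ^+ 2]real_normK ?num_real// expr2 mulrA ler_pM2r//.
have := ler_norm K; nra.
Qed.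

Lemma derive_norm_le (f : V -> R) (x w : V) (K r : R) : derivable f x w -> 0 < r ->
  (forall h, `|h| < r -> `|f (x + h *: w) - f x| <= K * `|h|) ->
  `|'D_w f x| <= K.
Proof.
move=> df r0 hK; apply/ler_addgt0Pr => e e0.
have := df => /cvgrPdist_le/(_ _ e0)[/= r1 r10 h1].
pose h := Num.min r r1 / 2.
have m0 : 0 < Num.min r r1 by rewrite lt_min r0.
have h0 : 0 < h by rewrite divr_gt0.
have hm : h < Num.min r r1 by rewrite ltr_pdivrMr// ltr_pMr// ltr1n.
have hr : h < r by rewrite (lt_le_trans hm)// ge_min lexx.
have hr1 : h < r1 by rewrite (lt_le_trans hm)// ge_min lexx orbT.
have := h1 h; rewrite /= sub0r normrN gtr0_norm// => /(_ hr1 (lt0r_neq0 h0)).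
have := hK h; rewrite gtr0_norm// => /(_ hr).
rewrite -[lim _]/('D_w f x) ![h *: w + x]addrC ![_ *: (_ - _)]mulrC.
move: (f (x + _)) (f x) ('D_w f x) => f1 f0 dd A1 A2.
rewrite -[dd](subrK ((f1 - f0) * h^-1)) addrC.
apply: le_trans (ler_normD _ _) _; apply: lerD => //.
by rewrite normrM normfV (gtr0_norm h0) ler_pdivrMr.
Qed.

End Derivatives.

(** Serves twice: for the variation of the exact gradient, with E2 the expectation at mixed
    parameters, and for the error of its estimate, with E2 = E3. *)
Lemma split_difference {R : realType} k l (E1 E2 E3 : 'cV[R]_k) (J J' : 'M[R]_(l, k))
    (G G' : 'cV[R]_l) :
  E1 + J^T *m G - (E3 + J'^T *m G') =
    (E1 - E2) + (E2 - E3) + (J - J')^T *m G + J'^T *m (G - G').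
Proof.
by rewrite [(J - J')^T]linearB mulmxBl mulmxBr opprD addrACA -[E1 - E3](subrKA E2) -!addrA; congr (_ + (_ + (_ + (_ + _)))); rewrite addKr.
Qed.

Section PerformativeLoss.
Context {R : realType} {n m d : nat} (M : model R n m d) (c : constants R).
Hypotheses (HS : model_setting M) (HB : convex_set (Bset M)).
Hypotheses (HD : assumption_densities M) (HG : assumption_growth M).
Hypothesis HC : valid_constants M c.
Hypotheses (HT : convex_set (Theta M)) (Hb : Ck 3 setT (beta M)).
Hypothesis HbB : forall t, Theta M t -> Bset M (beta M t).
Variable delta : R.
Hypothesis delta0 : 0 < delta.

Local Notation B := (Bset M).
Local Notation D := (Dist M).
Local Notation s := (score M).
Local Notation b_ := (beta M).
Local Notation Th := (Theta_sp M delta).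

Lemma Theta_spW t : Th t -> Theta M t. Proof. by case. Qed.

(** The point t + w lies on the segment from t to t + delta w / |w|, whose endpoints are in [Theta].
    Hence points of [Theta_sp] are interior to [Theta], and two-sided derivatives make sense
    there. *)
Lemma Theta_sp_ball t (w : 'cV[R]_n) : Th t -> enorm w <= delta -> Theta M (t + w).
Proof.
move=> [Tt Ts] wd; have [->|w0] := eqVneq w 0; first by rewrite addr0.
have nw := enorm_gt0 w0.
have [|+ _] := Ts ((enorm w)^-1 *: w).
  by rewrite /sphere/= enormZ gtr0_norm ?invr_gt0// mulVf ?gt_eqF.
have := (convexP _).1 HT => /(_ t _ (enorm w / delta) Tt)/[apply].
rewrite divr_ge0 ?(ltW nw) ?(ltW delta0)// ler_pdivrMr// mul1r => /(_ isT wd).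
rewrite addrAC subrr add0r !scalerA divfK ?gt_eqF// divff ?gt_eqF//.
by rewrite scale1r.
Qed.

Lemma Theta_sp_convex : convex_set Th.
Proof.
apply/convexP => x y a [Tx Sx] [Ty Sy] a0 a1; have cT := (convexP _).1 HT; split.
  exact: cT.
move=> u su; have [xp xm] := Sx u su; have [yp ym] := Sy u su; split.
- by rewrite (_ : _ + _ = x + delta *: u + a *: (y + delta *: u - (x + delta *: u)));
    [exact: cT|apply/matrixP => i j; rewrite !mxE; ring].
- by rewrite (_ : _ - _ = x - delta *: u + a *: (y - delta *: u - (x - delta *: u)));
    [exact: cT|apply/matrixP => i j; rewrite !mxE; ring].
Qed.

Lemma beta_differentiable x : differentiable b_ x.
Proof. by have [+ _] := Hb; apply. Qed.

Definition perf_grad (t : 'cV[R]_n) : 'cV[R]_n :=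
  expect (D (b_ t)) (fun z => grad (loss M z) t) + (jac b_ t)^T *m Gvec M t (b_ t).

Lemma grad_loss_lipschitz z t w (h : R) : Th t -> enorm w <= delta ->
  (forall t', Theta M t' -> opnorm (hess (loss M z) t') <= h) ->
  enorm (grad (loss M z) (t + w) - grad (loss M z) t) <= h * enorm w.
Proof.
move=> Tt wd hh; apply: mvt_vec => x x0 x1; first exact: grad_loss_differentiable.
apply: le_trans (enorm_mulmx_op _ _) _; rewrite ler_wpM2r ?enorm_ge0//.
apply: hh; apply: Theta_sp_ball => //; rewrite enormZ ger0_norm//.
by apply: le_trans wd; rewrite ler_piMl ?enorm_ge0.
Qed.

Lemma norm_Rint_Dist_le b (f g : 'cV[R]_d -> R) C : B b ->
  (D b).-integrable setT (EFin \o f) ->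
  measurable_fun setT g -> (forall z, 0 <= g z) ->
  (forall z, supp M b z -> `|f z| <= g z) ->
  (\int[D b]_z (g z)%:E <= C%:E)%E -> `|\int[D b]_z f z| <= C.
Proof.
move=> Bb if_ mg g0 fg gC; apply: le_trans (le_normr_Rintegral measurableT if_) _.
have /integrableP[mf fi] := if_.
rewrite -lee_fin /Rintegral fineK; last first.
  rewrite ge0_fin_numE; last by apply: integral_ge0 => z _; rewrite lee_fin.
  exact: le_lt_trans fi.
apply: le_trans gC; apply: (Dist_le HS Bb) => //.
by apply: measurableT_comp => //; exact/measurable_EFinP.
Qed.

Lemma perf_loss_expansion t : Th t -> exists K : R, forall w, enorm w <= delta ->
  `|perf_loss M (t + w) - perf_loss M t
    - dot (expect (D (b_ t)) (fun z => grad (loss M z) t)) w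
    - dot (Gvec M t (b_ t)) (b_ (t + w) - b_ t)| <= K * enorm w ^+ 2.
Proof.
move=> Tt; have Tt' := Theta_spW Tt; have Bt := HbB Tt'.
have [[Ll0 _ Lb0] [_ _ LG0] [_ _ I0]] := cst_ge0 HC.
have [H [C [mH H0 C0 hH intH]]] := hess_loss_bound HG.
set K1 := L_l_Lip c * Num.sqrt (I_max c) * L_b_Lip c.
exists (C + K1 + L_G_b c * L_b_Lip c ^+ 2) => w wd.
have Tw := Theta_sp_ball Tt wd; have Bw := HbB Tw.
have bl : enorm (b_ (t + w) - b_ t) <= L_b_Lip c * enorm w.
  by have := cst_b_Lip HC Tw Tt'; rewrite [t + w]addrC addrK.
have w0 := enorm_ge0 w.
have il := loss_integrable HS HG Bw Tw.
have il' := loss_integrable HS HG Bw Tt'.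
have igi i := grad_loss_integrable HG HC i Bw Tt'.
have igi' i := grad_loss_integrable HG HC i Bt Tt'.
have ig : (D (b_ (t + w))).-integrable setT (fun z => (dot (grad (loss M z) t) w)%:E).
  apply: integrable_of_sqr.
    by apply: measurable_fun_dot => //; exact: measurable_grad_loss.
  exact: le_lt_trans (dot_grad_loss_sqr_le HG HC w Bw Tt') (ltry _).
have ild : (D (b_ (t + w))).-integrable setT (EFin \o (fun z => loss M z (t + w) - loss M z t)).
  by have := integrableB measurableT il il'; apply: eq_integrable => // z _ /=; rewrite EFinB.
have A1 : `|\int[D (b_ (t + w))]_z loss M z (t + w) - \int[D (b_ (t + w))]_z loss M z t -
    dot (expect (D (b_ (t + w))) (fun z => grad (loss M z) t)) w| <= C * enorm w ^+ 2.
  rewrite dot_expect// -RintegralB// -RintegralB//.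
  apply: (norm_Rint_Dist_le (g := fun z => enorm w ^+ 2 * H z) Bw).
  - by have := integrableB measurableT ild ig; apply: eq_integrable => // z _ /=; rewrite EFinB.
  - exact: measurable_funM.
  - by move=> z; rewrite mulr_ge0// sqr_ge0.
  - move=> z /(supp_Zset HS) Zz; rewrite expr2 -mulrA mulrC -mulrA mulrCA mulrA.
    apply: taylor1 => x x0 x1; first exact: loss_differentiable.
    have xw : enorm (x *: w) <= enorm w by rewrite enormZ ger0_norm// ler_piMl.
    apply: le_trans (grad_loss_lipschitz (h := H z) Tt (le_trans xw wd) _) _.
      by move=> t' Tt2; exact: hH.
    by rewrite ler_wpM2l.
  - under eq_integral do rewrite EFinM.
    rewrite ge0_integralZl//; last 3 first.
    + exact/measurable_EFinP.
    + by move=> z _; rewrite lee_fin.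
    + by rewrite lee_fin sqr_ge0.
    have -> : (C * enorm w ^+ 2)%:E = ((enorm w ^+ 2)%:E * C%:E)%E by rewrite -EFinM mulrC.
    by rewrite lee_wpmul2l ?lee_fin ?sqr_ge0// intH.
have A2 : `|dot (expect (D (b_ (t + w))) (fun z => grad (loss M z) t)
     - expect (D (b_ t)) (fun z => grad (loss M z) t)) w| <= K1 * enorm w ^+ 2.
  apply: le_trans (dot_normr_le _ _) _; rewrite expr2 mulrA ler_wpM2r//.
  apply: le_trans (expect_grad_loss_lipschitz HS HB HD HG HC Bt Bw Tt') _.
  by rewrite /K1 -[leRHS]mulrA; apply: ler_wpM2l => //; rewrite mulr_ge0// sqrtr_ge0.
have B3 : L_G_b c * enorm (b_ (t + w) - b_ t) ^+ 2 <= L_G_b c * L_b_Lip c ^+ 2 * enorm w ^+ 2.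
  rewrite -mulrA ler_wpM2l// -exprMn.
  by apply: lerXn2r; rewrite ?nnegrE ?enorm_ge0// mulr_ge0.
have A3 := le_trans (Rint_loss_taylor HS HB HD HG HC Bt Bw Tt') B3.
rewrite dotBl in A2; rewrite /perf_loss.
move: A1 A2 A3; rewrite !mulrDl.
move: (Rintegral (D (b_ t)) _ _) => a3.
move: (Rintegral (D (b_ (t + w))) setT (loss M ^~ t)) => a2.
move: (Rintegral (D (b_ (t + w))) _ _) => a1.
 move: (dot (Gvec _ _ _) _) => g; move: (dot _ w) => e1; move: (dot _ w) => e0.
move=> A1 A2 A3; rewrite (_ : _ - g = (a1 - a2 - e1) + (e1 - e0) + (a2 - a3 - g)); last by ring.
apply: le_trans (ler_normD _ _) _; apply: lerD => //.
by apply: le_trans (ler_normD _ _) _; apply: lerD.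
Qed.

Lemma is_derive_perf_loss t w : Th t -> is_derive t w (perf_loss M) (dot (perf_grad t) w).
Proof.
move=> Tt; have [K hK] := perf_loss_expansion Tt.
set E := expect (D (b_ t)) (fun z => grad (loss M z) t).
set G := Gvec M t (b_ t).
(* E and G are frozen at t: [perf_loss] follows g up to the quadratic remainder, and g is
   differentiable because [beta] is. *)
pose g y := dot y E + dot (b_ y) G.
have d1 : differentiable (fun y : 'cV[R]_n => dot y E) t by apply: differentiable_dotl.
have d2 : differentiable (fun y : 'cV[R]_n => dot (b_ y) G) t.
  by apply: differentiable_dotl; exact: beta_differentiable.
have dg : derivable g t w by apply: derivableD; exact: diff_derivable.
have -> : dot (perf_grad t) w = 'D_w g t.
  rewrite (deriveD (diff_derivable d1) (diff_derivable d2)).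
  have -> : 'D_w (fun y : 'cV[R]_n => dot y E) t = dot w E.
    have dI : derivable (fun y : 'cV[R]_n => y) t w by exact/diff_derivable.
    by rewrite (derive_dotl _ dI); congr (dot _ E); exact: derive_id.
  rewrite derive_dotl; last exact: diff_derivable (beta_differentiable _).
  rewrite derive_jac; last exact: beta_differentiable.
  by rewrite dot_mulmx /perf_grad dotDl [dot w E]dotC [dot w _]dotC.
have w1 : 0 < 1 + enorm w by rewrite ltr_wpDr// enorm_ge0.
(* This radius keeps h w in the ball of radius delta; the 1 in the denominator allows w = 0. *)
apply: (derive_approx (K := K * enorm w ^+ 2) (r := delta / (1 + enorm w)) dg).
  by rewrite divr_gt0.
move=> h; rewrite ltr_pdivlMr// => hr.
have hw : enorm (h *: w) <= delta.
  rewrite enormZ; apply: le_trans (ltW hr); rewrite ler_wpM2l// lerDr ler01//.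
have := hK _ hw; rewrite enormZ exprMn real_normK ?num_real// mulrCA [h ^+ 2 * _]mulrC.
apply: le_trans; rewrite le_eqVlt; apply/orP; left; apply/eqP; congr `|_|.
by rewrite /g dotBr [t + _]addrC; 
   rewrite [dot (h *: w + t) E]dotDl [dot (Gvec _ _ _) _]dotC [dot G _]dotC [dot E _]dotC -/E -/G; ring.
Qed.

Lemma grad_perf_loss t : Th t -> grad (perf_loss M) t = perf_grad t.
Proof.
move=> Tt; apply/matrixP => i j; rewrite ord1 mxE.
by have [_ ->] := is_derive_perf_loss (ebasis i) Tt; rewrite dot_ebasis.
Qed.

Lemma beta_line_le t w v h : Th t -> `|h| < delta / (1 + enorm w) ->
  `|dot (b_ (t + h *: w)) v - dot (b_ t) v| <= L_b_Lip c * enorm w * enorm v * `|h|.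
Proof.
move=> Tt; rewrite ltr_pdivlMr ?ltr_wpDr ?enorm_ge0// => hr.
have hw : enorm (h *: w) <= delta.
  by rewrite enormZ; apply: le_trans (ltW hr); rewrite ler_wpM2l// lerDr ler01.
rewrite -dotBl; apply: le_trans (dot_normr_le _ _) _.
have := cst_b_Lip HC (Theta_sp_ball Tt hw) (Theta_spW Tt).
rewrite [t + _]addrC addrK enormZ => hl.
by rewrite mulrAC ler_wpM2r ?enorm_ge0// -mulrA [enorm w * _]mulrC.
Qed.

Lemma derivable_dot_beta t w v : derivable (fun y => dot (b_ y) v) t w /\
  'D_w (fun y => dot (b_ y) v) t = dot (jac b_ t *m w) v.
Proof.
have db := beta_differentiable t; split.
  by apply: diff_derivable; exact: differentiable_dotl.
by rewrite derive_dotl ?derive_jac//; exact: diff_derivable.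
Qed.

Lemma jac_beta_le t w : Th t -> enorm (jac b_ t *m w) <= L_b_Lip c * enorm w.
Proof.
move=> Tt; have [[_ _ Lb0] _ _] := cst_ge0 HC.
apply: enorm_dual => [|v]; first by rewrite mulr_ge0 ?enorm_ge0.
have [dv <-] := derivable_dot_beta t w v.
apply: le_trans (ler_norm _) _.
apply: (derive_norm_le dv (r := delta / (1 + enorm w))); last by move=> h; exact: beta_line_le.
by rewrite divr_gt0// ltr_wpDr// enorm_ge0.
Qed.

Lemma score_mean_diff b b0 b1 : B b -> B b0 -> B b1 -> \int[D b]_z dot (s z b) (b1 - b0) = 0.
Proof.
move=> Bb Bb0 Bb1; transitivity (\int[D b]_z (dot (s z b) (b1 - b) - dot (s z b) (b0 - b))).
  by apply: eq_Rint => z; rewrite -dotBr opprB addrA subrK.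
have i0 := score_integrable HS HD HG HC (b0 - b) Bb.
have i1 := score_integrable HS HD HG HC (b1 - b) Bb.
rewrite (RintegralB measurableT i1 i0).
by rewrite !(score_mean0 HS HB HD HG HC Bb)// subrr.
Qed.

Lemma score_mean_dot b v : B b -> \int[D b]_z dot (s z b) v = dot (expect (D b) (fun z => s z b)) v.
Proof.
move=> Bb; rewrite dot_expect// => i.
have := score_integrable HS HD HG HC (ebasis i) Bb.
by apply: eq_integrable => // z _; rewrite dot_ebasis.
Qed.

(** Near t, [beta] stays in [Bset], so pairing it with the mean score gives a constant function; its
    derivative is the claim. *)
Lemma score_mean_jac b t w : B b -> Th t -> \int[D b]_z dot (s z b) (jac b_ t *m w) = 0.
Proof.
move=> Bb Tt; have Bt := HbB (Theta_spW Tt).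
rewrite score_mean_dot// dotC.
have [dv <-] := derivable_dot_beta t w (expect (D b) (fun z => s z b)).
apply/eqP; rewrite -normr_le0.
apply: (derive_norm_le dv (r := delta / (1 + enorm w))) => [|h].
  by rewrite divr_gt0// ltr_wpDr// enorm_ge0.
rewrite ltr_pdivlMr ?ltr_wpDr ?enorm_ge0// => hr.
have hw : enorm (h *: w) <= delta.
  by rewrite enormZ; apply: le_trans (ltW hr); rewrite ler_wpM2l// lerDr ler01.
have Bh := HbB (Theta_sp_ball Tt hw).
by rewrite -dotBl dotC -score_mean_dot// score_mean_diff// normr0 mul0r.
Qed.

Lemma expect_grad_loss_sm t t' : Theta M t -> Theta M t' ->
  enorm (expect (D (b_ t)) (fun z => grad (loss M z) t)
         - expect (D (b_ t)) (fun z => grad (loss M z) t')) <= L_l_sm c * enorm (t - t').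
Proof.
move=> Tt Tt'; have Bt := HbB Tt; have [[_ ls0 _] _ _] := cst_ge0 HC.
apply: enorm_dual => [|v]; first by rewrite mulr_ge0 ?enorm_ge0.
have ig t0 : Theta M t0 -> (D (b_ t)).-integrable setT (fun z => (dot (grad (loss M z) t0) v)%:E).
  move=> T0; apply: integrable_of_sqr.
    by apply: measurable_fun_dot => //; exact: measurable_grad_loss.
  exact: le_lt_trans (dot_grad_loss_sqr_le HG HC v Bt T0) (ltry _).
have mg t0 : measurable_fun setT (fun z => grad (loss M z) t0) by exact: measurable_grad_loss.
have mgB : measurable_fun setT (fun z => grad (loss M z) t - grad (loss M z) t').
  apply: measurable_fun_cV => i.
  rewrite (_ : (fun z => _) = (fun z => grad (loss M z) t i 0 - grad (loss M z) t' i 0)).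
    by apply: measurable_funB; exact: measurable_fun_coord.
  by apply/funext => z; rewrite !mxE.
have igi t0 i : Theta M t0 -> (D (b_ t)).-integrable setT (fun z => (grad (loss M z) t0 i 0)%:E).
  by move=> T0; exact: (grad_loss_integrable HG HC).
have -> : dot (expect (D (b_ t)) (fun z => grad (loss M z) t)
         - expect (D (b_ t)) (fun z => grad (loss M z) t')) v =
    \int[D (b_ t)]_z (dot (grad (loss M z) t) v - dot (grad (loss M z) t') v).
  rewrite (RintegralB measurableT (ig _ Tt) (ig _ Tt')) dotBl.
  congr (_ - _); apply: dot_expect => i; exact: igi.
apply: le_trans (ler_norm _) _.
apply: (norm_Rint_Dist_le
  (g := fun z => enorm v * enorm (grad (loss M z) t - grad (loss M z) t')) Bt).
- by have := integrableB measurableT (ig _ Tt) (ig _ Tt'); apply: eq_integrable => // z _ /=; rewrite EFinB.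
- by apply: measurable_funM => //; exact: measurable_fun_enorm.
- by move=> z; rewrite mulr_ge0 ?enorm_ge0.
- by move=> z _; rewrite -dotBl mulrC dot_normr_le.
under eq_integral do rewrite EFinM.
rewrite ge0_integralZl//; last 3 first.
- by apply/measurable_EFinP; exact: measurable_fun_enorm.
- by move=> z _; rewrite lee_fin enorm_ge0.
- by rewrite lee_fin enorm_ge0.
by rewrite mulrC EFinM lee_wpmul2l ?lee_fin ?enorm_ge0// cst_l_sm.
Qed.

(** The four terms of [split_difference], with E2 the expectation under the law at t of the gradient
    at t', yield the four terms of [L_L_sm]. Both Jacobians have range orthogonal to the mean score,
    hence so does their difference. *)
Lemma perf_grad_lipschitz t t' : Th t -> Th t' ->
  enorm (perf_grad t - perf_grad t') <= L_L_sm c * enorm (t - t').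
Proof.
move=> Ht Ht'; have [Tt Tt'] := (Theta_spW Ht, Theta_spW Ht').
have [Bt Bt'] := (HbB Tt, HbB Tt').
have [[Ll0 Ls0 Lb0] [Lbs0 _ LG0] [LGt0 _ I0]] := cst_ge0 HC.
have bl := cst_b_Lip HC Tt Tt'.
set N := enorm (t - t') in bl *.
have N0 : 0 <= N by exact: enorm_ge0.
have A1 := expect_grad_loss_sm Tt Tt'.
have A2 := expect_grad_loss_lipschitz HS HB HD HG HC Bt' Bt Tt'.
have {}A2 := le_trans A2 (ler_wpM2l (mulr_ge0 Ll0 (sqrtr_ge0 _)) bl).
have A3 : enorm ((jac b_ t - jac b_ t')^T *m Gvec M t (b_ t))
    <= Num.sqrt (M_l c * I_max c) * (L_b_sm c * N).
  apply: (enorm_mulmx_Gvec HS HD HG HC) => //.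
  - by rewrite mulr_ge0.
  - move=> y; transitivity (\int[D (b_ t)]_z (dot (s z (b_ t)) (jac b_ t *m y) -
        dot (s z (b_ t)) (jac b_ t' *m y))).
      by apply: eq_Rint => z; rewrite -dotBr mulmxBl.
    have i0 := score_integrable HS HD HG HC (jac b_ t *m y) Bt.
    have i1 := score_integrable HS HD HG HC (jac b_ t' *m y) Bt.
    rewrite (RintegralB measurableT i0 i1).
    apply/eqP; rewrite subr_eq0; apply/eqP; transitivity (0 : R).
      exact: score_mean_jac.
    by apply/esym; exact: score_mean_jac.
  - move=> y; apply: le_trans (enorm_mulmx_op _ _) _.
    by rewrite ler_wpM2r ?enorm_ge0//; exact: cst_b_sm.
have A4 : enorm ((jac b_ t')^T *m (Gvec M t (b_ t) - Gvec M t' (b_ t')))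
    <= L_b_Lip c * (L_G_b c * (L_b_Lip c * N) + L_G_t c * N).
  apply: enorm_dual => [|v].
    by rewrite mulr_ge0// addr_ge0// !mulr_ge0.
  rewrite dotC -dot_mulmx; apply: le_trans (dot_le _ _) _.
  apply: le_trans (ler_wpM2r (enorm_ge0 _) (jac_beta_le _ Ht')) _.
  rewrite mulrAC; apply: ler_wpM2r; first exact: enorm_ge0.
  apply: ler_wpM2l => //.
  apply: le_trans (cst_G HC Tt Tt' Bt Bt') _.
  by rewrite lerD2r ler_wpM2l.
rewrite /perf_grad /L_L_sm.
set E1 := expect _ _ in A1 *; set E2 := expect (D (b_ t)) _ in A1 A2 *.
set E3 := expect _ _ in A2 *.
set J := jac b_ t in A3 *; set J' := jac b_ t' in A3 A4 *.
set G := Gvec _ _ _ in A3 A4 *; set G' := Gvec _ _ _ in A4 *.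
rewrite (split_difference E1 E2 E3 J J' G G').
rewrite [leRHS](_ : _ = L_l_sm c * N + L_l_Lip c * Num.sqrt (I_max c) * (L_b_Lip c * N)
  + Num.sqrt (M_l c * I_max c) * (L_b_sm c * N)
  + L_b_Lip c * (L_G_b c * (L_b_Lip c * N) + L_G_t c * N)); last by ring.
do 3![apply: le_trans (enormD _ _) _; apply: lerD => //].
Qed.

Lemma perf_loss_descent x y : Th x -> Th y ->
  perf_loss M y <= perf_loss M x + dot (grad (perf_loss M) x) (y - x)
    + L_L_sm c / 2 * enorm (y - x) ^+ 2.
Proof.
move=> Tx Ty; rewrite grad_perf_loss//; set w := y - x.
have Ts t : 0 <= t -> t <= 1 -> Th (x + t *: w) by apply: (convexP _).1 Theta_sp_convex _ _ _ Tx Ty.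
have := @second_order_le R (fun t => perf_loss M (x + t *: w))
  (fun t => dot (perf_grad (x + t *: w)) w) (dot (perf_grad x) w) (L_L_sm c * enorm w ^+ 2).
rewrite scale1r scale0r addr0 /w subrKC -/w [_ * _ / 2]mulrAC; apply.
- move=> t t0 t1; have [dv <-] := is_derive_perf_loss w (Ts _ t0 t1).
  exact: is_derive_line.
- move=> t t0 t1; rewrite -lerBlDl -dotBl; apply: le_trans (dot_le _ _) _.
  apply: le_trans (ler_wpM2r (enorm_ge0 _) (perf_grad_lipschitz (Ts _ t0 t1) Tx)) _.
  rewrite [x + _]addrC addrK enormZ ger0_norm// expr2.
  by rewrite le_eqVlt; apply/orP; left; apply/eqP; ring.
Qed.

Lemma Theta_sp_closed : closed (Theta M) -> closed Th.
Proof.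
move=> cT; have cl v : closed [set x : 'cV[R]_n | Theta M (x + v)].
  apply: (@closed_comp _ _ (fun x : 'cV[R]_n => x + v)) => // x _.
  exact: (cvgD (f := id) cvg_id (cvg_cst v)).
rewrite (_ : Th = Theta M `&` \bigcap_(u in @sphere R n)
   ([set x | Theta M (x + delta *: u)] `&` [set x | Theta M (x - delta *: u)])).
  by apply: closedI => //; apply: closed_bigI => u _; apply: closedI; exact: cl.
by apply/seteqP; split.
Qed.

Lemma Theta_sp_compact : closed (Theta M) -> compact (Theta M) -> compact Th.
Proof.
by move=> cT kT; apply: subclosed_compact kT _ => [|x]; [exact: Theta_sp_closed|exact: Theta_spW].
Qed.

End PerformativeLoss.

(** * Conditional noise and measurability of the data kernels *)

Section BoundedAdapted.
Context {R : realType} {dO} {Omega : measurableType dO}.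
Variable F : set (set Omega).
Hypothesis sF : sub_sigma_field F.

(** Boundedness and adaptedness, expressed by [bmf] on [Omega] equipped with [F], so that its
    closure properties carry over. *)
Definition bwrt (W : Omega -> R) := @bmf R _ (g_sigma_algebraType F) W.

Lemma bwrt_wrt W : bwrt W -> wrt F W.
Proof. by move=> [mW _]; apply/(wrtP W sF). Qed.

Lemma bwrt_bound W : bwrt W -> exists C, forall w, `|W w| <= C.
Proof. by case. Qed.

Lemma bwrt_bmf W : bwrt W -> bmf W.
Proof. by move=> bW; split; [exact: wrt_measurable sF (bwrt_wrt bW)|exact: bwrt_bound]. Qed.

End BoundedAdapted.

Section ConditionalNoise.
Context {R : realType} {dO} {Omega : measurableType dO} (P : probability Omega R).
Variable F : set (set Omega).
Hypothesis sF : sub_sigma_field F.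
Context {I : finType} {dE} {E : measurableType dE}.
Variables (X : I -> Omega -> E) (kappa : I -> Omega -> probability E R).
Hypothesis mX : forall i, measurable_fun setT (X i).
Hypothesis mk : forall i S, measurable S ->
  measurable_fun setT (fun w => fine (kappa i w S)).
Hypothesis cX : cond_indep_draws P F X kappa.

Lemma Rint_sqr_sum (a : I -> Omega -> R) : (forall k, bmf (a k)) ->
  (forall k k', k != k' -> \int[P]_w (a k w * a k' w) = 0) ->
  \int[P]_w ((\sum_k a k w) ^+ 2) = \sum_k \int[P]_w (a k w ^+ 2).
Proof.
move=> ba h; transitivity (\int[P]_w (\sum_k \sum_k' (a k w * a k' w))).
  apply: eq_Rint => w; rewrite expr2 mulr_suml; apply: eq_bigr => k _.
  by rewrite mulr_sumr.
have baa k k' : bmf (fun w => a k w * a k' w) by exact: bmfM.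
rewrite Rint_sum; last by move=> k _; exact: bmf_sum.
apply: eq_bigr => k _; rewrite Rint_sum// (bigD1 k)//= big1 ?addr0.
  by apply: eq_Rint => w; rewrite expr2.
by move=> k' kk; apply: h; rewrite eq_sym.
Qed.

(* Conditionally on F the summands are independent and centered. *)
Lemma cond_noise (c m : I -> Omega -> R) (phi : E -> R) (v : R) :
  (forall k, bwrt F (c k)) -> (forall k, bwrt F (m k)) -> bmf phi ->
  (forall k w, \int[kappa k w]_x phi x = m k w) ->
  (forall k w, \int[kappa k w]_x ((phi x - m k w) ^+ 2) <= v) ->
  \int[P]_w ((\sum_k c k w * (phi (X k w) - m k w)) ^+ 2)
    <= v * \int[P]_w (\sum_k c k w ^+ 2).
Proof.
move=> bc bm bphi hm hv.
have bc' k := bwrt_bmf sF (bc k); have bm' k := bwrt_bmf sF (bm k).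
have bX k : bmf (fun w => phi (X k w)) by exact: bmf_comp.
have d1 k (W : Omega -> R) (psi : E -> R) : bwrt F W -> bmf psi ->
    \int[P]_w (W w * psi (X k w)) = \int[P]_w (W w * \int[kappa k w]_x psi x).
  move=> bW bpsi.
  by have [] := cond_draw1 sF mX mk cX k (bwrt_wrt sF bW) (bwrt_bound bW) bpsi.
rewrite Rint_sqr_sum; last 2 first.
- by move=> k; apply: bmfM => //; exact: bmfB.
- move=> k k' kk; pose W w := c k w * c k' w.
  have bW : bwrt F W by exact: (bmfM (bc k) (bc k')).
  have bW' := bwrt_bmf sF bW.
  (* Each term is an [F]-measurable weight times draws; conditioning turns all four integrals into
     that of W m_k m_k', and they cancel. *)
  transitivity (\int[P]_w (W w * (phi (X k w) * phi (X k' w))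
     - (W w * m k w) * phi (X k' w) - (W w * m k' w) * phi (X k w) + W w * m k w * m k' w)).
    by apply: eq_Rint => w; rewrite /W; ring.
  have b1 : bmf (fun w => W w * (phi (X k w) * phi (X k' w))) by do 2!apply: bmfM => //.
  have b2 : bmf (fun w => W w * m k w * phi (X k' w)) by do 2!apply: bmfM => //.
  have b3 : bmf (fun w => W w * m k' w * phi (X k w)) by do 2!apply: bmfM => //.
  have b4 : bmf (fun w => W w * m k w * m k' w) by do 2!apply: bmfM => //.
  rewrite RintD//; last by apply: bmfB => //; exact: bmfB.
  rewrite RintB//; last exact: bmfB.
  rewrite RintB//.
  rewrite (cond_draw2 sF mX mk cX (bwrt_wrt sF bW) (bwrt_bound bW) kk bphi bphi).
  have bWm k0 : bwrt F (fun w => W w * m k0 w) by exact: (bmfM bW (bm k0)).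
  rewrite (d1 k' (fun w => W w * m k w))// (d1 k (fun w => W w * m k' w))//.
  have -> : \int[P]_w (W w * (\int[kappa k w]_x phi x * \int[kappa k' w]_x phi x)) =
      \int[P]_w (W w * m k w * m k' w).
    by apply: eq_Rint => w; rewrite !hm mulrA.
  have -> : \int[P]_w (W w * m k w * \int[kappa k' w]_x phi x) =
      \int[P]_w (W w * m k w * m k' w).
    by apply: eq_Rint => w; rewrite hm.
  have -> : \int[P]_w (W w * m k' w * \int[kappa k w]_x phi x) =
      \int[P]_w (W w * m k w * m k' w).
    by apply: eq_Rint => w; rewrite hm mulrAC.
  by rewrite subrr sub0r addNr.
rewrite Rint_sum; last by move=> k _; exact: bmfX.
rewrite mulr_sumr; apply: ler_sum => k _.
pose W w := c k w ^+ 2.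
have bW : bwrt F W by exact: (bmfX 2 (bc k)).
have bW' := bwrt_bmf sF bW.
have bphi2 : bmf (fun x => phi x ^+ 2) by exact: bmfX.
have [bK _] := cond_draw1 sF mX mk cX k (bwrt_wrt sF bW) (bwrt_bound bW) bphi2.
have bX2 : bmf (fun w => phi (X k w) ^+ 2) by exact: bmfX.
have b1 : bmf (fun w => W w * phi (X k w) ^+ 2) by exact: bmfM.
have b2 : bmf (fun w => 2 * (W w * m k w * phi (X k w))).
  by apply: bmfM; [exact: bmf_cst|do 2!apply: bmfM => //].
have b2' : bmf (fun w => W w * m k w * phi (X k w)) by do 2!apply: bmfM => //.
have b3 : bmf (fun w => W w * m k w ^+ 2) by apply: bmfM => //; exact: bmfX.
have b4 : bmf (fun w => W w * \int[kappa k w]_x (phi x ^+ 2)) by exact: bmfM.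
have -> : \int[P]_w ((c k w * (phi (X k w) - m k w)) ^+ 2) =
    \int[P]_w (W w * phi (X k w) ^+ 2 - 2 * (W w * m k w * phi (X k w)) + W w * m k w ^+ 2).
  by apply: eq_Rint => w; rewrite /W; ring.
rewrite RintD//; last exact: bmfB.
rewrite RintB// RintZ//.
have bWm : bwrt F (fun w => W w * m k w) by exact: (bmfM bW (bm k)).
rewrite (d1 k W (fun x => phi x ^+ 2))// (d1 k (fun w => W w * m k w))//.
have -> : \int[P]_w (W w * m k w * \int[kappa k w]_x phi x) = \int[P]_w (W w * m k w ^+ 2).
  by apply: eq_Rint => w; rewrite hm expr2 mulrA.
set A := \int[P]_w (W w * \int[kappa k w]_x (phi x ^+ 2)).
set B := \int[P]_w (W w * m k w ^+ 2).
have -> : A - 2 * B + B = A - B by ring.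
rewrite /A /B -RintB// -RintZ//; apply: le_Rint.
- exact: bmfB.
- by apply: bmfM => //; exact: bmf_cst.
move=> w; rewrite -/(W w) -mulrBr [v * _]mulrC ler_wpM2l ?sqr_ge0//.
apply: le_trans (hv k w).
have -> : \int[kappa k w]_x ((phi x - m k w) ^+ 2) =
    \int[kappa k w]_x (phi x ^+ 2 - 2 * m k w * phi x + m k w ^+ 2).
  by apply: eq_Rint => x; ring.
have bp : bmf (fun x => 2 * m k w * phi x) by apply: bmfM => //; exact: bmf_cst.
rewrite RintD//; [|exact: bmfB|exact: bmf_cst].
rewrite RintB// RintZ// hm Rint_cst le_eqVlt; apply/orP; left; apply/eqP.
by ring.
Qed.

End ConditionalNoise.

Section IidVariation.
Context {R : realType} {d} {T : measurableType d}.

Lemma Rint_iidS (P : probability T R) b (f : b.+1.-tuple T -> R) : bmf f ->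
  bmf (fun x => \int[iid P b]_y f (tcons (x, y))) /\
  \int[iid P b.+1]_z f z = \int[P]_x \int[iid P b]_y f (tcons (x, y)).
Proof.
move=> bf; have bft : bmf (fun xy => f (@tcons _ _ b xy)) by exact: bmf_comp (@measurable_tcons _ _ b) bf.
have [mg [C hC]] := bft.
have ig : ((P \x iid P b)%E : measure _ _).-integrable setT (EFin \o (fun xy => f (@tcons _ _ b xy))).
  exact: (@bmf_integrable _ _ _ (P \x iid P b)%E).
have mF := measurable_fubini_F ig.
have b1 x : bmf (fun y => f (@tcons _ _ b (x, y))).
  by split; [exact: (measurableT_comp mg)|exists C].
have bF : bmf (fun x => \int[iid P b]_y f (tcons (x, y))).
  split; last by exists C => y; apply: le_norm_Rint.
  by apply: (measurableT_comp _ mF).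
split => //; rewrite /= [LHS]/Rintegral integral_distribution//; last first.
  by apply/measurable_EFinP; case: bf.
rewrite -integral12_prod_meas1// [RHS]/Rintegral; congr fine.
by apply: eq_integral => x _; rewrite EFin_Rint.
Qed.

(** One coordinate is exchanged at a time. After the last b draws are integrated out, the function
    of the first draw is still bounded by 1, so exchanging that draw costs at most e. *)
Lemma iid_variation (P0 P1 : probability T R) (e : R) b : 0 <= e ->
  (forall f : T -> R, bmf f -> (forall x, `|f x| <= 1) ->
     `|\int[P1]_x f x - \int[P0]_x f x| <= e) ->
  forall f : b.-tuple T -> R, bmf f -> (forall x, `|f x| <= 1) ->
     `|\int[iid P1 b]_x f x - \int[iid P0 b]_x f x| <= b%:R * e.
Proof.
move=> e0 h; elim: b => [|b ih] f bf f1; first by rewrite subrr normr0 mul0r.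
have [b1 ->] := Rint_iidS P1 bf; have [b0 ->] := Rint_iidS P0 bf.
have bx x : bmf (fun y => f (@tcons _ _ b (x, y))).
  have [mf _] := bf; split; last by exists 1.
  apply: (measurableT_comp mf); apply: (measurableT_comp (@measurable_tcons _ _ b)).
  exact: measurable_pair1.
set g1 := fun x => _ in b1 *; set g0 := fun x => \int[iid P0 b]_y _ in b0 *.
have A : `|\int[P1]_x g1 x - \int[P1]_x g0 x| <= b%:R * e.
  rewrite -RintB//; apply: le_norm_Rint; first exact: bmfB.
  by move=> x; apply: ih => //.
have B : `|\int[P1]_x g0 x - \int[P0]_x g0 x| <= e.
  by apply: h => // x; apply: le_norm_Rint.
rewrite -(subrKA (\int[P1]_x g0 x)); apply: le_trans (ler_normD _ _) _.
by rewrite -natr1 mulrDl mul1r lerD.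
Qed.

End IidVariation.

Section ModelKernel.
Context {R : realType} {n m d : nat} (M : model R n m d) (c : constants R).
Hypotheses (HS : model_setting M) (HB : convex_set (Bset M)).
Hypotheses (HD : assumption_densities M) (HG : assumption_growth M).
Hypothesis HC : valid_constants M c.
Hypothesis HbB : forall t, Theta M t -> Bset M (beta M t).

(** [cond_indep_draws] does not state that the kernels are measurable. Here the probability of S is
    a Lipschitz function of Y w, by the total variation bound on the laws, and
    [measurable_fun_factor] concludes. *)
Lemma measurable_iid_kernel dO (Omega : measurableType dO) (Y : Omega -> 'cV[R]_n) b
    (S : set (b.-tuple 'cV[R]_d)) :
  measurable_fun setT Y -> (forall w, Theta M (Y w)) -> measurable S ->
  measurable_fun setT (fun w => fine (iid (Dist M (beta M (Y w))) b S)).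
Proof.
move=> mY TY mS; apply: (measurable_fun_factor mY) => w e e0.
have [[_ _ Lb0] _ [_ _ I0]] := cst_ge0 HC.
set K := b%:R * (Num.sqrt (I_max c) * L_b_Lip c).
have K0 : 0 <= K by rewrite !mulr_ge0 ?sqrtr_ge0.
exists (e / (1 + K)); first by rewrite divr_gt0// ltr_wpDr.
move=> w'; rewrite ltr_pdivlMr ?ltr_wpDr// => hw.
have N0 := enorm_ge0 (Y w - Y w').
apply: (@le_lt_trans _ _ (K * enorm (Y w - Y w'))); last first.
  by apply: le_lt_trans hw; rewrite mulrC ler_wpM2l// lerDr.
rewrite -!Rint_indic// /K -!mulrA; apply: iid_variation.
- by rewrite !mulr_ge0// sqrtr_ge0.
- move=> f [mf _] f1.
  apply: le_trans (Dist_tv_lipschitz HS HB HD HG HC (HbB (TY w')) (HbB (TY w)) mf f1) _.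
  by rewrite ler_wpM2l ?sqrtr_ge0//; exact: cst_b_Lip.
- exact: bmf_indic.
- by move=> x; rewrite indicE; case: (_ \in _); rewrite ?normr1// normr0.
Qed.

End ModelKernel.

(** * Central differences and empirical means *)

Lemma is_derive_scale {R : realType} (a s : R) : is_derive s 1 (fun x : R => a * x) (a * 1).
Proof. exact: (is_deriveZ (f := @id R) a (is_derive_id s 1)). Qed.

Section CentralDifference.
Context {R : realType} {n : nat}.
Variables (f : 'cV[R]_n -> R) (t : 'cV[R]_n) (delta L : R).
Hypothesis df : forall x, differentiable f x.
Hypothesis dg : forall x, differentiable (grad f) x.
Hypothesis delta0 : 0 < delta.
Hypothesis L0 : 0 <= L.
Hypothesis hL : forall y, enorm y <= delta ->
  opnorm (hess f (t + y) - hess f (t - y)) <= L * (2 * enorm y).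

(** Along s y the derivative is a difference of Hessians at the symmetric points t + s y and t - s
    y, of size 2 L |s y|; a further factor |y| gives the second order. *)
Lemma central_grad_le y : enorm y <= delta ->
  enorm (grad f (t + y) + grad f (t - y) - (grad f t + grad f t)) <= 2 * L * delta ^+ 2.
Proof.
move=> yd; have y0 := enorm_ge0 y; apply: enorm_dual => [|v].
  by have := sqr_ge0 delta; have := L0; nra.
pose g x := dot (grad f x) v.
have dgv x : differentiable g x by exact: differentiable_dotl.
have Dgv x w : 'D_w g x = dot (hess f x *m w) v.
  by rewrite derive_dotl ?derive_jac//; exact: diff_derivable.
pose psi (s : R) := g (t + s *: y) + g (t + s *: (- y)).
have Dpsi (s : R) : is_derive s 1 psi ('D_y g (t + s *: y) + 'D_(- y) g (t + s *: (- y))).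
  have D1 := @is_derive_line _ _ _ g t y s (diff_derivable (dgv _)).
  have D2 := @is_derive_line _ _ _ g t (- y) s (diff_derivable (dgv _)).
  exact: (is_deriveD D1 D2).
have DE s : 'D_y g (t + s *: y) + 'D_(- y) g (t + s *: (- y)) =
    dot ((hess f (t + s *: y) - hess f (t - s *: y)) *m y) v.
  have e1 := Dgv (t + s *: y) y; have e2 := Dgv (t + s *: - y) (- y).
  transitivity (dot (hess f (t + s *: y) *m y) v + dot (hess f (t + s *: - y) *m (- y)) v).
    by congr (_ + _).
  rewrite scalerN; move: (hess f (t + s *: y)) (hess f (t - s *: y)) => A A'.
  by rewrite mulmxN dotNl mulmxBl dotBl.
have psi1 : psi 1 - psi 0 =
    dot (grad f (t + y) + grad f (t - y) - (grad f t + grad f t)) v.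
  by rewrite /psi scale1r !scale0r addr0 scale1r dotBl !dotDl.
have [s /andP[s0 s1]] := mvt01 (fun s _ _ => Dpsi s).
rewrite psi1 DE => ->; apply: le_trans (dot_le _ _) _.
rewrite ler_wpM2r ?enorm_ge0//; apply: le_trans (enorm_mulmx_op _ _) _.
have sy : enorm (s *: y) <= delta.
  by rewrite enormZ gtr0_norm//; apply: le_trans yd; rewrite ler_piMl// ltW.
apply: le_trans (ler_wpM2r y0 (hL sy)) _.
rewrite -!mulrA mulrCA ler_wpM2l// ler_wpM2l// expr2.
by apply: ler_pM => //; exact: enorm_ge0.
Qed.

Definition central_diff (u : 'cV[R]_n) : R :=
  (2 * delta)^-1 * (f (t + delta *: u) - f (t - delta *: u)).

(** The derivative along u' to u of the central difference minus its linear part is a symmetric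
    second difference of gradients, so [central_grad_le] controls how the error varies with u. The
    points used stay in the delta-ball, as u' to u is a chord of the unit ball. *)
Lemma central_diff_lipschitz u u' : enorm u <= 1 -> enorm u' <= 1 ->
  `|(central_diff u - dot u (grad f t)) - (central_diff u' - dot u' (grad f t))|
    <= L * delta ^+ 2 * enorm (u - u').
Proof.
move=> u1 u'1; set w := delta *: (u - u').
pose phi (s : R) := f (t + delta *: u' + s *: w) - f (t - delta *: u' + s *: (- w))
   - (2 * dot w (grad f t)) * s.
pose y s := delta *: u' + s *: w.
have Dphi (s : R) : is_derive s 1 phi ('D_w f (t + delta *: u' + s *: w) -
    'D_(- w) f (t - delta *: u' + s *: (- w)) - 2 * dot w (grad f t) * 1).
  have D1 := @is_derive_line _ _ _ f (t + delta *: u') w s (diff_derivable (df _)).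
  have D2 := @is_derive_line _ _ _ f (t - delta *: u') (- w) s (diff_derivable (df _)).
  exact: (is_deriveB (is_deriveB D1 D2) (is_derive_scale _ s)).
have DE s : 'D_w f (t + delta *: u' + s *: w) -
    'D_(- w) f (t - delta *: u' + s *: (- w)) - 2 * dot w (grad f t) * 1 =
    dot (grad f (t + y s) + grad f (t - y s) - (grad f t + grad f t)) w.
  have -> : t + delta *: u' + s *: w = t + y s by rewrite /y addrA.
  have -> : t - delta *: u' + s *: (- w) = t - y s by rewrite /y opprD scalerN addrA.
  rewrite (derive_grad w (df (t + y s))) (derive_grad (- w) (df (t - y s))).
  by rewrite dotNr opprK dotBl !dotDl [dot w _]dotC; ring.
have wE : delta *: u = delta *: u' + w by rewrite /w scalerBr subrKC.
have phi1 : phi 1 - phi 0 = f (t + delta *: u) - f (t - delta *: u) -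
   2 * dot w (grad f t) - (f (t + delta *: u') - f (t - delta *: u')).
  have -> : t + delta *: u = t + delta *: u' + w by rewrite wE addrA.
  have -> : t - delta *: u = t - delta *: u' - w by rewrite wE opprD addrA.
  by rewrite /phi !scale1r !scale0r !addr0 mulr0 mulr1 subr0.
have [s /andP[s0 s1]] := mvt01 (fun s _ _ => Dphi s).
rewrite phi1 DE => e.
have ys : enorm (y s) <= delta.
  have -> : y s = delta *: (s *: u + (1 - s) *: u').
    by apply/matrixP => i j; rewrite /y /w !mxE; ring.
  rewrite enormZ gtr0_norm// -[leRHS]mulr1 ler_pM2l//.
  apply: le_trans (enormD _ _) _; rewrite !enormZ gtr0_norm// ger0_norm ?subr_ge0 ?(ltW s1)//.
  have : s * enorm u <= s * 1 by rewrite ler_wpM2l// ltW.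
  have : (1 - s) * enorm u' <= (1 - s) * 1 by rewrite ler_wpM2l// subr_ge0 ltW.
  lra.
have := le_trans (dot_normr_le _ w) (ler_wpM2r (enorm_ge0 w) (central_grad_le ys)).
rewrite -e => {e} h.
rewrite [X in `|X|](_ : _ = (2 * delta)^-1 * (f (t + delta *: u) - f (t - delta *: u) -
   2 * dot w (grad f t) - (f (t + delta *: u') - f (t - delta *: u')))); last first.
  by rewrite /central_diff /w dotZl dotBl; field; rewrite gt_eqF.
rewrite normrM gtr0_norm ?invr_gt0 ?mulr_gt0// ler_pdivrMl ?mulr_gt0//.
apply: le_trans h _; rewrite /w enormZ gtr0_norm//.
by rewrite le_eqVlt; apply/orP; left; apply/eqP; ring.
Qed.

End CentralDifference.

Section EmpiricalMean.
Context {R : realType} {d} {T : measurableType d} (P : probability T R).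
Context {d1} {E1 : measurableType d1} {d2} {E2 : measurableType d2}.
Variable Q : probability E2 R.
Variables (I : finType) (Y : T -> E1) (U : I -> T -> E2).
Hypotheses (mY : measurable_fun setT Y) (mU : forall i, measurable_fun setT (U i)).
Hypothesis hU : forall i A S, measurable A -> measurable S ->
  P (Y @^-1` A `&` U i @^-1` S) = (P (Y @^-1` A) * Q S)%E.
Hypothesis hU2 : forall i i' A S S', i != i' -> measurable A -> measurable S -> measurable S' ->
  P (Y @^-1` A `&` U i @^-1` S `&` U i' @^-1` S') = (P (Y @^-1` A `&` U i @^-1` S) * Q S')%E.

(** Centering given Y makes the summands orthogonal, and a variance is at most a second moment. The
    index i0 gives access to Fubini, from which the mean is measurable in Y. *)
Lemma Rint_sqr_empirical (g : E1 * E2 -> R) : bmf g -> I ->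
  \int[P]_w ((\sum_i (g (Y w, U i w) - \int[Q]_x g (Y w, x))) ^+ 2)
    <= \sum_i \int[P]_w (g (Y w, U i w) ^+ 2).
Proof.
move=> bg i0; set mean := fun y => \int[Q]_x g (y, x).
have [bm _] := Rint_indep mY (mU i0) (hU i0) bg; rewrite -/mean in bm.
pose g' z := g z - mean z.1.
have bg' : bmf g' by apply: bmfB => //; exact: bmf_comp measurable_fst bm.
have bx y : bmf (fun x => g (y, x)) by exact: bmf_comp (measurable_pair1 y) bg.
have bYU i : measurable_fun setT (fun w => (Y w, U i w)) by exact: measurable_fun_pair.
have g'0 y : \int[Q]_x g' (y, x) = 0.
  transitivity (\int[Q]_x g (y, x) - \int[Q]_x mean y).
    by rewrite -RintB//; exact: bmf_cst.
  by rewrite Rint_cst subrr.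
rewrite (@Rint_sqr_sum _ _ _ P _ (fun i w => g' (Y w, U i w))); last 2 first.
- by move=> i; exact: bmf_comp (bYU i) bg'.
- move=> i i' ii; apply: (Rint_indep_pair (Q := Q) mY (mU i) (mU i')) => //.
  by move=> A S S'; exact: hU2.
apply: ler_sum => i _.
have [_ ->] := Rint_indep mY (mU i) (hU i) (bmfX 2 bg').
have [b2 ->] := Rint_indep mY (mU i) (hU i) (bmfX 2 bg).
have [b1 _] := Rint_indep mY (mU i) (hU i) (bmfX 2 bg').
apply: le_Rint; [exact: bmf_comp mY b1|exact: bmf_comp mY b2|move=> w].
rewrite /g'/=.
have -> : \int[Q]_x ((g (Y w, x) - mean (Y w)) ^+ 2) =
   \int[Q]_x (g (Y w, x) ^+ 2 - 2 * mean (Y w) * g (Y w, x) + mean (Y w) ^+ 2).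
  by apply: eq_Rint => x; ring.
have b3 : bmf (fun x => 2 * mean (Y w) * g (Y w, x)) by apply: bmfM => //; exact: bmf_cst.
have b4 : bmf (fun x => g (Y w, x) ^+ 2) by exact: bmfX.
rewrite RintD//; [|exact: bmfB|exact: bmf_cst].
rewrite RintB// RintZ// -/(mean (Y w)) Rint_cst.
have := sqr_ge0 (mean (Y w)); lra.
Qed.

End EmpiricalMean.

(** * The iterates *)

Lemma sum_decrease {V : zmodType} (f : nat -> V) T :
  \sum_(t < T) (f t - f t.+1) = f 0%N - f T.
Proof.
elim: T => [|T ih]; first by rewrite big_ord0 subrr.
by rewrite big_ord_recr/= ih addrA subrK.
Qed.

Section Iterates.
Context {R : realType} {n m d : nat} (M : model R n m d) (c : constants R).
Variables (sigma_max : R) (b_min : nat) (sigma_j L_b_H_j : 'I_m -> R).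
Variables (alpha delta : R) (b b_sp : nat) (nu : probability 'cV[R]_n R).
Hypothesis HS : model_setting M.
Hypothesis HA : assumption_A M delta sigma_max b_min.
Hypothesis HC : valid_constants M c.
Hypothesis HU : assumption_S M c delta sigma_max b_min sigma_j L_b_H_j.
Hypotheses (delta0 : 0 < delta) (n0 : (0 < n)%N) (bsp0 : (0 < b_sp)%N).
Hypothesis bb : (b_min <= b)%N.
Hypothesis unu : unif_sphere nu.

Local Notation b_ := (beta M).
Local Notation Th := (Theta_sp M delta).

Let HB : convex_set (Bset M). Proof. by case: (A_Bset HA). Qed.
Let HbB t : Theta M t -> Bset M (b_ t). Proof. by case: (A_Bset HA) => _ _; apply. Qed.
Let HD := A_dens HA.
Let HG := A_growth HA.
Let HT : convex_set (Theta M). Proof. by case: (A_Theta HA). Qed.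
Let Hb := A_beta HA.
Let bmin0 : (0 < b_min)%N. Proof. by case: (A_Pred HA). Qed.
Let b0 : (0 < b)%N. Proof. exact: leq_trans bmin0 bb. Qed.

Lemma Bset_bounded : exists C, forall b1, Bset M b1 -> enorm b1 <= C.
Proof.
have [_ /compact_bounded[C [_ hC]] _] := A_Bset HA.
exists (m%:R * (1 + `|C|)) => b1 Bb1; apply: le_trans (enorm_le_normr _) _.
rewrite ler_wpM2l//; apply: (hC (1 + `|C|)) => //.
by rewrite (le_lt_trans (ler_norm C))// ltrDr.
Qed.

Lemma bmf_Pred k j : bmf (fun s : k.-tuple 'cV[R]_d => Pred M s j 0).
Proof.
split; first by apply: measurable_fun_coord; exact: Pred_measurable HS k.
have [C hC] := Bset_bounded; exists C => s.
by apply: le_trans (normr_coord_le _ _) _; apply: hC; exact: Pred_Bset HS _ _.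
Qed.

Lemma Pred_mean t k j : Theta M t -> (b_min <= k)%N ->
  \int[iid (Dist M (b_ t)) k]_s Pred M s j 0 = b_ t j 0.
Proof.
move=> Tt bk; have /matrixP/(_ j 0) := S_unbiased HU Tt bk; rewrite !mxE => h.
apply/eqP; rewrite -subr_eq0 -{}h -[X in _ - X](Rint_cst (iid (Dist M (b_ t)) k)) -RintB.
- by apply/eqP; apply: eq_Rint => s; rewrite !mxE.
- exact: bmf_Pred.
- exact: bmf_cst.
Qed.

Lemma Pred_variance t k j : Theta M t -> (b_min <= k)%N ->
  \int[iid (Dist M (b_ t)) k]_s ((Pred M s j 0 - b_ t j 0) ^+ 2) <= sigma_j j ^+ 2 / k%:R.
Proof.
move=> Tt bk; rewrite -lee_fin EFin_Rint; last first.
  by apply: bmfX; apply: bmfB; [exact: bmf_Pred|exact: bmf_cst].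
apply: le_trans (S_Pred HU j Tt bk); rewrite le_eqVlt; apply/orP; left; apply/eqP.
by apply: eq_integral => s _; rewrite real_normK// num_real.
Qed.

Let beta_coord_measurable j : measurable_fun setT (fun x => b_ x j 0).
Proof.
apply: continuous_measurable_cV => x; apply: differentiable_continuous.
by apply: differentiable_entry; exact: (beta_differentiable Hb).
Qed.

Lemma bwrt_beta dO (Omega : measurableType dO) (F : set (set Omega)) (Y : Omega -> 'cV[R]_n) j :
  sub_sigma_field F -> wrt F Y -> (forall w, Theta M (Y w)) -> bwrt F (fun w => b_ (Y w) j 0).
Proof.
move=> sF FY TY; split.
  by apply: measurableT_comp (beta_coord_measurable j) _; exact/(wrtP Y sF).
have [C hC] := Bset_bounded; exists C => w.
by apply: le_trans (normr_coord_le _ _) _; apply: hC; exact: HbB.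
Qed.

Lemma wrt_perturb dO (Omega : measurableType dO) (F : set (set Omega)) (Y U : Omega -> 'cV[R]_n) s :
  sub_sigma_field F -> wrt F Y -> wrt F U -> wrt F (fun w => perturb delta (Y w) (U w) s).
Proof.
move=> sF /(wrtP _ sF) FY /(wrtP _ sF) FU; apply/(wrtP _ sF).
case: s; rewrite /perturb; first by apply: measurable_funD_cV => //; exact: measurable_funZ_cV.
under eq_fun do rewrite -scaleNr.
by apply: measurable_funD_cV => //; exact: measurable_funZ_cV.
Qed.

Lemma perturb_in t u s : Th t -> sphere u -> Theta M (perturb delta t u s).
Proof. by move=> [_ h] /h[? ?]; case: s. Qed.

Lemma central_diff_beta_le t u : Th t -> sphere u ->
  \sum_j central_diff (fun x => b_ x j 0) t delta u ^+ 2 <= L_b_Lip c ^+ 2.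
Proof.
move=> [_ h] su; have [Tp Tm] := h u su; have [[_ _ Lb0] _ _] := cst_ge0 HC.
have -> : \sum_j central_diff (fun x => b_ x j 0) t delta u ^+ 2 =
    ((2 * delta)^-1 * enorm (b_ (t + delta *: u) - b_ (t - delta *: u))) ^+ 2.
  rewrite exprMn sqr_enormE mulr_sumr; apply: eq_bigr => j _.
  by rewrite !mxE -exprMn.
have d2 : 0 < 2 * delta by rewrite mulr_gt0.
apply: lerXn2r; rewrite ?nnegrE ?mulr_ge0 ?enorm_ge0 ?invr_ge0 ?(ltW d2)//.
rewrite ler_pdivrMl//; apply: le_trans (cst_b_Lip HC Tp Tm) _.
rewrite (_ : _ - _ = (2 * delta) *: u); last by apply/matrixP => i j; rewrite !mxE; ring.
by rewrite enormZ su mulr1 gtr0_norm// mulrC.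
Qed.

Lemma measurable_Theta_sp : measurable Th.
Proof.
rewrite -[Th]setCK; apply: measurableC; apply: open_measurable_mx; apply: closed_openC.
by apply: Theta_sp_closed; case: (A_Theta HA).
Qed.

(** Up to the factor n, the entry (j, l) of the Jacobian estimate for one direction without
    estimation noise. The indicators make it bounded on the whole product space, not just on
    admissible pairs. *)
Definition sp_sample (j : 'I_m) (l : 'I_n) (yu : 'cV[R]_n * 'cV[R]_n) : R :=
  \1_Th yu.1 * (\1_sphere yu.2 *
    (central_diff (fun x => b_ x j 0) yu.1 delta yu.2 * yu.2 l 0)).

Lemma sp_sampleE j l y u : Th y -> sphere u ->
  sp_sample j l (y, u) = central_diff (fun x => b_ x j 0) y delta u * u l 0.
Proof. by move=> Ty su; rewrite /sp_sample/= !indicE !mem_set// !mul1r. Qed.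

Lemma sphere_sqr_sum (u : 'cV[R]_n) : sphere u -> \sum_l u l 0 ^+ 2 = 1.
Proof. by move=> su; rewrite -sqr_enormE su expr1n. Qed.

Lemma sphere_coord_le (u : 'cV[R]_n) l : sphere u -> `|u l 0| <= 1.
Proof. by move=> su; rewrite -su; exact: normr_coord_le. Qed.

(** A rank-one matrix whose second factor is a unit vector: its Frobenius norm is that of the
    central difference of [beta], with no dependence on n. *)
Lemma sp_sample_sqr_le y u : Th y -> sphere u ->
  \sum_j \sum_l sp_sample j l (y, u) ^+ 2 <= L_b_Lip c ^+ 2.
Proof.
move=> Ty su; apply: le_trans (central_diff_beta_le Ty su).
rewrite le_eqVlt; apply/orP; left; apply/eqP; apply: eq_bigr => j _.
rewrite -[RHS]mulr1 -(sphere_sqr_sum su) mulr_sumr; apply: eq_bigr => l _.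
by rewrite sp_sampleE// exprMn.
Qed.

Lemma bmf_sp_sample j l : bmf (sp_sample j l).
Proof.
split.
  apply: measurable_funM.
    exact: measurableT_comp (measurable_indic measurable_Theta_sp) measurable_fst.
  apply: measurable_funM.
    exact: measurableT_comp (measurable_indic (@measurable_sphere R n)) measurable_snd.
  apply: measurable_funM; last exact: measurable_fun_coord measurable_snd.
  apply: measurable_funM => //; apply: measurable_funB.
    apply: measurableT_comp (beta_coord_measurable j) _.
    apply: measurable_funD_cV; first exact: measurable_fst.
    exact: measurable_funZ_cV measurable_snd.
  apply: measurableT_comp (beta_coord_measurable j) _.
  under eq_fun do rewrite -scaleNr.
  apply: measurable_funD_cV; first exact: measurable_fst.
  exact: measurable_funZ_cV measurable_snd.
have [[_ _ Lb0] _ _] := cst_ge0 HC.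
exists (L_b_Lip c) => -[y u].
have [Ty|Ty] := pselect (Th y); last first.
  by rewrite /sp_sample/= [\1_Th y]indicE memNset// mul0r normr0.
have [su|su] := pselect (sphere u); last first.
  by rewrite /sp_sample/= [\1_sphere u]indicE memNset// mul0r mulr0 normr0.
rewrite -(@ler_pXn2r _ 2)// ?nnegrE// real_normK ?num_real//.
apply: le_trans (sp_sample_sqr_le Ty su).
rewrite (bigD1 j)//= (bigD1 l)//= -addrA lerDl addr_ge0 ?sumr_ge0// => [l' _|j' _].
  exact: sqr_ge0.
by apply: sumr_ge0 => l' _; exact: sqr_ge0.
Qed.

(** Averaging <u, grad f> u and multiplying by n returns grad f exactly, so the bias comes from the
    remainder rho alone, to which [sphere_first_moment_lipschitz] applies. *)
Lemma sp_bias_le t j : Th t ->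
  \sum_l (n%:R * \int[nu]_u sp_sample j l (t, u) - jac b_ t j l) ^+ 2
    <= L_b_H_j j ^+ 2 * delta ^+ 4.
Proof.
(* No sign is assumed for [L_b_H_j]; the square in the conclusion absorbs the absolute value. *)
move=> Tt; set f := fun x => b_ x j 0; set L := `|L_b_H_j j|.
have db x := beta_differentiable Hb x.
have df x : differentiable f x by apply: differentiable_entry.
have dgr x : differentiable (grad f) x.
  apply: differentiable_cV => i.
  rewrite (_ : (fun y => _) = (fun y => ('D_(ebasis i) b_ y) j 0)); last first.
    by apply/funext => y; rewrite mxE derive_coord//; exact: diff_derivable.
  have [_ /(_ (ebasis i))[+ _]] := Hb => /(_ x Logic.I) dd.
  exact: differentiable_entry.
have hL y : enorm y <= delta -> opnorm (hess f (t + y) - hess f (t - y)) <= L * (2 * enorm y).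
  move=> yd; have Tp := Theta_sp_ball HT delta0 Tt yd.
  have Tm : Theta M (t - y) by apply: (Theta_sp_ball HT delta0 Tt); rewrite enormN.
  apply: le_trans (S_hess HU j Tp Tm) _.
  rewrite (_ : t + y - (t - y) = 2 *: y); last by apply/matrixP => i i'; rewrite !mxE; ring.
  by rewrite enormZ gtr0_norm// ler_wpM2r ?mulr_ge0 ?enorm_ge0// ler_norm.
pose rho u := central_diff f t delta u - dot u (grad f t).
pose bv : 'cV[R]_n := \col_l \int[nu]_u (\1_sphere u * (rho u * u l 0)).
have mrho : measurable_fun setT rho.
  apply: measurable_funB; last by apply: measurable_fun_dot.
  apply: measurable_funM => //; apply: measurable_funB.
    apply: measurableT_comp (beta_coord_measurable j) _.
    by apply: measurable_funD_cV => //; exact: measurable_funZ_cV.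
  apply: measurableT_comp (beta_coord_measurable j) _.
  under eq_fun do rewrite -scaleNr.
  by apply: measurable_funD_cV => //; exact: measurable_funZ_cV.
have hrho u u' : sphere u -> sphere u' -> `|rho u - rho u'| <= L * delta ^+ 2 * enorm (u - u').
  by move=> su su'; apply: (central_diff_lipschitz df dgr delta0 _ hL); rewrite ?su ?su' /L.
have [[_ _ Lb0] _ _] := cst_ge0 HC.
have brho : exists C, forall u, sphere u -> `|rho u| <= C.
  exists (L_b_Lip c + enorm (grad f t)) => u su; apply: le_trans (ler_normB _ _) _; apply: lerD.
    rewrite -(@ler_pXn2r _ 2)// ?nnegrE// real_normK ?num_real//.
    apply: le_trans (central_diff_beta_le Tt su).
    by rewrite (bigD1 j)//= lerDl sumr_ge0// => j' _; exact: sqr_ge0.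
  by apply: le_trans (dot_normr_le _ _) _; rewrite su mul1r.
have Ld0 : 0 <= L * delta ^+ 2 by rewrite mulr_ge0// ?sqr_ge0// /L.
have := sphere_first_moment_lipschitz (b := bv) unu n0 mrho Ld0 brho hrho.
move=> /(_ (fun l => mxE _ _ _ _)) hbv.
have -> : L_b_H_j j ^+ 2 * delta ^+ 4 = (L * delta ^+ 2) ^+ 2.
  by rewrite exprMn real_normK ?num_real// -exprM.
apply: (@le_trans _ _ ((n%:R * enorm bv) ^+ 2)); last first.
  by apply: lerXn2r => //; rewrite nnegrE// mulr_ge0 ?enorm_ge0.
rewrite exprMn sqr_enormE mulr_sumr le_eqVlt; apply/orP; left; apply/eqP.
apply: eq_bigr => l _; rewrite -exprMn; congr (_ ^+ 2).
have bcd : bmf (fun u => sp_sample j l (t, u)).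
  exact: bmf_comp (measurable_pair1 t) (bmf_sp_sample j l).
have bsm : bmf (fun u => \1_sphere u * (dot u (grad f t) * dot u (ebasis l))).
  apply: (bmf_sphere (C := enorm (grad f t))).
    by apply: measurable_funM; exact: measurable_fun_dot.
  move=> u su; rewrite normrM dot_ebasis -[leRHS]mulr1.
  apply: ler_pM => //; last exact: sphere_coord_le.
  by apply: le_trans (dot_normr_le _ _) _; rewrite su mul1r.
have -> : bv l 0 = \int[nu]_u sp_sample j l (t, u) -
    \int[nu]_u (\1_sphere u * (dot u (grad f t) * dot u (ebasis l))).
  rewrite mxE -RintB//; apply: eq_Rint => u.
  rewrite /sp_sample/= [\1_Th t]indicE mem_set// mul1r dot_ebasis /rho; ring.
rewrite sphere_second_moment// dot_ebasis jac_coord// -/f mulrBr; congr (_ - _).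
by rewrite mulrC divfK// pnatr_eq0 -lt0n.
Qed.

(** * A run: errors of the estimators, of the gradient, and their accumulation *)

Section Run.
Context {dO} {Omega : measurableType dO} (P : probability Omega R).
Variables (theta0 : 'cV[R]_n) (X : @run R n d b b_sp b_min dO Omega).
Variables Fpast Fdata Fdir : nat -> set (set Omega).
Hypothesis HR : is_run M alpha delta P nu theta0 X Fpast Fdata Fdir.
Hypothesis Th0 : Th theta0.

Local Notation th := (theta X).

Lemma theta_in t w : Th (th t w).
Proof.
case: t => [|t]; first by rewrite (run_init HR).
have [_ cT _ kT] := A_Theta HA.
rewrite (run_step HR); apply: euclid_proj_in; first exact: S_sp HU.
exact: Theta_sp_compact.
Qed.

Let Tth t w : Theta M (th t w). Proof. exact: Theta_spW (theta_in t w). Qed.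

Let sFp t : sub_sigma_field (Fpast t). Proof. by have [] := run_sigma HR t. Qed.
Let sFd t : sub_sigma_field (Fdata t). Proof. by have [] := run_sigma HR t. Qed.
Let sFr t : sub_sigma_field (Fdir t). Proof. by have [] := run_sigma HR t. Qed.
Let th_past t : wrt (Fpast t) (th t). Proof. by have [] := run_adapted HR t. Qed.
Let th_data t : wrt (Fdata t) (th t).
Proof. by move=> A mA; have [h _ _] := run_filtration HR t; apply: h; exact: th_past. Qed.
Let th_dir t : wrt (Fdir t) (th t).
Proof. by move=> A mA; have [_ h _] := run_filtration HR t; apply: h; exact: th_data. Qed.
Let dir_dir t i : wrt (Fdir t) (dir X t i).
Proof. by have [_ _ h _] := run_adapted HR t. Qed.
Lemma measurable_theta t : measurable_fun setT (th t).
Proof. exact: wrt_measurable (sFp t) (th_past t). Qed.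
Let mdir t i : measurable_fun setT (dir X t i).
Proof. exact: wrt_measurable (sFr t) (dir_dir t i). Qed.
Let mdata t : measurable_fun setT (data X t).
Proof. by have [_ h _ _] := run_adapted HR t; exact: wrt_measurable (sFd t) h. Qed.
Let mpm t k : measurable_fun setT (data_pm X t k).
Proof. by have [_ _ _ h] := run_adapted HR t; exact: wrt_measurable (sFp t.+1) (h k). Qed.
Let sdir t i w : sphere (dir X t i w). Proof. exact: run_dir_sphere HR _ _ _. Qed.

Lemma bmf_data_coord t j : bmf (fun w => Pred M (data X t w) j 0 - b_ (th t w) j 0).
Proof.
apply: bmfB; first exact: bmf_comp (mdata t) (bmf_Pred b j).
exact: (@bwrt_bmf R _ _ _ (sFp t) _ (bwrt_beta j (sFp t) (th_past t) (Tth t))).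
Qed.

Lemma bmf_data_error t : bmf (fun w => enorm (Pred M (data X t w) - b_ (th t w)) ^+ 2).
Proof.
rewrite (_ : (fun w => _) = (fun w => \sum_j (Pred M (data X t w) j 0 - b_ (th t w) j 0) ^+ 2)).
  by apply: bmf_sum => j _; apply: bmfX; exact: bmf_data_coord.
by apply/funext => w; rewrite sqr_enormE; apply: eq_bigr => j _; rewrite !mxE.
Qed.

(** Component by component, this is [cond_noise] for a single dataset of weight 1, indexed by
    [unit]. *)
Lemma data_error_le t :
  \int[P]_w (enorm (Pred M (data X t w) - b_ (th t w)) ^+ 2) <= sigma_max ^+ 2 / b%:R.
Proof.
rewrite (S_sigma HU) mulr_suml.
have -> : \int[P]_w (enorm (Pred M (data X t w) - b_ (th t w)) ^+ 2) =
    \sum_j \int[P]_w ((Pred M (data X t w) j 0 - b_ (th t w) j 0) ^+ 2).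
  rewrite -Rint_sum; last by move=> j _; apply: bmfX; exact: bmf_data_coord.
  by apply: eq_Rint => w; rewrite sqr_enormE; apply: eq_bigr => j _; rewrite !mxE.
apply: ler_sum => j _.
have mk (k : unit) S : measurable S ->
    measurable_fun setT (fun w => fine (iid (Dist M (b_ (th t w))) b S)).
  exact: (measurable_iid_kernel HS HB HD HG HC HbB (measurable_theta t) (Tth t)).
have rd : cond_indep_draws P (Fpast t) (fun _ : unit => data X t)
    (fun _ w => iid (Dist M (b_ (th t w))) b) by move=> A S FA mS; have := run_data HR FA mS.
have := @cond_noise R _ _ P _ (sFp t) unit _ _ (fun _ => data X t)
  (fun _ w => iid (Dist M (b_ (th t w))) b) (fun _ => mdata t) mk
  rd (fun _ _ => 1) (fun _ w => b_ (th t w) j 0) (fun s => Pred M s j 0)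
  (sigma_j j ^+ 2 / b%:R) (fun _ => bmf_cst 1)
  (fun _ => bwrt_beta j (sFp t) (th_past t) (Tth t)) (bmf_Pred b j)
  (fun _ w => Pred_mean j (Tth t w) bb) (fun _ w => Pred_variance j (Tth t w) bb).
have -> : \int[P]_w ((\sum_(k : unit) 1 * (Pred M (data X t w) j 0 - b_ (th t w) j 0)) ^+ 2) =
    \int[P]_w ((Pred M (data X t w) j 0 - b_ (th t w) j 0) ^+ 2).
  by apply: eq_Rint => w; rewrite sumr_const card_unit mul1r.
have -> : \int[P]_w (\sum_(k : unit) (1 : R) ^+ 2) = 1.
  by rewrite -[RHS](Rint_cst P); apply: eq_Rint => w; rewrite sumr_const card_unit expr1n.
by rewrite mulr1.
Qed.

Let K := n%:R / b_sp%:R : R.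
Let i2 := (2 * delta)^-1.

(** Weight of the dataset k in column l of the estimate. It depends on the directions only, hence is
    known given [Fdir]. *)
Let cpm t l (k : 'I_b_sp * bool) w : R := K * i2 * (if k.2 then 1 else -1) * dir X t k.1 w l 0.
Let bpm t (k : 'I_b_sp * bool) w := b_ (perturb delta (th t w) (dir X t k.1 w) k.2).

Let jac_noise t j l w := \sum_k cpm t l k w * (Pred M (data_pm X t k w) j 0 - bpm t k w j 0).
Let jac_avg t j l w := K * \sum_i (sp_sample j l (th t w, dir X t i w)
   - \int[nu]_u sp_sample j l (th t w, u)).
Let jac_bias t j l w := n%:R * \int[nu]_u sp_sample j l (th t w, u) - jac b_ (th t w) j l.
Let J t w := jac_est delta (fun k => Pred M (data_pm X t k w)) (fun i => dir X t i w).

Let jac_est_split t j l w :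
  J t w j l - jac b_ (th t w) j l = jac_noise t j l w + jac_avg t j l w + jac_bias t j l w.
Proof.
rewrite /jac_bias addrA; congr (_ - _).
have -> : jac_avg t j l w = K * (\sum_i sp_sample j l (th t w, dir X t i w))
    - n%:R * \int[nu]_u sp_sample j l (th t w, u).
  rewrite /jac_avg sumrB mulrBr sumr_const card_ord -[_ *+ b_sp]mulr_natl mulrA.
  by rewrite /K divfK// pnatr_eq0 -lt0n.
rewrite [jac_noise _ _ _ _ + _]addrA subrK /jac_noise.
have -> : \sum_k cpm t l k w * (Pred M (data_pm X t k w) j 0 - bpm t k w j 0) =
    \sum_i \sum_s cpm t l (i, s) w * (Pred M (data_pm X t (i, s) w) j 0 - bpm t (i, s) w j 0).
  by rewrite pair_bigA; apply: eq_bigr => -[i s] _.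
rewrite mulr_sumr -big_split/= /J /jac_est !mxE summxE mulr_sumr.
apply: eq_bigr => i _; rewrite big_bool/= sp_sampleE//; last exact: theta_in.
rewrite !mxE big_ord1 !mxE /cpm/= /bpm /perturb/= /central_diff -/i2 -/K; ring.
Qed.

Let bwrt_cpm t l k : bwrt (Fdir t) (cpm t l k).
Proof.
have bd : bwrt (Fdir t) (fun w => dir X t k.1 w l 0).
  split; last by exists 1 => w; exact: sphere_coord_le.
  by apply: measurable_fun_coord; exact/(wrtP _ (sFr t)).
exact: (bmfM (bmf_cst (K * i2 * (if k.2 then 1 else -1))) bd).
Qed.

Let bwrt_bpm t k j : bwrt (Fdir t) (fun w => bpm t k w j 0).
Proof.
apply: bwrt_beta => //; first exact: wrt_perturb.
by move=> w; apply: perturb_in => //; exact: theta_in.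
Qed.

Let bmf_noise t j l : bmf (jac_noise t j l).
Proof.
apply: bmf_sum => k _; apply: bmfM; first exact: (@bwrt_bmf R _ _ _ (sFr t) _ (bwrt_cpm t l k)).
apply: bmfB; first exact: bmf_comp (mpm t k) (bmf_Pred b_min j).
exact: (@bwrt_bmf R _ _ _ (sFr t) _ (bwrt_bpm t k j)).
Qed.

Let bmf_sample t j l i : bmf (fun w => sp_sample j l (th t w, dir X t i w)).
Proof.
have mp : measurable_fun setT (fun w => (th t w, dir X t i w)).
  by apply: measurable_fun_pair => //; exact: measurable_theta.
exact: bmf_comp mp (bmf_sp_sample j l).
Qed.

(** The kernel of the directions is the constant [nu], and the iterate is known given [Fdata];
    conditional draws become plain independence. *)
Let P_dir t i A S : measurable A -> measurable S ->
  P (th t @^-1` A `&` dir X t i @^-1` S) = (P (th t @^-1` A) * nu S)%E.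
Proof.
move=> mA mS; pose S0 i' : set 'cV[R]_n := if i' == i then S else setT.
have FA : Fdata t (th t @^-1` A) by exact: th_data.
have := run_dir HR FA (_ : forall i', measurable (S0 i')).
have mS0 i' : measurable (S0 i') by rewrite /S0; case: ifP.
move=> /(_ mS0).
have -> : \bigcap_i' (dir X t i' @^-1` S0 i') = dir X t i @^-1` S.
  apply/seteqP; split => w /=; first by move=> /(_ i Logic.I); rewrite /S0 eqxx.
  by move=> h i' _; rewrite /S0; case: eqP => // ->.
move=> ->.
have -> : \prod_i' fine (nu (S0 i')) = fine (nu S).
  rewrite (bigD1 i)//= {1}/S0 eqxx big1 ?mulr1// => i' /negbTE ii.
  by rewrite /S0 ii [X in fine X](_ : _ = 1%E)//; exact: probability_setT.
rewrite integral_cst//; last by have [_] := sFd t; apply.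
by rewrite fineK ?fin_num_measure// muleC.
Qed.

Let P_dir2 t i i' A S S' : i != i' -> measurable A -> measurable S -> measurable S' ->
  P (th t @^-1` A `&` dir X t i @^-1` S `&` dir X t i' @^-1` S') =
  (P (th t @^-1` A `&` dir X t i @^-1` S) * nu S')%E.
Proof.
move=> ii mA mS mS'; rewrite P_dir//.
pose S0 k : set 'cV[R]_n := if k == i then S else if k == i' then S' else setT.
have FA : Fdata t (th t @^-1` A) by exact: th_data.
have mS0 k : measurable (S0 k) by rewrite /S0; case: ifP => // _; case: ifP.
have := run_dir HR FA mS0.
have -> : \bigcap_k (dir X t k @^-1` S0 k) = dir X t i @^-1` S `&` dir X t i' @^-1` S'.
  apply/seteqP; split => w /=.
    move=> h; split; first by have := h i Logic.I; rewrite /S0 eqxx.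
    by have := h i' Logic.I; rewrite /S0 eq_sym (negbTE ii) eqxx.
  by move=> [h h'] k _; rewrite /S0; case: eqP => [->//|_]; case: eqP => // ->.
rewrite setIA => ->.
have -> : \prod_k fine (nu (S0 k)) = fine (nu S) * fine (nu S').
  rewrite (bigD1 i)//= (bigD1 i')/=; last by rewrite eq_sym.
  rewrite {1 2}/S0 eqxx eq_sym (negbTE ii) eqxx big1 ?mulr1// => k /andP[/negbTE h /negbTE h'].
  by rewrite /S0 h h' [X in fine X](_ : _ = 1%E)//; exact: probability_setT.
rewrite integral_cst//; last by have [_] := sFd t; apply.
by rewrite EFinM !fineK ?fin_num_measure// muleC muleA.
Qed.

Let i0 : 'I_b_sp := Ordinal bsp0.

Let bmf_mean t j l : bmf (fun w => \int[nu]_u sp_sample j l (th t w, u)).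
Proof.
have [bm _] := Rint_indep (measurable_theta t) (mdir t i0) (@P_dir t i0) (bmf_sp_sample j l).
exact: bmf_comp (measurable_theta t) bm.
Qed.

Let bmf_avg t j l : bmf (jac_avg t j l).
Proof.
apply: bmfM; first exact: bmf_cst.
by apply: bmf_sum => i _; apply: bmfB.
Qed.

Let bias_sum_le t w : \sum_j \sum_l jac_bias t j l w ^+ 2 <= L_b_H c ^+ 2 * delta ^+ 4.
Proof.
rewrite (S_L_b_H HU) sqr_sqrtr ?sumr_ge0// => [|j _]; last exact: sqr_ge0.
rewrite mulr_suml; apply: ler_sum => j _; apply: sp_bias_le; exact: theta_in.
Qed.

Let jac_entry_bmf t j l : bmf (fun w => jac b_ (th t w) j l).
Proof.
split.
  have -> : (fun w => jac b_ (th t w) j l) =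
     (fun x => jac b_ x j l) \o th t by [].
  apply: measurableT_comp (measurable_theta t); apply: continuous_measurable_cV => x.
  rewrite (_ : (fun x => _) = (fun x => ('D_(ebasis l) b_ x) j 0)); last first.
    by apply/funext => y; rewrite mxE.
  apply: differentiable_continuous; apply: differentiable_entry.
  by have [_ /(_ (ebasis l))[+ _]] := Hb; apply.
exists (L_b_Lip c) => w.
have := jac_beta_le HC HT Hb delta0 (ebasis l) (theta_in t w).
rewrite enorm_ebasis mulr1; apply: le_trans; rewrite -colE.
by apply: le_trans (normr_coord_le (col l (jac b_ (th t w))) j); rewrite [col _ _ _ _]mxE.
Qed.

Let jac_bias_bmf t j l : bmf (jac_bias t j l).
Proof.
apply: (bmfB _ (jac_entry_bmf t j l)).
exact: (bmfM (bmf_cst n%:R) (bmf_mean t j l)).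
Qed.

Lemma bmf_jac_error t : bmf (fun w => frob2 (J t w - jac b_ (th t w))).
Proof.
apply: bmf_sum => j _; apply: bmf_sum => l _; apply: bmfX.
rewrite (_ : (fun w => _) = (fun w => jac_noise t j l w + jac_avg t j l w + jac_bias t j l w)).
  exact: (bmfD (bmfD (bmf_noise t j l) (bmf_avg t j l)) (jac_bias_bmf t j l)).
by apply/funext => w; rewrite -jac_est_split !mxE.
Qed.

(** [cond_noise] given the directions. Summing the squared weights over the columns uses |u| = 1, so
    only the number 2 b_sp of datasets appears, without an additional factor n. *)
Let noise_le t :
  \sum_j \sum_l \int[P]_w (jac_noise t j l w ^+ 2)
    <= sigma_max ^+ 2 / b_min%:R * (K ^+ 2 * i2 ^+ 2 * (2 * b_sp%:R)).
Proof.
rewrite (S_sigma HU) !mulr_suml; apply: ler_sum => j _.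
have mk (k : 'I_b_sp * bool) S : measurable S -> measurable_fun setT (fun w =>
    fine (iid (Dist M (b_ (perturb delta (th t w) (dir X t k.1 w) k.2))) b_min S)).
  move=> mS; apply: (measurable_iid_kernel HS HB HD HG HC HbB _ _ mS).
    by apply: (wrt_measurable (sFr t)); exact: wrt_perturb.
  by move=> w; apply: perturb_in => //; exact: theta_in.
have hp (k : 'I_b_sp * bool) w : Theta M (perturb delta (th t w) (dir X t k.1 w) k.2).
  by apply: perturb_in => //; exact: theta_in.
have h l : \int[P]_w (jac_noise t j l w ^+ 2) <=
    sigma_j j ^+ 2 / b_min%:R * \int[P]_w (\sum_k cpm t l k w ^+ 2).
  have rd : cond_indep_draws P (Fdir t) (data_pm X t) (fun k w => iid (Dist M (b_
      (perturb delta (th t w) (dir X t k.1 w) k.2))) b_min) by move=> A S FA mS; have := run_data_pm HR FA mS.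
  have := (@cond_noise R _ _ P _ (sFr t) _ _ _ (data_pm X t)
    (fun k w => iid (Dist M (b_ (perturb delta (th t w) (dir X t k.1 w) k.2))) b_min) (mpm t) mk rd
    (cpm t l) (fun k w => bpm t k w j 0) (fun s => Pred M s j 0) _ (bwrt_cpm t l)
    (fun k => bwrt_bpm t k j) (bmf_Pred b_min j)
    (fun k w => Pred_mean j (hp k w) (leqnn _)) (fun k w => Pred_variance j (hp k w) (leqnn _))).
  exact.
apply: le_trans (ler_sum _ (fun l _ => h l)) _.
rewrite -mulr_sumr ler_wpM2l ?divr_ge0 ?sqr_ge0//.
have bc l : bmf (fun w => \sum_k cpm t l k w ^+ 2).
  by apply: bmf_sum => k _; apply: bmfX; exact: (@bwrt_bmf R _ _ _ (sFr t) _ (bwrt_cpm t l k)).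
rewrite -Rint_sum//.
rewrite -[leRHS](Rint_cst P) le_eqVlt; apply/orP; left; apply/eqP; apply: eq_Rint => w.
rewrite exchange_big/=.
transitivity (\sum_(k : 'I_b_sp * bool) K ^+ 2 * i2 ^+ 2).
  apply: eq_bigr => k _; rewrite -[RHS]mulr1 -(sphere_sqr_sum (sdir t k.1 w)) mulr_sumr.
  by apply: eq_bigr => l _; rewrite /cpm; case: k.2; ring.
rewrite sumr_const card_prod card_ord card_bool -[LHS]mulr_natr natrM; ring.
Qed.

Let avg_le t : \sum_j \sum_l \int[P]_w (jac_avg t j l w ^+ 2) <= K ^+ 2 * (b_sp%:R * L_b_Lip c ^+ 2).
Proof.
have h j l : \int[P]_w (jac_avg t j l w ^+ 2) <=
    K ^+ 2 * \sum_i \int[P]_w (sp_sample j l (th t w, dir X t i w) ^+ 2).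
  have -> : \int[P]_w (jac_avg t j l w ^+ 2) = K ^+ 2 * \int[P]_w ((\sum_i
      (sp_sample j l (th t w, dir X t i w) - \int[nu]_u sp_sample j l (th t w, u))) ^+ 2).
    rewrite -RintZ; first by apply: eq_Rint => w; rewrite /jac_avg exprMn.
    by apply: bmfX; apply: bmf_sum => i _; apply: bmfB.
  rewrite ler_wpM2l ?sqr_ge0//.
  exact: (Rint_sqr_empirical (measurable_theta t) (mdir t) (@P_dir t) (@P_dir2 t) (bmf_sp_sample j l) i0).
apply: le_trans (ler_sum _ (fun j _ => ler_sum _ (fun l _ => h j l))) _.
under eq_bigr do rewrite -mulr_sumr.
rewrite -mulr_sumr ler_wpM2l ?sqr_ge0//.
under eq_bigr do rewrite exchange_big.
rewrite exchange_big/=.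
rewrite mulr_natl -[X in _ <= _ *+ X]card_ord -sumr_const; apply: ler_sum => i _.
have -> : \sum_j \sum_l \int[P]_w (sp_sample j l (th t w, dir X t i w) ^+ 2) =
    \int[P]_w (\sum_j \sum_l sp_sample j l (th t w, dir X t i w) ^+ 2).
  rewrite Rint_sum; last by move=> j _; apply: bmf_sum => l _; apply: bmfX.
  by apply: eq_bigr => j _; rewrite Rint_sum// => l _; apply: bmfX.
rewrite -[leRHS](Rint_cst P); apply: le_Rint.
- by apply: bmf_sum => j _; apply: bmf_sum => l _; apply: bmfX.
- exact: bmf_cst.
- by move=> w; apply: sp_sample_sqr_le => //; exact: theta_in.
Qed.

Lemma jac_error_le t : \int[P]_w frob2 (J t w - jac b_ (th t w)) <=
  3 * (sigma_max ^+ 2 / b_min%:R * (K ^+ 2 * i2 ^+ 2 * (2 * b_sp%:R))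
       + K ^+ 2 * (b_sp%:R * L_b_Lip c ^+ 2) + L_b_H c ^+ 2 * delta ^+ 4).
Proof.
pose SS (f : 'I_m -> 'I_n -> Omega -> R) w := \sum_j \sum_l f j l w ^+ 2.
have bSS f : (forall j l, bmf (f j l)) -> bmf (SS f).
  by move=> bf; apply: bmf_sum => j _; apply: bmf_sum => l _; apply: bmfX.
have iSS f : (forall j l, bmf (f j l)) -> \int[P]_w SS f w = \sum_j \sum_l \int[P]_w (f j l w ^+ 2).
  move=> bf; rewrite Rint_sum; last by move=> j _; apply: bmf_sum => l _; apply: bmfX.
  by apply: eq_bigr => j _; rewrite Rint_sum// => l _; apply: bmfX.
have b1 := bSS _ (bmf_noise t); have b2 := bSS _ (bmf_avg t); have b3 := bSS _ (jac_bias_bmf t).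
apply: (@le_trans _ _ (\int[P]_w (3 * (SS (jac_noise t) w + SS (jac_avg t) w + SS (jac_bias t) w)))).
  apply: le_Rint; first exact: bmf_jac_error.
    by apply: bmfM; [exact: bmf_cst|apply: bmfD => //; exact: bmfD].
  move=> w; rewrite /SS -!big_split/= mulr_sumr; apply: ler_sum => j _.
  rewrite -!big_split/= mulr_sumr; apply: ler_sum => l _.
  have -> : (J t w - jac b_ (th t w)) j l = jac_noise t j l w + jac_avg t j l w + jac_bias t j l w.
    by rewrite -jac_est_split !mxE.
  move: (jac_noise t j l w) (jac_avg t j l w) (jac_bias t j l w) => x y z.
  have := sqr_ge0 (x - y); have := sqr_ge0 (y - z); have := sqr_ge0 (x - z); nra.
rewrite RintZ; last by apply: bmfD => //; exact: bmfD.
rewrite RintD//; last exact: bmfD.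
rewrite RintD// !iSS//; rewrite ler_wpM2l//; apply: lerD; first by apply: lerD; [exact: noise_le|exact: avg_le].
rewrite -iSS// -[leRHS](Rint_cst P); apply: le_Rint => //; first exact: bmf_cst.
by move=> w; exact: bias_sum_le.
Qed.

(** Each summand maps y to a multiple of a difference of two estimates in [Bset]. Thus even the
    noisy Jacobian may be paired with the centered loss. *)
Lemma jac_est_orth (v : 'cV[R]_m) (bh : 'I_b_sp * bool -> 'cV[R]_m) (u : 'I_b_sp -> 'cV[R]_n) y :
  (forall k, Bset M (bh k)) ->
  (forall b1 b2, Bset M b1 -> Bset M b2 -> dot v (b1 - b2) = 0) ->
  dot v (jac_est delta bh u *m y) = 0.
Proof.
move=> hB hv; rewrite /jac_est -scalemxAl dotZr mulmx_suml dotC dot_suml big1 ?mulr0// => i _.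
rewrite -mulmxA.
have -> : ((2 * delta)^-1 *: (bh (i, true) - bh (i, false))) *m ((u i)^T *m y) =
    (((u i)^T *m y) 0 0 * (2 * delta)^-1) *: (bh (i, true) - bh (i, false)).
  by apply/matrixP => k l; rewrite ord1 !mxE big_ord1 !mxE; ring.
by rewrite dotZl dotC hv// mulr0.
Qed.

Let grad_error t w :=
  grad_est M (th t w) (Pred M (data X t w)) (J t w) - perf_grad M (th t w).

Let C1a := 3 * (L_l_Lip c ^+ 2 * I_max c + (L_b_Lip c * L_G_b c) ^+ 2).
(** A bounded measurable majorant of the squared gradient error, integrated in its place so that
    measurability of the error itself is never at issue. *)
Let error_ub t w := C1a * enorm (Pred M (data X t w) - b_ (th t w)) ^+ 2
  + 3 * (M_l c * I_max c) * frob2 (J t w - jac b_ (th t w)).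

Let bmf_error_ub t : bmf (error_ub t).
Proof.
apply: bmfD; first exact: (bmfM (bmf_cst C1a) (bmf_data_error t)).
exact: (bmfM (bmf_cst (3 * (M_l c * I_max c))) (bmf_jac_error t)).
Qed.

(** The error of the estimated parameter enters through the expected gradient and through G, which
    accounts for the two terms of [C1a]; the Jacobian error meets G at the estimated parameter. The
    factor 3 comes from squaring a sum of three terms. *)
Lemma grad_error_le t w : enorm (grad_error t w) ^+ 2 <= error_ub t w.
Proof.
rewrite /grad_error /error_ub; set x := th t w; set bh := Pred M (data X t w); set Jt := J t w.
have Tx := theta_in t w; have Tx' := Theta_spW Tx; have Bx := HbB Tx'.
rewrite -/x in Tx Tx' Bx.
have Bh : Bset M bh by exact: Pred_Bset.
have [[Ll0 Ls0 Lb0] [Lbs0 _ LG0] [LGt0 Ml0 I0]] := cst_ge0 HC.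
set D := enorm (bh - b_ x); have D0 : 0 <= D by exact: enorm_ge0.
set r := Num.sqrt (frob2 (Jt - jac b_ x)); have r0 : 0 <= r by exact: sqrtr_ge0.
have A1 := expect_grad_loss_lipschitz HS HB HD HG HC Bx Bh Tx'; rewrite -/D in A1.
have A2 : enorm ((Jt - jac b_ x)^T *m Gvec M x bh) <= Num.sqrt (M_l c * I_max c) * r.
  apply: (enorm_mulmx_Gvec HS HD HG HC) => //; last by move=> y; exact: enorm_mulmx_frob.
  move=> y; rewrite (score_mean_dot HS HD HG HC)// mulmxBl dotBr.
  have hv b1 b2 : Bset M b1 -> Bset M b2 ->
      dot (expect (Dist M bh) (fun z => score M z bh)) (b1 - b2) = 0.
    by move=> B1 B2; rewrite -(score_mean_dot HS HD HG HC)//; exact: (score_mean_diff HS HB HD HG HC).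
  have e1 : dot (expect (Dist M bh) (fun z => score M z bh)) (Jt *m y) = 0.
    by apply: jac_est_orth => // k; exact: Pred_Bset.
  have e2 : dot (expect (Dist M bh) (fun z => score M z bh)) (jac b_ x *m y) = 0.
    rewrite -(score_mean_dot HS HD HG HC)//.
    exact: (score_mean_jac HS HB HD HG HC HT Hb HbB delta0).
  by rewrite e1 e2 subrr.
have A3 : enorm ((jac b_ x)^T *m (Gvec M x bh - Gvec M x (b_ x))) <= L_b_Lip c * L_G_b c * D.
  apply: enorm_dual => [|v]; first by rewrite !mulr_ge0.
  rewrite dotC -dot_mulmx; apply: le_trans (dot_le _ _) _.
  apply: le_trans (ler_wpM2r (enorm_ge0 _) (jac_beta_le HC HT Hb delta0 _ Tx)) _.
  rewrite mulrAC; apply: ler_wpM2r; first exact: enorm_ge0.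
  rewrite -mulrA; apply: ler_wpM2l => //.
  by have := cst_G HC Tx' Tx' Bh Bx; rewrite subrr enorm0 mulr0 addr0.
rewrite /grad_est /perf_grad.
set E1 := expect _ _ in A1 *; set E3 := expect _ _ in A1 *.
rewrite (split_difference E1 E3 E3 Jt (jac b_ x)) subrr addr0.
have := le_trans (enormD _ _) (lerD (le_trans (enormD _ _) (lerD A1 A2)) A3).
move: (enorm _) (enorm_ge0 (E1 - E3 + (Jt - jac b_ x)^T *m Gvec M x bh +
   (jac b_ x)^T *m (Gvec M x bh - Gvec M x (b_ x)))) => e e0 he.
have rr : r ^+ 2 = frob2 (Jt - jac b_ x) by rewrite sqr_sqrtr// frob2_ge0.
have Mr : Num.sqrt (M_l c * I_max c) ^+ 2 = M_l c * I_max c by rewrite sqr_sqrtr// mulr_ge0.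
have Ir : Num.sqrt (I_max c) ^+ 2 = I_max c by rewrite sqr_sqrtr.
rewrite -rr -Mr; move: (Num.sqrt (M_l c * I_max c)) he => q he.
rewrite /C1a -Ir; move: (Num.sqrt (I_max c)) he => s he.
set a1 := L_l_Lip c * s * D in he; set a2 := q * r in he; set a3 := L_b_Lip c * L_G_b c * D in he.
have -> : 3 * (L_l_Lip c ^+ 2 * s ^+ 2 + (L_b_Lip c * L_G_b c) ^+ 2) * D ^+ 2
    + 3 * q ^+ 2 * r ^+ 2 = 3 * (a1 ^+ 2 + a2 ^+ 2 + a3 ^+ 2).
  by rewrite /a1 /a2 /a3; ring.
apply: (@le_trans _ _ ((a1 + a2 + a3) ^+ 2)).
  by apply: lerXn2r; rewrite ?nnegrE// (le_trans e0).
move: a1 a2 a3 {he} => x1 x2 x3.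
have := sqr_ge0 (x1 - x2); have := sqr_ge0 (x2 - x3); have := sqr_ge0 (x1 - x3); nra.
Qed.

(** The descent inequality in both directions. It makes [perf_loss] continuous on [Theta_sp], hence
    measurable along the iterates, and bounded there. *)
Lemma perf_loss_diff_le x y : Th x -> Th y ->
  `|perf_loss M y - perf_loss M x| <=
    (enorm (perf_grad M x) + 2 * L_L_sm c * enorm (y - x)) * enorm (y - x).
Proof.
move=> Tx Ty.
have D1 := perf_loss_descent HS HB HD HG HC HT Hb HbB delta0 Tx Ty.
have D2 := perf_loss_descent HS HB HD HG HC HT Hb HbB delta0 Ty Tx.
rewrite (grad_perf_loss HS HB HD HG HC HT Hb HbB delta0 Tx) in D1.
rewrite (grad_perf_loss HS HB HD HG HC HT Hb HbB delta0 Ty) in D2.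
have L0 := perf_grad_lipschitz HS HB HD HG HC HT Hb HbB delta0 Ty Tx.
rewrite (enormBC x y) in D2; rewrite -[x - y]opprB dotNr in D2.
have [[Ll0 Ls0 Lb0] [Lbs0 _ LG0] [LGt0 Ml0 I0]] := cst_ge0 HC.
have Lsm0 : 0 <= L_L_sm c by rewrite /L_L_sm !addr_ge0 ?mulr_ge0 ?addr_ge0 ?mulr_ge0 ?sqrtr_ge0.
have N0 := enorm_ge0 (y - x).
move: L0 D1 D2; generalize (perf_grad M x) (perf_grad M y) => gX gY L0 D1 D2.
have h1 := dot_normr_le gX (y - x).
have h2 := dot_normr_le (gY - gX) (y - x); rewrite dotBl in h2.
have h3 := ler_wpM2r N0 L0.
move: D1 D2 h1 h2 h3; set N := enorm (y - x) in N0 *.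
move: (dot gX _) (dot gY _) (enorm gX) => gx gy e.
move: (enorm _) => e'; move: (perf_loss M x) (perf_loss M y) => lx ly.
rewrite !ler_norml => D1 D2 /andP[h1 h1'] /andP[h2 h2'] h3.
have LN : 0 <= L_L_sm c * N ^+ 2 by rewrite mulr_ge0// sqr_ge0.
apply/andP; split; lra.
Qed.

Lemma bmf_perf_loss t : bmf (fun w => perf_loss M (th t w)).
Proof.
have [[Ll0 Ls0 Lb0] [Lbs0 _ LG0] [LGt0 Ml0 I0]] := cst_ge0 HC.
have Lsm0 : 0 <= L_L_sm c by rewrite /L_L_sm !addr_ge0 ?mulr_ge0 ?addr_ge0 ?mulr_ge0 ?sqrtr_ge0.
split.
  apply: (measurable_fun_factor (measurable_theta t)) => w e e0.
  set A := enorm (perf_grad M (th t w)) + 2 * L_L_sm c.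
  have A0 : 0 <= A by rewrite addr_ge0 ?enorm_ge0// mulr_ge0.
  exists (Num.min 1 (e / (1 + A))).
    by rewrite lt_min ltr01/= divr_gt0// ltr_wpDr.
  move=> w'; rewrite lt_min enormBC => /andP[h1 h2].
  have N0 := enorm_ge0 (th t w' - th t w).
  rewrite distrC; apply: le_lt_trans (perf_loss_diff_le (theta_in t w) (theta_in t w')) _.
  apply: (@le_lt_trans _ _ (A * enorm (th t w' - th t w))).
    by rewrite ler_wpM2r// /A lerD2l ler_piMr ?mulr_ge0// ltW.
  move: h2; rewrite ltr_pdivlMr ?ltr_wpDr// => h2; apply: le_lt_trans h2.
  by rewrite mulrC ler_wpM2l// lerDr.
have [_ _ _ /compact_bounded[C [_ hC]]] := A_Theta HA.
set D := n%:R * ((1 + `|C|) + (1 + `|C|)).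
have nT x : Theta M x -> `|x| <= 1 + `|C|.
  by move=> Tx; apply: (hC (1 + `|C|)) => //; rewrite (le_lt_trans (ler_norm C))// ltrDr.
exists (`|perf_loss M theta0| + (enorm (perf_grad M theta0) + 2 * L_L_sm c * D) * D) => w.
rewrite -[perf_loss M (th t w)](subrK (perf_loss M theta0)) addrC.
apply: le_trans (ler_normD _ _) _; apply: lerD => //.
apply: le_trans (perf_loss_diff_le Th0 (theta_in t w)) _.
have hD : enorm (th t w - theta0) <= D.
  apply: le_trans (enorm_le_normr _) _; rewrite ler_wpM2l//.
  apply: le_trans (ler_normB _ _) _; apply: lerD; apply: nT => //.
  exact: Theta_spW Th0.
apply: ler_pM => //; rewrite ?enorm_ge0// ?addr_ge0 ?mulr_ge0 ?enorm_ge0//.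
by rewrite lerD2l ler_wpM2l// mulr_ge0.
Qed.

Hypotheses (alpha0 : 0 < alpha) (alphaL : alpha * L_L_sm c <= 1).

(** The squared step length left over by [inexact_proj_step] pays for the quadratic term of the
    descent inequality, as alpha times the smoothness constant is at most 1. *)
Lemma gradmap_le t w : enorm (gradmap M Th alpha (th t w)) ^+ 2 <=
  2 / alpha * (perf_loss M (th t w) - perf_loss M (th t.+1 w)) + error_ub t w.
Proof.
have Tx := theta_in t w; have Ty := theta_in t.+1 w.
have [_ cT _ kT] := A_Theta HA.
have gE := grad_perf_loss HS HB HD HG HC HT Hb HbB delta0 Tx.
have st : th t.+1 w = euclid_proj Th (th t w - alpha *:
    (grad (perf_loss M) (th t w) + grad_error t w)).
  by rewrite (run_step HR) gE /grad_error subrKC.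
have h := inexact_proj_step (S_sp HU) (Theta_sp_compact (delta := delta) cT kT)
  (Theta_sp_convex HT (delta := delta)) Tx alpha0 (erefl _) st.
have dsc := perf_loss_descent HS HB HD HG HC HT Hb HbB delta0 Tx Ty.
have ge := grad_error_le t w.
rewrite /gradmap enormZ gtr0_norm ?invr_gt0// exprMn.
move: h dsc ge; move: (enorm (grad_error t w)) (error_ub t w) => e eu.
move: (dot _ _) (enorm (th t.+1 w - th t w)) (enorm (th t w - _)) => dd N G.
move: (perf_loss M (th t w)) (perf_loss M (th t.+1 w)) => lx ly h dsc ge.
rewrite exprVn ler_pdivrMl ?exprn_gt0//.
have -> : alpha ^+ 2 * (2 / alpha * (lx - ly) + eu) = 2 * alpha * (lx - ly) + alpha ^+ 2 * eu.
  by field; rewrite gt_eqF.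
have h1 := ler_wpM2l (ltW (mulr_gt0 (ltr0n R 2) alpha0)) dsc.
have h2 := ler_wpM2r (sqr_ge0 N) alphaL.
have h3 := ler_wpM2l (sqr_ge0 alpha) ge.
nra.
Qed.

(* No measurability: the integral of a nonnegative function is defined as a supremum
over the simple functions below it. *)
Let ge0_le_integral_lower (f g : Omega -> \bar R) : (forall w, 0 <= f w)%E ->
  (forall w, f w <= g w)%E -> (\int[P]_w f w <= \int[P]_w g w)%E.
Proof.
move=> f0 fg; rewrite !ge0_integralTE//; last by move=> w; exact: le_trans (fg w).
apply: ereal_sup_le => _ [h /= hf <-]; exists h => //= w.
exact: le_trans (hf w) (fg w).
Qed.

Let EB := C1a * (sigma_max ^+ 2 / b%:R) + 3 * (M_l c * I_max c) *
  (3 * (sigma_max ^+ 2 / b_min%:R * (K ^+ 2 * i2 ^+ 2 * (2 * b_sp%:R))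
       + K ^+ 2 * (b_sp%:R * L_b_Lip c ^+ 2) + L_b_H c ^+ 2 * delta ^+ 4)).

Let error_ub_le t : \int[P]_w error_ub t w <= EB.
Proof.
have [[Ll0 Ls0 Lb0] [Lbs0 _ LG0] [LGt0 Ml0 I0]] := cst_ge0 HC.
rewrite RintD; last 2 first.
- exact: (bmfM (bmf_cst C1a) (bmf_data_error t)).
- exact: (bmfM (bmf_cst (3 * (M_l c * I_max c))) (bmf_jac_error t)).
rewrite (RintZ _ _ (bmf_data_error t)) (RintZ _ _ (bmf_jac_error t)).
apply: lerD; apply: ler_wpM2l.
- by rewrite /C1a mulr_ge0// addr_ge0// ?sqr_ge0// mulr_ge0// sqr_ge0.
- exact: data_error_le.
- by rewrite !mulr_ge0.
- exact: jac_error_le.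
Qed.

Lemma sum_gradmap_le T :
  (\sum_(t < T) \int[P]_w (enorm (gradmap M Th alpha (th t w)) ^+ 2)%:E <=
   (2 / alpha * (perf_loss M theta0 - perf_loss_inf M) + T%:R * EB)%:E)%E.
Proof.
pose l t := \int[P]_w perf_loss M (th t w).
have hl t : (\int[P]_w (enorm (gradmap M Th alpha (th t w)) ^+ 2)%:E <=
    (2 / alpha * (l t - l t.+1) + EB)%:E)%E.
  have bd : bmf (fun w => perf_loss M (th t w) - perf_loss M (th t.+1 w)).
    by apply: bmfB; exact: bmf_perf_loss.
  have bd2 : bmf (fun w => 2 / alpha * (perf_loss M (th t w) - perf_loss M (th t.+1 w))).
    exact: (bmfM (bmf_cst (2 / alpha)) bd).
  apply: (@le_trans _ _ (\int[P]_w (2 / alpha *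
      (perf_loss M (th t w) - perf_loss M (th t.+1 w)) + error_ub t w)%:E)%E).
    apply: ge0_le_integral_lower => w; rewrite lee_fin ?sqr_ge0//.
    exact: gradmap_le.
  rewrite -EFin_Rint; last exact: (bmfD bd2 (bmf_error_ub t)).
  rewrite lee_fin RintD// lerD//.
  rewrite (RintZ _ _ bd) (RintB _ (bmf_perf_loss t) (bmf_perf_loss t.+1)).
  exact: lexx.
apply: (@le_trans _ _ (\sum_(t < T) (2 / alpha * (l t - l t.+1) + EB)%:E)%E).
  by apply: lee_sum => t _; exact: hl.
rewrite sumEFin lee_fin big_split/= sumr_const card_ord -[EB *+ T]mulr_natl lerD2r -mulr_sumr.
apply: ler_wpM2l; first by rewrite divr_ge0// ltW.
rewrite sum_decrease.
apply: lerB.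
  rewrite /l -[leRHS](Rint_cst P) le_eqVlt; apply/orP; left; apply/eqP.
  by apply: eq_Rint => w; rewrite (run_init HR).
rewrite -[leLHS](Rint_cst P); apply: le_Rint; [exact: bmf_cst|exact: bmf_perf_loss|move=> w].
by apply: inf_lbound; [exact: cst_inf HC|exists (th T w)].
Qed.

End Run.

End Iterates.

(** * Rates *)

Section Rates.
Context {R : realType}.

(** Unless k = 1, the number k - 1 is positive and, by minimality, below x. *)
Lemma smallest_pos_le (x : R) k :
  smallest_pos (fun k' => x <= k'%:R) k -> 0 <= x -> k%:R <= 1 + x.
Proof.
case: k => [|k] [//] _ _ h x0; rewrite -natr1 addrC lerD2l.
case: k h => [//|k] h; case: (leP x k.+1%:R) => [xk|/ltW//].
by have := h _ (ltn0Sn k) xk; rewrite ltnn.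
Qed.

Lemma smallest_pos_abs_le (x : R) k :
  smallest_pos (fun k' => x <= k'%:R) k -> k%:R <= 1 + `|x|.
Proof.
move=> h; have [x0|x0] := leP 0 x; first by rewrite ger0_norm//; exact: smallest_pos_le.
have [_ _ /(_ 1%N)] := h => /(_ isT) k1.
apply: (@le_trans _ _ 1); last by rewrite lerDl.
by rewrite -[1]/(1%:R) ler_nat; apply: k1; rewrite (le_trans (ltW x0)).
Qed.

Lemma radius_pow6 (n b : nat) : (0 < n)%N -> (0 < b)%N ->
  (n%:R `^ (1 / 6) * b%:R `^ (- (1 / 6))) ^+ 6 = n%:R / b%:R :> R.
Proof.
move=> n0 b0; rewrite exprMn -!powR_mulrn ?powR_ge0// -!powRrM.
rewrite mulNr divfK ?pnatr_eq0// powRr1// powRN powRr1//.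
Qed.

(** With q the root of 3 C, the condition on b reads (delta^2 q)^3 <= eps^3. Taking cube roots and
    squaring gives the claim; this explains the exponent 3/2. *)
Lemma cube_rate_le (n b delta eps C : R) : 0 < delta -> 0 < eps -> 0 <= C -> 0 < b ->
  delta ^+ 6 = n / b -> n * (3 * C) `^ (3 / 2) / eps ^+ 3 <= b ->
  3 * (C * delta ^+ 4) <= eps ^+ 2.
Proof.
move=> d0 e0 C0 b0 dE; set q := Num.sqrt (3 * C).
have q0 : 0 <= q by exact: sqrtr_ge0.
have C30 : 0 <= 3 * C by rewrite mulr_ge0.
have -> : (3 * C) `^ (3 / 2) = q ^+ 3.
  have -> : q = (3 * C) `^ 2^-1 by rewrite powR12_sqrt.
  by rewrite -powR_mulrn ?powR_ge0// -powRrM; congr (_ `^ _); rewrite mulrC.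
rewrite ler_pdivrMr ?exprn_gt0// => h.
have h3 : (delta ^+ 2 * q) ^+ 3 <= eps ^+ 3.
  rewrite exprMn -exprM dE mulrAC ler_pdivrMr// mulrC [leRHS]mulrC.
  by rewrite mulrC.
have h1 : delta ^+ 2 * q <= eps.
  have qd : 0 <= delta ^+ 2 * q by rewrite mulr_ge0 ?sqr_ge0.
  by rewrite -(@ler_pXn2r _ 3)// nnegrE ltW.
have -> : 3 * (C * delta ^+ 4) = (delta ^+ 2 * q) ^+ 2.
  by rewrite exprMn sqr_sqrtr// -exprM; ring.
by apply: lerXn2r; rewrite ?nnegrE ?(ltW e0)// mulr_ge0// sqr_ge0.
Qed.

End Rates.

Section ErrorBudget.
Context {R : realType}.

Lemma error_budget (l I lb lg Ml H s bm n b delta : R) :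
  0 <= I -> 0 <= Ml -> 0 < bm -> 0 < n -> 0 < b ->
  0 < delta -> delta <= 1 -> delta ^+ 6 = n / b ->
  3 * (l ^+ 2 * I + (lb * lg) ^+ 2) * (s ^+ 2 / b) + 3 * (Ml * I) *
   (3 * (s ^+ 2 / bm * ((n / (n * b)) ^+ 2 * ((2 * delta)^-1) ^+ 2 * (2 * (n * b)))
       + (n / (n * b)) ^+ 2 * ((n * b) * lb ^+ 2) + H ^+ 2 * delta ^+ 4))
  <= 3 * (l ^+ 2 * I + (lb * lg) ^+ 2) * s ^+ 2 / b
   + (3 * Ml * I * (3 * s ^+ 2 / bm + 3 * H ^+ 2 + H ^+ 2 / 6 + 18 * lb ^+ 2)) * delta ^+ 4.
Proof.
move=> I0 Ml0 bm0 n0 b0 d0 d1 dE.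
(* Eliminating n makes the noise term exactly (s^2 / bm) delta^4 / 2 and the fluctuation lb^2
   delta^6. The coefficients of [C2'] then dominate with room to spare. *)
have nE : n = delta ^+ 6 * b by rewrite dE divfK ?gt_eqF.
have -> : s ^+ 2 / bm * ((n / (n * b)) ^+ 2 * ((2 * delta)^-1) ^+ 2 * (2 * (n * b))) =
    s ^+ 2 / bm / 2 * delta ^+ 4.
  by rewrite nE; field; rewrite !gt_eqF.
have -> : (n / (n * b)) ^+ 2 * ((n * b) * lb ^+ 2) = delta ^+ 2 * lb ^+ 2 * delta ^+ 4.
  by rewrite nE; field; rewrite !gt_eqF.
rewrite mulrA lerD2l.
have -> : 3 * Ml * I * (3 * s ^+ 2 / bm + 3 * H ^+ 2 + H ^+ 2 / 6 + 18 * lb ^+ 2) * delta ^+ 4 =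
  3 * (Ml * I) * ((3 * (s ^+ 2 / bm) + 3 * H ^+ 2 + H ^+ 2 / 6 + 18 * lb ^+ 2) * delta ^+ 4).
  by ring.
apply: ler_wpM2l; first by rewrite !mulr_ge0.
have -> : 3 * (s ^+ 2 / bm / 2 * delta ^+ 4 + delta ^+ 2 * lb ^+ 2 * delta ^+ 4 + H ^+ 2 * delta ^+ 4)
  = (3 * (s ^+ 2 / bm / 2 + delta ^+ 2 * lb ^+ 2 + H ^+ 2)) * delta ^+ 4 by ring.
apply: ler_wpM2r; first by rewrite exprn_ge0// ltW.
have x0 : 0 <= s ^+ 2 / bm by rewrite divr_ge0 ?sqr_ge0// ltW.
have d2 : delta ^+ 2 * lb ^+ 2 <= lb ^+ 2.
  by rewrite ler_piMl ?sqr_ge0// exprn_ile1// ltW.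
have := sqr_ge0 H; have := sqr_ge0 lb; move: (s ^+ 2 / bm) x0 d2 => x x0; lra.
Qed.

End ErrorBudget.

Section SampleComplexity.
Context {R : realType}.

(** Product of bounds for eps^2 T, for eps^3 b / n, and for the ratio of b + 2 n b bm to n b. The
    powers of E, an upper bound of eps, raise the terms of lower order in 1 / eps to the leading
    one. *)
Definition complexity_cst (E alpha gap : R) (bm : nat) (C1 C2 : R) : R :=
  (E ^+ 2 + 6 * `|gap| / alpha) *
  (E ^+ 3 * (2 + bm%:R) + 3 * `|C1| * E + (3 * C2) `^ (3 / 2)) * (1 + 2 * bm%:R).

Lemma sample_complexity_le (n b bm T : nat) (E eps alpha gap C1 C2 : R) :
  (0 < n)%N -> 0 < alpha -> 0 < eps -> eps <= E ->
  T%:R <= 1 + `|6 * gap / (alpha * eps ^+ 2)| ->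
  b%:R <= 1 + (bm%:R + (n%:R + (`|3 * C1 / eps ^+ 2| + n%:R * (3 * C2) `^ (3 / 2) / eps ^+ 3))) ->
  (T * (b + 2 * (n * b) * bm))%:R
    <= complexity_cst E alpha gap bm C1 C2 * n%:R ^+ 2 / eps ^+ 5.
Proof.
move=> n0 a0 e0 eE hT hb; set P := (3 * C2) `^ (3 / 2).
have P0 : 0 <= P by exact: powR_ge0.
have E0 : 0 < E by exact: lt_le_trans eE.
have N1 : 1 <= n%:R :> R by rewrite ler1n.
have N0 : 0 < n%:R :> R by rewrite ltr0n.
(* These ratios are inserted into the lower-order terms to bring them all to the order eps^-2 for T
   and n eps^-3 for b. *)
have r1 k : 1 <= E ^+ k / eps ^+ k.
  by rewrite ler_pdivlMr ?exprn_gt0// mul1r; apply: lerXn2r => //; rewrite nnegrE ltW.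
have T1 : T%:R <= (E ^+ 2 + 6 * `|gap| / alpha) / eps ^+ 2.
  apply: le_trans hT _; rewrite [leRHS]mulrDl; apply: lerD => //.
  move: (eps ^+ 2) (exprn_gt0 2 e0) => y y0.
  by rewrite normrM normfV !normrM (gtr0_norm a0) (gtr0_norm y0) gtr0_norm// invfM mulrA.
have B1 : b%:R <= n%:R * (E ^+ 3 * (2 + bm%:R) + 3 * `|C1| * E + P) / eps ^+ 3.
  apply: le_trans hb _.
  have -> : n%:R * (E ^+ 3 * (2 + bm%:R) + 3 * `|C1| * E + P) / eps ^+ 3 =
     n%:R * (E ^+ 3 / eps ^+ 3) * (1 + bm%:R) + (n%:R * (E ^+ 3 / eps ^+ 3)
       + (n%:R * (3 * `|C1| / eps ^+ 2 * (E / eps)) + n%:R * P / eps ^+ 3)).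
    by field; rewrite gt_eqF.
  rewrite addrA; apply: lerD.
    rewrite -[leLHS]mul1r; apply: ler_wpM2r; first by rewrite addr_ge0.
    by rewrite -[leLHS]mulr1; apply: ler_pM.
  apply: lerD; first by rewrite -[leLHS]mulr1; apply: ler_wpM2l.
  rewrite lerD2r normrM normfV normrM (gtr0_norm (exprn_gt0 2 e0)) [`|3|]gtr0_norm//.
  have x0 : 0 <= 3 * `|C1| / eps ^+ 2 by apply: divr_ge0; [exact: mulr_ge0|exact: sqr_ge0].
  rewrite -[leLHS]mul1r; apply: ler_pM => //.
  by rewrite -[leLHS]mulr1; apply: ler_wpM2l => //; have := r1 1%N; rewrite !expr1.
have -> : (T * (b + 2 * (n * b) * bm))%:R = T%:R * b%:R * (1 + 2 * n%:R * bm%:R) :> R.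
  by rewrite !(natrM, natrD); ring.
have M1 : 1 + 2 * n%:R * bm%:R <= n%:R * (1 + 2 * bm%:R) :> R.
  by rewrite mulrDr mulr1 mulrCA mulrA lerD2r.
have bm0 : 0 <= bm%:R :> R by [].
apply: (@le_trans _ _ ((E ^+ 2 + 6 * `|gap| / alpha) / eps ^+ 2 *
    (n%:R * (E ^+ 3 * (2 + bm%:R) + 3 * `|C1| * E + P) / eps ^+ 3) * (n%:R * (1 + 2 * bm%:R)))).
  have TB : 0 <= T%:R * b%:R :> R by rewrite mulr_ge0.
  have M0 : 0 <= 1 + 2 * n%:R * bm%:R :> R by rewrite addr_ge0// !mulr_ge0.
  apply: (ler_pM TB M0 _ M1).
  exact: ler_pM.
rewrite /complexity_cst -/P le_eqVlt; apply/orP; left; apply/eqP.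
by field; rewrite !gt_eqF.
Qed.

End SampleComplexity.

(** [K] is chosen before the dimension, the accuracy and the model, so the implied constant of the
    complexity bound sees only its listed arguments. *)
Theorem proposition5 (R : realType) :
  exists K : R -> R -> R -> nat -> R -> R -> R,
  forall (n m d : nat) (M : model R n m d) (c : constants R)
    (sigma_max : R) (b_min : nat) (sigma_j L_b_H_j : 'I_m -> R)
    (alpha eps : R) (T b : nat) (theta0 : 'cV[R]_n)
    (nu : probability 'cV[R]_n R)
    (dO : measure_display) (Omega : measurableType dO)
    (P : probability Omega R),
  let b_sp := (n * b)%N in
  let delta := n%:R `^ (1 / 6) * b%:R `^ (- (1 / 6)) in
  let C1 := C1 c sigma_max in
  let C2' := C2' c sigma_max b_min in
  let gap := perf_loss M theta0 - perf_loss_inf M in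
  forall (X : @run R n d b b_sp b_min dO Omega)
    (Fpast Fdata Fdir : nat -> set (set Omega)),
  (0 < n)%N -> (0 < m)%N -> (0 < d)%N ->
  model_setting M ->
  assumption_A M delta sigma_max b_min ->
  valid_constants M c ->
  assumption_S M c delta sigma_max b_min sigma_j L_b_H_j ->
  0 < alpha -> alpha * L_L_sm c <= 1 ->
  0 < eps ->
  smallest_pos (fun T' => 6 * gap / (alpha * eps ^+ 2) <= T'%:R) T ->
  smallest_pos (fun b' =>
    Num.max b_min%:R (Num.max n%:R (Num.max (3 * C1 / eps ^+ 2)
      (n%:R * (3 * C2') `^ (3 / 2) / eps ^+ 3))) <= b'%:R) b ->
  Theta_sp M delta theta0 ->
  unif_sphere nu ->
  is_run M alpha delta P nu theta0 X Fpast Fdata Fdir ->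
  ((\sum_(t < T)
     \int[P]_w (enorm (gradmap M (Theta_sp M delta) alpha (theta X t w)) ^+ 2)%:E)
   * (T%:R^-1)%:E <= (eps ^+ 2)%:E)%E
  /\
  (forall eps_max : R, eps <= eps_max ->
   (T * (b + 2 * b_sp * b_min))%:R
     <= K eps_max alpha gap b_min C1 C2' * n%:R ^+ 2 / eps ^+ 5).
Proof.
exists complexity_cst => n m d M c s bm sj Hj alpha eps T b theta0 nu dO Omega P.
move=> b_sp delta C1 C2' gap X Fp Fd Fr n0 m0 d0 HS HA HC HU a0 aL e0 hT hb Th0 unu HR.
have [[Ll0 Ls0 Lb0] [Lbs0 _ LG0] [LGt0 Ml0 I0]] := cst_ge0 HC.
have [_ bm0 _] := A_Pred HA.
have [Tpos hT1 _] := hT; have [bpos + _] := hb.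
rewrite !ge_max => /and4P[b1 b2 b3 b4].
have bmb : (bm <= b)%N by rewrite -(ler_nat R).
have nb : (n <= b)%N by rewrite -(ler_nat R).
have bR : 0 < b%:R :> R by rewrite ltr0n.
have nR : 0 < n%:R :> R by rewrite ltr0n.
have TR : 0 < T%:R :> R by rewrite ltr0n.
have delta0 : 0 < delta by rewrite mulr_gt0// powR_gt0.
have dE : delta ^+ 6 = n%:R / b%:R by exact: radius_pow6.
(* From n <= b; this is what lets the fluctuation, of order delta^6, be absorbed into delta^4. *)
have delta1 : delta <= 1.
  by rewrite -(@expr_le1 _ 6) ?(ltW delta0)// dE ler_pdivrMr// mul1r.
have bsp0 : (0 < b_sp)%N by rewrite muln_gt0 n0.
have C20 : 0 <= C2'.
  apply: mulr_ge0; first by apply: mulr_ge0 => //; apply: mulr_ge0.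
  have x0 : 0 <= s ^+ 2 / bm%:R by rewrite divr_ge0// sqr_ge0.
  have := sqr_ge0 (L_b_H c); have := sqr_ge0 (L_b_Lip c).
  rewrite -[3 * s ^+ 2 / _]mulrA; lra.
have C10 : 0 <= C1.
  apply: mulr_ge0; last exact: sqr_ge0.
  by apply: mulr_ge0 => //; apply: addr_ge0; [apply: mulr_ge0 => //|]; exact: sqr_ge0.
split; last first.
  move=> E eE; apply: sample_complexity_le => //; first exact: smallest_pos_abs_le hT.
  have x0 : 0 <= 3 * C1 / eps ^+ 2 by apply: divr_ge0; [exact: mulr_ge0|exact: sqr_ge0].
  have y0 : 0 <= n%:R * (3 * C2') `^ (3 / 2) / eps ^+ 3.
    apply: divr_ge0; last by apply: exprn_ge0; exact: ltW.
    by apply: mulr_ge0 => //; exact: powR_ge0.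
  apply: le_trans (smallest_pos_le hb _) _; first by rewrite le_max ler0n.
  rewrite lerD2l (ger0_norm x0).
  move: (3 * C1 / _) (n%:R * _ / _) x0 y0 => x y x0 y0.
  have bmR := ler0n R bm; have nR0 := ltW nR.
  rewrite !ge_max; apply/and4P; split; lra.
have hs := @sum_gradmap_le R n m d M c s bm sj Hj alpha delta b b_sp nu HS HA HC HU
  delta0 n0 bsp0 bmb unu dO Omega P theta0 X Fp Fd Fr HR Th0 a0 aL T.
cbv zeta in hs; rewrite natrM in hs.
have bmR : 0 < bm%:R :> R by rewrite ltr0n.
have hB := error_budget (L_l_Lip c) (L_b_Lip c) (L_G_b c) (L_b_H c) s
  I0 Ml0 bmR nR bR delta0 delta1 dE.
rewrite -/(Defs.C1 c s) -/(Defs.C2' c s bm) -/C1 -/C2' in hB.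
have y0 : 0 < eps ^+ 2 by exact: exprn_gt0.
(* The target eps^2 is shared in thirds: the choice of b settles the data error and the Jacobian
   error ([h1], [h2]), the choice of T the telescoped decrease of the loss ([h3]). *)
have h1 : 3 * (C1 / b%:R) <= eps ^+ 2.
  by rewrite mulrA ler_pdivrMr// [eps ^+ 2 * _]mulrC -ler_pdivrMr.
have h2 := cube_rate_le delta0 e0 C20 bR dE b4.
have h3 : 2 / alpha * gap <= T%:R * (eps ^+ 2 / 3).
  move: hT1; rewrite ler_pdivrMr ?mulr_gt0// => h.
  rewrite mulrAC ler_pdivrMr//; move: h; move: (eps ^+ 2) => y h; lra.
have h4 : C1 / b%:R + C2' * delta ^+ 4 <= 2 * (eps ^+ 2 / 3).
  by move: h1 h2; move: (C1 / _) (C2' * _) (eps ^+ 2) => x y e; lra.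
have h5 := ler_wpM2l (ltW TR) (le_trans hB h4).
apply: (@le_trans _ _ ((T%:R * eps ^+ 2)%:E * (T%:R^-1)%:E)%E).
  apply: lee_wpmul2r; first by rewrite lee_fin invr_ge0.
  apply: le_trans hs _; rewrite lee_fin.
  apply: le_trans (lerD h3 h5) _; move: (eps ^+ 2) => y.
  by rewrite le_eqVlt; apply/orP; left; apply/eqP; field.
by rewrite -EFinM mulrAC mulfV ?gt_eqF// mul1r.
Qed.
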